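(* The fused $R$-matrix satisfies the crossing symmetry $$R^{(2,2)}(-u-1)=(Q^{-1}\otimes1)\,\left(P^{(2)}R^{(2,2)}(u)P^{(2)}\right)^{t_1}\,(Q\otimes1),$$ where $$Q=U^tU=\frac12\begin{pmatrix}1+\eta^2&0&1-\eta^2\\0&2\xi^2&0\\1-\eta^2&0&1+\eta^2\end{pmatrix},\qquad U=\begin{pmatrix}1&0&0\\0&\xi&0\\0&0&\eta\end{pmatrix}\begin{pmatrix}\frac1{\sqrt2}&0&\frac1{\sqrt2}\\0&1&0\\\frac1{\sqrt2}&0&-\frac1{\sqrt2}\end{pmatrix},$$ $$\xi^2=-\frac12\,\frac{\vartheta_0(0|\tau)\,\vartheta_3\left(\frac1r\big|\tau\right)}{\vartheta_0\left(\frac1r\big|\tau\right)\vartheta_3(0|\tau)},\qquad \eta^2=-\frac{\vartheta_2(0|\tau)\,\vartheta_3\left(\frac1r\big|\tau\right)}{\vartheta_2\left(\frac1r\big|\tau\right)\vartheta_3(0|\tau)},$$ and $P^{(2)}$ is the permutation operator $P^{(2)}(v^{(2)}_{\varepsilon_1}\otimes v^{(2)}_{\varepsilon_2})=v^{(2)}_{\varepsilon_2}\otimes v^{(2)}_{\varepsilon_1}$.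
   Context: Parameters: $K,K',\lambda$ are complex parameters, $x=e^{-\frac{\pi\lambda}{2K}}$, $\tau=\frac{2iK}{K'}$ with $\mathrm{Im}\,\tau>0$, $r=\frac{K'}{\lambda}$, $p=e^{-\pi K'/K}=e^{-2\pi i/\tau}=x^{2r}$, and $|x|<1$. Identities are between meromorphic functions of the spectral parameter $u$. Theta functions: with $\tilde p=e^{2\pi i\tau}$ and $(\tilde p;\tilde p)_\infty=\prod_{n\ge1}(1-\tilde p^n)$, $\vartheta_1(u|\tau)=2\tilde p^{1/8}(\tilde p;\tilde p)_\infty\sin\pi u\prod_{n=1}^\infty(1-2\tilde p^n\cos2\pi u+\tilde p^{2n})$, $\vartheta_0(u|\tau)=-ie^{\pi i(u+\tau/4)}\vartheta_1(u+\frac\tau2|\tau)$, $\vartheta_2(u|\tau)=\vartheta_1(u+\frac12|\tau)$, $\vartheta_3(u|\tau)=e^{\pi i(u+\tau/4)}\vartheta_1(u+\frac{\tau+1}2|\tau)$; in $\vartheta_i(\cdot|\frac{\tau}{2})$ one replaces $\tau$ by $\tau/2$ throughout. Baxter's $R$-matrix: $V=\mathbb{C}v_+\oplus\mathbb{C}v_-$; $R(u)\in\mathrm{End}(V\otimes V)$ is, in the ordered basis $v_+\otimes v_+,v_+\otimes v_-,v_-\otimes v_+,v_-\otimes v_-$, $$R(u)=R_0(u)\begin{pmatrix}a(u)&0&0&d(u)\\0&b(u)&c(u)&0\\0&c(u)&b(u)&0\\d(u)&0&0&a(u)\end{pmatrix},$$ where, with $\theta_i(k)=\vartheta_i(\frac{k}{2r}|\frac\tau2)$,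 $a(u)=\frac{\theta_2(1)\theta_2(u)}{\theta_2(0)\theta_2(1+u)}$, $b(u)=\frac{\theta_2(1)\theta_1(u)}{\theta_2(0)\theta_1(1+u)}$, $c(u)=\frac{\theta_1(1)\theta_2(u)}{\theta_2(0)\theta_1(1+u)}$, $d(u)=-\frac{\theta_1(1)\theta_1(u)}{\theta_2(0)\theta_2(1+u)}$, and with $z=x^{2u}$ (so $z^{s}=x^{2us}$), $(z;x^4,p)_\infty=\prod_{m,n\ge0}(1-zx^{4m}p^n)$, $$R_0(u)=z^{-\frac{r-1}{2r}}\frac{(px^2z;x^4,p)_\infty(x^2z;x^4,p)_\infty(p/z;x^4,p)_\infty(x^4/z;x^4,p)_\infty}{(px^2/z;x^4,p)_\infty(x^2/z;x^4,p)_\infty(pz;x^4,p)_\infty(x^4z;x^4,p)_\infty}.$$ Fusion: $P$ is the flip on $V\otimes V$, $\Pi=\frac12(P+\mathrm{id})$ is the projection on the space $V^{(2)}\subset V\otimes V$ of symmetric tensors, with basis $v^{(2)}_2=v_+\otimes v_+$, $v^{(2)}_0=\frac12(v_+\otimes v_-+v_-\otimes v_+)$, $v^{(2)}_{-2}=v_-\otimes v_-$. Let $V_1,V_2,V_{\bar1},V_{\bar2}$ be copies of $V$; subscripts of an operator indicate the tensor factors on which it acts. Put $R^{(2,1)}_{12,\bar j}(u)=\Pi_{12}R_{1\bar j}(u+1)R_{2\bar j}(u)$, which satisfies $R^{(2,1)}_{12,\bar j}(u)\Pi_{12}=R^{(2,1)}_{12,\bar j}(u)$ and is regarded as an operator on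 $V^{(2)}\otimes V_{\bar j}$. The $2\times2$ fused $R$-matrix is $R^{(2,2)}(u)=\Pi_{\bar1\bar2}R^{(2,1)}_{12,\bar2}(u)R^{(2,1)}_{12,\bar1}(u-1)$, regarded as an operator on $V^{(2)}\otimes V^{(2)}$. Conventions: $3\times3$ matrices act on $V^{(2)}$ in the ordered basis $v^{(2)}_2,v^{(2)}_0,v^{(2)}_{-2}$; ${}^{t_1}$ denotes transposition with respect to this basis in the first tensor factor, and $U^t$ is the transpose of $U$. *)

(* Defs.v *)
From mathcomp Require Import all_boot all_order all_algebra.
From mathcomp Require Import complex mxtens.
From mathcomp Require Import all_classical all_reals all_analysis.
Import Order.TTheory GRing.Theory Num.Theory.
Import numFieldNormedType.Exports.

Set Implicit Arguments.
Unset Strict Implicit.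
Unset Printing Implicit Defensive.

Local Open Scope ring_scope.
Local Open Scope complex_scope.

(* The limit is taken for the topology induced by the norm of F; below F is
   the field of complex numbers R[i], and all the products converge. *)
Definition infprod (F : numFieldType) (f : nat -> F) : F :=
  limn (fun N => \prod_(n < N) f n).

Section ComplexFunctions.
Variable R : realType.
Local Notation C := R[i].

Definition cpi : C := (pi : R)%:C.

Definition cexp (z : C) : C :=
  (expR (complex.Re z) * cos (complex.Im z))
    +i* (expR (complex.Re z) * sin (complex.Im z)).

Definition ccos (z : C) : C := (cexp ('i * z) + cexp (- ('i * z))) / 2.

Definition csin (z : C) : C := (cexp ('i * z) - cexp (- ('i * z))) / (2 * 'i).

Section Theta.
Variables u tau : C.

(* s-th power of the nome e^(2 pi i tau); fractional powers such as the
   prefactor of vartheta1 are determined by tau, not only by the nome. *)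
Definition nomeX (s : C) : C := cexp (2 * cpi * 'i * tau * s).

Definition vartheta1 : C :=
  2 * nomeX 8^-1 * infprod (fun n => 1 - nomeX 1 ^+ n.+1) * csin (cpi * u)
  * infprod (fun n => 1 - 2 * nomeX 1 ^+ n.+1 * ccos (2 * cpi * u)
                      + nomeX 1 ^+ (2 * n.+1)).

End Theta.

Definition vartheta0 (u tau : C) : C :=
  - 'i * cexp (cpi * 'i * (u + tau / 4)) * vartheta1 (u + tau / 2) tau.

Definition vartheta2 (u tau : C) : C := vartheta1 (u + 2^-1) tau.

Definition vartheta3 (u tau : C) : C :=
  cexp (cpi * 'i * (u + tau / 4)) * vartheta1 (u + (tau + 1) / 2) tau.

(* (z; q1, q2)_oo; the product is absolutely convergent for |q1|, |q2| < 1,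
   so that it may be computed iteratively. *)
Definition dqpoch (z q1 q2 : C) : C :=
  infprod (fun m => infprod (fun n => 1 - z * q1 ^+ m * q2 ^+ n)).

End ComplexFunctions.

Section Tensor.
Variable F : fieldType.

Definition mx_of_rows (m n : nat) (rows : seq (seq F)) : 'M[F]_(m, n) :=
  \matrix_(i, j) nth 0 (nth [::] rows i) j.

Definition flip_mx (n : nat) : 'M[F]_(n * n) :=
  \matrix_(i, j) (mxtens_unindex i ==
                  ((mxtens_unindex j).2, (mxtens_unindex j).1))%:R.

Definition ptrmx1 (m n : nat) (A : 'M[F]_(m * n)) : 'M[F]_(m * n) :=
  \matrix_(i, j)
    A (mxtens_index ((mxtens_unindex j).1, (mxtens_unindex i).2))
      (mxtens_index ((mxtens_unindex i).1, (mxtens_unindex j).2)).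

(* Four copies V_1, V_2, V_1bar, V_2bar of V, numbered 0, 1, 2, 3, with tensor
   product grouped as (V_1 (x) V_2) (x) (V_1bar (x) V_2bar). The basis vectors
   v_+, v_- of V have indices 0, 1; [site i k] is the index in the k-th factor
   of the i-th vector of the product basis. *)
Definition site (i : 'I_((2 * 2) * (2 * 2))) : 4.-tuple 'I_2 :=
  let l := mxtens_unindex (mxtens_unindex i).1 in
  let r := mxtens_unindex (mxtens_unindex i).2 in
  [tuple l.1; l.2; r.1; r.2].

(* The operator A on V (x) V acting on the k-th and l-th factors (k != l). *)
Definition act_on (k l : 'I_4) (A : 'M[F]_(2 * 2)) :
    'M[F]_((2 * 2) * (2 * 2)) :=
  \matrix_(i, j)
    (A (mxtens_index (tnth (site i) k, tnth (site i) l))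
       (mxtens_index (tnth (site j) k, tnth (site j) l))
     *+ [forall m, (m \notin [:: k; l]) ==>
                   (tnth (site i) m == tnth (site j) m)]).

Definition V1 : 'I_4 := inord 0.
Definition V2 : 'I_4 := inord 1.
Definition V1bar : 'I_4 := inord 2.
Definition V2bar : 'I_4 := inord 3.

Definition symproj : 'M[F]_(2 * 2) := 2^-1 *: (flip_mx 2 + 1%:M).

(* The columns are v^(2)_2, v^(2)_0, v^(2)_(-2). *)
Definition sym_basis : 'M[F]_(2 * 2, 3) :=
  mx_of_rows _ _ [:: [:: 1; 0;    0];
                     [:: 0; 2^-1; 0];
                     [:: 0; 2^-1; 0];
                     [:: 0; 0;    1]].

(* Coordinates, in that basis, of the symmetric part of a tensor. *)
Definition sym_coord : 'M[F]_(3, 2 * 2) :=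
  mx_of_rows _ _ [:: [:: 1; 0; 0; 0];
                     [:: 0; 1; 1; 0];
                     [:: 0; 0; 0; 1]].

(* Matrix of the restriction of A to V^(2) (x) V^(2), for an operator A that
   maps this subspace to itself. *)
Definition restr_sym (A : 'M[F]_((2 * 2) * (2 * 2))) : 'M[F]_(3 * 3) :=
  (sym_coord *t sym_coord) *m A *m (sym_basis *t sym_basis).

Lemma sym_basisK : 2 != 0 :> F -> sym_coord *m sym_basis = 1%:M.
Proof.
move=> two_neq0; apply/matrixP => i j; rewrite !mxE !big_ord_recl big_ord0 !mxE.
have half2 : 2^-1 + 2^-1 = 1 :> F by rewrite -mulr2n -[LHS]mulr_natr mulVf.
by case: i => [[|[|[|//]]] ?]; case: j => [[|[|[|//]]] ?];
  rewrite /= ?mul0r ?mul1r ?addr0 ?add0r ?half2.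
Qed.

Lemma sym_coordK : 2 != 0 :> F -> sym_basis *m sym_coord = symproj.
Proof.
move=> two_neq0; apply/matrixP => i j; rewrite !mxE !big_ord_recl big_ord0 !mxE.
have half2 : 2^-1 * (1 + 1) = 1 :> F by rewrite mulVf.
by case: i => [[|[|[|[|//]]]] ?]; case: j => [[|[|[|[|//]]]] ?];
  rewrite /= ?mul0r ?mulr0 ?mulr1 ?mul1r ?addr0 ?add0r
    ?half2 ?mulr0 ?mulr1 /=.
Qed.

End Tensor.

Section Model.
Variable R : realType.
Local Notation C := R[i].
Variables K K' lambda : C.

Definition tau : C := 2 * 'i * K / K'.

Definition rr : C := K' / lambda.

(* x^s for complex s, where x = e^(- pi lambda / (2 K)). *)
Definition xpow (s : C) : C := cexp (- (cpi R * lambda * s / (2 * K))).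

Definition xx : C := xpow 1.

Definition pp : C := cexp (- (cpi R * K' / K)).

Definition theta1 (k : C) : C := vartheta1 (k / (2 * rr)) (tau / 2).
Definition theta2 (k : C) : C := vartheta2 (k / (2 * rr)) (tau / 2).

Section RMatrix.
Variable u : C.

Definition Ra : C := theta2 1 * theta2 u / (theta2 0 * theta2 (1 + u)).
Definition Rb : C := theta2 1 * theta1 u / (theta2 0 * theta1 (1 + u)).
Definition Rc : C := theta1 1 * theta2 u / (theta2 0 * theta1 (1 + u)).
Definition Rd : C := - (theta1 1 * theta1 u / (theta2 0 * theta2 (1 + u))).

Let poch (z : C) : C := dqpoch z (xx ^+ 4) pp.
Let z : C := xpow (2 * u).

Definition R0_num : C :=
  poch (pp * xx ^+ 2 * z) * poch (xx ^+ 2 * z) * poch (pp / z)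
  * poch (xx ^+ 4 / z).

Definition R0_den : C :=
  poch (pp * xx ^+ 2 / z) * poch (xx ^+ 2 / z) * poch (pp * z)
  * poch (xx ^+ 4 * z).

(* The prefactor is z^s with s = - (r - 1) / (2 r), i.e. x^(2 u s). *)
Definition R0 : C :=
  xpow (2 * u * - ((rr - 1) / (2 * rr))) * (R0_num / R0_den).

Definition Rmx : 'M[C]_(2 * 2) :=
  R0 *: mx_of_rows _ _ [:: [:: Ra; 0;  0;  Rd];
                           [:: 0;  Rb; Rc; 0];
                           [:: 0;  Rc; Rb; 0];
                           [:: Rd; 0;  0;  Ra]].

(* R is meromorphic in u, whereas division by 0 yields 0 here: values of R are
   meaningful at the u where no denominator vanishes. The remaining constant
   denominator theta2 0 is nonzero as soon as Im tau > 0. *)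
Definition R_regular : bool :=
  [&& theta1 (1 + u) != 0, theta2 (1 + u) != 0 & R0_den != 0].

End RMatrix.

(* R^(2,1)_(12,j)(u), extended by the identity on the remaining factor. *)
Definition R21 (j : 'I_4) (u : C) : 'M[C]_((2 * 2) * (2 * 2)) :=
  act_on V1 V2 (symproj C) *m act_on V1 j (Rmx (u + 1)) *m act_on V2 j (Rmx u).

Definition R22 (u : C) : 'M[C]_(3 * 3) :=
  restr_sym (act_on V1bar V2bar (symproj C)
             *m R21 V2bar u *m R21 V1bar (u - 1)).

(* The points u, u + 1, u - 1 at which R is evaluated in R22 u. *)
Definition R22_regular (u : C) : bool :=
  [&& R_regular (u + 1), R_regular u & R_regular (u - 1)].

Definition xi_sq : C :=
  - 2^-1 * (vartheta0 0 tau * vartheta3 (1 / rr) tau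
            / (vartheta0 (1 / rr) tau * vartheta3 0 tau)).

Definition eta_sq : C :=
  - (vartheta2 0 tau * vartheta3 (1 / rr) tau
     / (vartheta2 (1 / rr) tau * vartheta3 0 tau)).

End Model.

Section Crossing.
Variable R : realType.
Local Notation C := R[i].
Variables xi eta : C.

Definition Umx : 'M[C]_3 :=
  let s := ((Num.sqrt (2 : R))^-1)%:C in
  mx_of_rows 3 3 [:: [:: 1; 0;  0];
                     [:: 0; xi; 0];
                     [:: 0; 0;  eta]]
  *m mx_of_rows 3 3 [:: [:: s; 0; s];
                        [:: 0; 1; 0];
                        [:: s; 0; - s]].

Definition Qmx : 'M[C]_3 := Umx^T *m Umx.

End Crossing.

(* Main.v *)
Require Import Defs.
From mathcomp Require Import all_boot all_order all_algebra.
From mathcomp Require Import complex mxtens.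
From mathcomp Require Import all_classical all_reals all_analysis.
From mathcomp Require Import ring lra zify.
Import Order.TTheory GRing.Theory Num.Theory.
Import numFieldNormedType.Exports.
Import ComplexField.Normc.

Set Implicit Arguments.
Unset Strict Implicit.
Unset Printing Implicit Defensive.

Local Open Scope ring_scope.
Local Open Scope complex_scope.

(* The theta functions are bilateral Gaussian sums by the Jacobi triple product
   (limit of the finite q-binomial theorem). Splitting a double sum by parity gives
   theta_1(x+y|tau/2) theta_1(x-y|tau/2) in terms of theta_2, theta_3 at modulus
   tau, and every quadratic relation between the weights a, b, c, d at u and u+1
   follows from this addition formula.

   R_0(u) lives on the nome p = exp(-2 pi i/tau) and the weights on the nome of
   tau/2, so crossing of the weights, (a, b, c, d)(-u-1) = (-b, -a, c, d)(u),
   needs the modular transformation of theta_1 theta_2. Jacobi's imaginary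
   transformation is only needed up to a constant factor: it is obtained from
   finite Fourier inversion on Z/(2M+1), letting M tend to infinity.

   Write L(e,f) for the 3x3 matrix by which R_1(u+1) R_2(u), with entry (e,f) in
   the barred factor, acts on symmetric tensors. The weight relations say that
   Q L'(e,f) = L(e,f)^t Q, with L' at the crossed parameters. Expanding R^(2,2) as
   a sum of L(e,f) L(e',f') (x) E, and using P R = R P and fusion to exchange the
   two tensor factors, this factorwise relation becomes the crossing symmetry. *)

(** * Elementary estimates *)

(** The relations to be proved are homogeneous: weights are ratios of theta functions, and crossing
    compares [theta1 * theta2] at [u] and at [1 + u]. The constants of the addition formula and of
    the modular transformation therefore cancel; in the latter, the Gaussian integral enters as a
    common factor [J M], eliminated between two base points.

    The form of Q is read off the weights: [(1 + eta^2) / 2] and [(1 - eta^2) / 2] are proportional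
    to minus the square of [theta1 1] and to the square of [theta2 1], which balances the diagonal
    relation; the mixed relations then give [xi^2].

    The factorwise relation can be assembled because two reversals match: [v -> - v - 1] exchanges
    the pairs [(u + 1, u)] and [(u, u - 1)] with those of the crossed matrix in opposite order, and
    transposition reverses the product of two blocks.

    Since division by 0 yields 0, nonvanishing has to be tracked: [vartheta0] and [vartheta2] at
    [1 / r] are denominators of [xi^2] and [eta^2], and [vartheta3] at [1 / r] makes Q
    invertible. *)

Section RealBounds.
Variable R : realType.
Implicit Types a b x : R.

(** This is [1 - a <= expR (- a)] multiplied by [expR a]. *)
Lemma expR_sub1_le a : expR a - 1 <= a * expR a.
Proof.
have := expR_ge1Dx (- a); rewrite -subr_ge0 => h.
have := mulr_ge0 h (expR_ge0 a).
rewrite expRN mulrBl mulVf ?gt_eqF ?expR_gt0//; lra.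
Qed.

Lemma normr_expR_sub1D_le a : `|expR a - 1 - a| <= a ^+ 2 * expR `|a|.
Proof.
have h1 := expR_ge1Dx a; have h2 := expR_sub1_le a.
rewrite ger0_norm; last by lra.
have [a0|a0] := leP 0 a.
  rewrite ger0_norm//; have := expR_gt0 a; nra.
have e1 : 1 <= expR `|a| by apply: le_trans (expR_ge1Dx _); have := normr_ge0 a; lra.
have : expR a <= 1 by rewrite expR_le1 ltW.
have := sqr_ge0 a; nra.
Qed.

Lemma sin_le_id x : 0 <= x -> sin x <= x.
Proof.
move=> x0; pose g (y : R) := y - sin y.
have dg (y : R) : is_derive y 1 g (1 - cos y) by apply: is_deriveB.
have cg : {within `[0, x], continuous g}%classic.
  apply: continuous_subspaceT => y; apply: differentiable_continuous.
  by apply/derivable1_diffP; have [] := dg y.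
have [c _] := MVT_segment x0 (fun y _ => dg y) cg.
rewrite /g sin0 !subr0 => e.
by rewrite -subr_ge0 e mulr_ge0// subr_ge0 cos_le1.
Qed.

Lemma normr_sin_le x : `|sin x| <= `|x|.
Proof.
wlog x0 : x / 0 <= x => [hw|].
  have [/hw//|/ltW x0] := leP 0 x.
  by rewrite -normrN -[leRHS]normrN -sinN; apply: hw; rewrite oppr_ge0.
rewrite (ger0_norm x0) ler_norml sin_le_id// andbT.
(* What is left is [- x <= sin x]: beyond 1 it follows from [sin x >= -1], below 1 from
   [sin x >= 0]. *)
have [x1|x1] := leP x 1; last by apply: le_trans (sin_geN1 x); lra.
have : 0 <= sin x; last by lra.
by apply: sin_ge0_pi; rewrite x0 (le_trans x1)//; have := pi_ge2 R; lra.
Qed.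

Lemma cos_half x : 1 - cos x = 2 * sin (x / 2) ^+ 2.
Proof.
rewrite {1}(_ : x = (x / 2) *+ 2); last by rewrite -mulr_natr divfK.
by rewrite cos_mulr2n sin2cos2; ring.
Qed.

Lemma cos_sub1_le x : 1 - cos x <= x ^+ 2 / 2.
Proof.
rewrite cos_half -[sin _ ^+ 2]real_normK ?num_real//.
have h := normr_sin_le (x / 2).
have : `|sin (x / 2)| ^+ 2 <= `|x / 2| ^+ 2 by rewrite lerXn2r ?nnegrE.
rewrite (real_normK (num_real (x / 2))); lra.
Qed.

Lemma cos_sub1_le_norm x : 1 - cos x <= `|x|.
Proof.
have h := cos_sub1_le x.
have [x1|x1] := leP `|x| 2.
  apply: le_trans h _; rewrite -(real_normK (num_real x)).
  have := normr_ge0 x; nra.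
have := cos_geN1 x; lra.
Qed.

(** For [x >= 0] the function [y^2 / 2 - y + sin y] vanishes at 0 and has derivative
    [y - (1 - cos y) >= 0]. *)
Lemma sin_sub_le x : `|sin x - x| <= x ^+ 2 / 2.
Proof.
wlog x0 : x / 0 <= x => [hw|].
  have [/hw//|/ltW x0] := leP 0 x.
  rewrite -sqrrN (_ : sin x - x = - (sin (- x) - - x)); last by rewrite sinN; ring.
  by rewrite normrN; apply: hw; rewrite oppr_ge0.
rewrite ler0_norm; last by rewrite subr_le0 sin_le_id.
pose g (y : R) := y ^+ 2 / 2 - y + sin y.
have dg (y : R) : is_derive y 1 g (y - 1 + cos y).
  apply: is_derive_eq; rewrite /GRing.scale/=; by field.
have cg : {within `[0, x], continuous g}%classic.
  apply: continuous_subspaceT => y; apply: differentiable_continuous.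
  by apply/derivable1_diffP; have [] := dg y.
have [c] := MVT_segment x0 (fun y _ => dg y) cg.
rewrite in_itv/= => /andP[c0 _]; rewrite /g sin0 => e.
have := cos_sub1_le_norm c; rewrite ger0_norm// => hc.
have : 0 <= (c - 1 + cos c) * (x - 0) by rewrite mulr_ge0//; lra.
rewrite -e expr0n/=; lra.
Qed.

End RealBounds.

(** * The complex exponential and its Taylor remainder *)

Section ComplexExponential.
Variable R : realType.
Local Notation C := R[i].
Implicit Types (z w : C) (x : R).

Lemma normr_normc z : `|z| = (normc z)%:C.
Proof. by []. Qed.

Lemma normc_ge0 z : 0 <= normc z.
Proof. by case: z => a b; exact: sqrtr_ge0. Qed.

Lemma normc_gt0 z : (0 < normc z) = (z != 0).
Proof.
rewrite lt_neqAle normc_ge0 andbT eq_sym; congr (~~ _).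
by apply/eqP/eqP => [/eq0_normc//|->]; exact: normc0.
Qed.

Lemma normc_real x : normc x%:C = `|x|.
Proof. by rewrite /= expr0n/= addr0 sqrtr_sqr. Qed.

Lemma normcX z n : normc (z ^+ n) = normc z ^+ n.
Proof. by elim: n => [|n ih]; rewrite ?expr0 ?normc1// !exprS normcM ih. Qed.

Lemma normc_sum (I : Type) (s : seq I) (P : pred I) (F : I -> C) :
  normc (\sum_(i <- s | P i) F i) <= \sum_(i <- s | P i) normc (F i).
Proof.
elim/big_ind2 : _ => [|x1 x2 y1 y2 h1 h2|//]; first by rewrite normc0.
by apply: le_trans (le_normcD _ _) (lerD h1 h2).
Qed.

Lemma normcB z w : normc (z - w) = normc (w - z).
Proof. by rewrite -normcN opprB. Qed.

Lemma normc_subD z w : normc z - normc w <= normc (z - w).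
Proof. by rewrite lerBlDr -{1}(subrK w z) le_normcD. Qed.

Lemma Re_le_normc z : `|complex.Re z| <= normc z.
Proof.
case: z => a b /=; rewrite -sqrtr_sqr ler_sqrt; first by rewrite lerDl sqr_ge0.
by rewrite addr_ge0 ?sqr_ge0.
Qed.

Lemma Im_le_normc z : `|complex.Im z| <= normc z.
Proof.
case: z => a b /=; rewrite -sqrtr_sqr ler_sqrt; first by rewrite lerDr sqr_ge0.
by rewrite addr_ge0 ?sqr_ge0.
Qed.

Lemma normc_le_ReIm z : normc z <= `|complex.Re z| + `|complex.Im z|.
Proof.
case: z => a b /=; rewrite -[leRHS]ger0_norm ?addr_ge0 ?normr_ge0//.
rewrite -sqrtr_sqr ler_sqrt ?sqr_ge0// sqrrD !real_normK ?num_real//.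
by rewrite -addrA lerD2l lerDr mulrn_wge0// mulr_ge0.
Qed.

Lemma normc_exp z : normc (cexp z) = expR (complex.Re z).
Proof.
rewrite /normc /cexp !exprMn -mulrDr cos2Dsin2 mulr1 sqrtr_sqr ger0_norm ?expR_ge0//.
Qed.

Lemma cexpD z w : cexp (z + w) = cexp z * cexp w.
Proof.
case: z w => [a b] [c d]; rewrite /cexp /= expRD cosD sinD.
by apply/eqP; rewrite eq_complex /=; apply/andP; split; apply/eqP; ring.
Qed.

Lemma cexp0 : cexp 0 = 1 :> C.
Proof. by rewrite /cexp /= expR0 cos0 sin0 mul1r mulr0. Qed.

Lemma cexp_neq0 z : cexp z != 0.
Proof. by rewrite -normc_gt0 normc_exp expR_gt0. Qed.

Lemma cexpN z : cexp (- z) = (cexp z)^-1.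
Proof.
by apply: (mulfI (cexp_neq0 z)); rewrite -cexpD subrr cexp0 divff// cexp_neq0.
Qed.

Lemma cexpB z w : cexp (z - w) = cexp z / cexp w.
Proof. by rewrite cexpD cexpN. Qed.

Lemma cexpMn z n : cexp (z *+ n) = cexp z ^+ n.
Proof. by elim: n => [|n ih]; rewrite ?mulr0n ?cexp0// mulrS exprS cexpD ih. Qed.

Lemma cexp_natl z n : cexp (n%:R * z) = cexp z ^+ n.
Proof. by rewrite mulr_natl cexpMn. Qed.

Lemma cexp_imag x : cexp ('i * x%:C) = cos x +i* sin x.
Proof.
have -> : 'i * x%:C = 0 +i* x.
  by apply/eqP; rewrite eq_complex/=; apply/andP; split; apply/eqP; ring.
by rewrite /cexp /= expR0 !mul1r.
Qed.

Lemma cexp_pi : cexp ('i * cpi R) = -1.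
Proof. by rewrite cexp_imag cospi sinpi complexr0 rmorphN. Qed.

Lemma cexp_halfpi : cexp ('i * cpi R / 2) = 'i.
Proof.
rewrite (_ : _ / 2 = 'i * (pi / 2)%:C).
  by rewrite cexp_imag cos_pihalf sin_pihalf.
by rewrite /cpi rmorphM/= fmorphV/= rmorph_nat mulrA.
Qed.

Lemma cexp_2pi_int (n : int) : cexp (2 * cpi R * 'i * n%:~R) = 1.
Proof.
have h (k : nat) : cexp (2 * cpi R * 'i * k%:R) = 1.
  have -> : 2 * cpi R * 'i * k%:R = (k * 2)%:R * ('i * cpi R).
    by rewrite natrM; ring.
  by rewrite cexp_natl cexp_pi mulnC exprM sqrrN expr1n expr1n.
by case: n => n; rewrite ?NegzE ?mulrNz ?mulrN ?cexpN -?pmulrn h ?invr1.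
Qed.

Lemma Re_le_abs z : complex.Re z <= normc z.
Proof. exact: le_trans (ler_norm _) (Re_le_normc z). Qed.

Lemma normc_cexp_sub1D_le z :
  normc (cexp z - 1 - z) <= 4 * normc z ^+ 2 * expR (normc z).
Proof.
case: z => a b.
have na : `|a| <= normc (a +i* b) := Re_le_normc (a +i* b).
have nb : `|b| <= normc (a +i* b) := Im_le_normc (a +i* b).
set n := normc _ in na nb *.
pose w := cos b +i* sin b.
(* With [w = exp(i b)] the remainder splits into the real one times [w], the cross term [a (w - 1)]
   and the imaginary one; they contribute 1, 2 and 1 to the constant 4. *)
have -> : cexp (a +i* b) - 1 - (a +i* b) =
    w * (expR a - 1 - a)%:C + a%:C * (w - 1) + (w - 1 - (0 +i* b)).
  by apply/eqP; rewrite eq_complex/=; apply/andP; split; apply/eqP; ring.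
have e0 := expR_ge0 n.
have e1 : 1 <= expR n.
  by apply: le_trans (expR_ge1Dx _); have := normc_ge0 (a +i* b); rewrite -/n; lra.
have hw : normc w = 1 by rewrite /w /= cos2Dsin2 sqrtr1.
have h1 : normc (w * (expR a - 1 - a)%:C) <= n ^+ 2 * expR n.
  rewrite normcM hw mul1r normc_real; apply: le_trans (normr_expR_sub1D_le a) _.
  rewrite -(real_normK (num_real a)) ler_pM ?expR_ge0 ?sqr_ge0 ?ler_expR//.
  by rewrite lerXn2r ?nnegrE// (le_trans _ na).
have h2 : normc (w - 1) <= 2 * `|b|.
  apply: le_trans (normc_le_ReIm _) _; rewrite /= subr0.
  have := normr_sin_le b; have := cos_sub1_le_norm b; have := cos_le1 b.
  move=> c1 hc hs; rewrite distrC (ger0_norm (x := 1 - cos b)); last by lra.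
  by move: hc hs; lra.
have h3 : normc (a%:C * (w - 1)) <= 2 * n ^+ 2.
  rewrite normcM normc_real; have := normr_ge0 a; have := normr_ge0 b.
  have := normc_ge0 (w - 1); nra.
have h4 : normc (w - 1 - (0 +i* b)) <= n ^+ 2.
  apply: le_trans (normc_le_ReIm _) _; rewrite /= !subr0.
  have := sin_sub_le b; have := cos_sub1_le b; have := cos_le1 b.
  rewrite -(real_normK (num_real b)).
  move=> ?; rewrite (distrC (cos b)) (ger0_norm (x := 1 - cos b)); last lra.
  have := normr_ge0 b; nra.
apply: le_trans (le_normcD _ _) _; have := le_normcD (w * (expR a - 1 - a)%:C) (a%:C * (w - 1)).
have := sqr_ge0 n; nra.
Qed.

End ComplexExponential.

(* R[i] carries no topology of its own in the libraries; it gets one as an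
   instance of a numFieldType. *)
Definition tends (F : numFieldType) (u : nat -> F) (l : F) : Prop :=
  (u @ \oo --> l)%classic.

Section Tends.
Variable F : numFieldType.
Implicit Types (u v : nat -> F) (l m : F).

Lemma tends_lim u l : tends u l -> limn u = l.
Proof. by apply: cvg_lim; exact: norm_hausdorff. Qed.

Lemma tends_uniq u l m : tends u l -> tends u m -> l = m.
Proof. by move=> /tends_lim <- /tends_lim. Qed.

Lemma tends_cst l : tends (fun=> l) l.
Proof. exact: cvg_cst. Qed.

Lemma tendsD u v l m : tends u l -> tends v m ->
  tends (fun n => u n + v n) (l + m).
Proof. exact: cvgD. Qed.

Lemma tendsM u v l m : tends u l -> tends v m ->
  tends (fun n => u n * v n) (l * m).
Proof. exact: cvgM. Qed.

Lemma tendsV u l : l != 0 -> tends u l -> tends (fun n => (u n)^-1) l^-1.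
Proof. exact: cvgV. Qed.

Lemma eq_tends u v l : u =1 v -> tends u l -> tends v l.
Proof. by move=> /funext ->. Qed.

Lemma tendsP u l : tends u l <->
  forall e : F, 0 < e -> exists N, forall n, (N <= n)%N -> `|u n - l| < e.
Proof.
split=> [/cvgrPdist_lt h e e0|h].
  by have [N _ hN] := h _ e0; exists N => n /hN; rewrite /= distrC.
apply/cvgrPdist_lt => e e0; have [N hN] := h _ e0.
by exists N => // n /= /hN; rewrite distrC.
Qed.

Lemma tends_comp u l (f : nat -> nat) : (forall n, n <= f n)%N ->
  tends u l -> tends (u \o f) l.
Proof.
move=> hf /tendsP hu; apply/tendsP => e /hu[N hN].
by exists N => n Nn; apply: hN; exact: leq_trans (hf n).
Qed.

End Tends.

(** * Unconditional sums and infinite products *)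

Section Convergence.
Variable R : realType.
Local Notation C := R[i].

Lemma tendsCP (u : nat -> C) (l : C) : tends u l <->
  forall e : R, 0 < e -> exists N, forall n, (N <= n)%N -> normc (u n - l) < e.
Proof.
rewrite tendsP; split=> h e e0.
  have : 0 < e%:C :> C by rewrite ltcR.
  by move=> /h[N hN]; exists N => n /hN; rewrite normr_normc ltcR.
have [/eqP ei er] : complex.Im e == 0 /\ 0 < complex.Re e.
  by move: e0; rewrite ltcE /= => /andP[].
have [N hN] := h _ er; exists N => n /hN.
by rewrite ltcE /= ei eqxx /=.
Qed.

Lemma normc_small0 (z : C) : (forall e : R, 0 < e -> normc z < e) -> z = 0.
Proof.
move=> h; apply/eqP; rewrite -[_ == _]negbK -normc_gt0; apply/negP => z0.
by have := h _ z0; rewrite ltxx.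
Qed.

Lemma cvgC_ReIm (u : nat -> C) (a b : R) :
  tends (fun n => complex.Re (u n)) a ->
  tends (fun n => complex.Im (u n)) b ->
  tends u (a +i* b).
Proof.
move=> /tendsP ha /tendsP hb; apply/tendsCP => e e0.
have e20 : 0 < e / 2 by lra.
have [N hN] := ha _ e20; have [M hM] := hb _ e20.
exists (maxn N M) => n; rewrite geq_max => /andP[/hN/= h1 /hM/= h2].
apply: le_lt_trans (normc_le_ReIm _) _.
by case: (u n) h1 h2 => x y /= h1 h2; lra.
Qed.

(** Completeness is taken from the reals: both parts are dominated by the norm, so their series
    converge absolutely. *)
Lemma series_abs_cvg (a : nat -> C) (M : R) :
  (forall N, \sum_(n < N) normc (a n) <= M) ->
  exists l, tends (fun N => \sum_(n < N) a n) l.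
Proof.
move=> hM.
have key (p : nat -> R) : (forall n, `|p n| <= normc (a n)) -> cvgn (series p).
  move=> hp; apply: normed_cvg; apply: nondecreasing_is_cvgn.
    by apply: nondecreasing_series => n _ _; exact: normr_ge0.
  exists M => _ [N _ <-]; rewrite /= seriesEord/=.
  by apply: le_trans (hM N); apply: ler_sum => i _; exact: hp.
have /cvg_ex[x hx] := key _ (fun n => Re_le_normc (a n)).
have /cvg_ex[y hy] := key _ (fun n => Im_le_normc (a n)).
exists (x +i* y); apply: cvgC_ReIm.
- suff -> : (fun n => complex.Re (\sum_(n0 < n) a n0)) = series (fun n => complex.Re (a n)) by [].
  apply/funext => n; rewrite /series/= big_mkord.
  by apply: (big_morph (@complex.Re R)) => // -[? ?] [].
- suff -> : (fun n => complex.Im (\sum_(n0 < n) a n0)) = series (fun n => complex.Im (a n)) by [].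
  apply/funext => n; rewrite /series/= big_mkord.
  by apply: (big_morph (@complex.Im R)) => // -[? ?] [].
Qed.

End Convergence.

Section Summation.
Variable R : realType.
Local Notation C := R[i].

Lemma ler_sum_sub (T : eqType) (f : T -> R) (A B : seq T) :
  (forall t, 0 <= f t) -> uniq A -> uniq B -> {subset B <= A} ->
  \sum_(t <- B) f t <= \sum_(t <- A) f t.
Proof.
move=> f0 uA uB sBA; rewrite [leRHS](bigID (mem B))/=.
have p : perm_eq [seq t <- A | t \in B] B.
  apply: uniq_perm => //; first exact: filter_uniq.
  by move=> t; rewrite mem_filter; case: (boolP (t \in B)) => // /sBA ->.
apply: le_trans (_ : \sum_(t <- [seq t <- A | t \in B]) f t <= _).
  by rewrite (perm_big _ p).
by rewrite big_filter lerDl sumr_ge0.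
Qed.

Lemma sum_subD (V : zmodType) (T : eqType) (f : T -> V) (A B : seq T) :
  uniq A -> uniq B -> {subset A <= B} ->
  \sum_(t <- B) f t = \sum_(t <- A) f t + \sum_(t <- B | t \notin A) f t.
Proof.
move=> uA uB sAB; rewrite (bigID (mem A))/= -big_filter; congr (_ + _).
apply: perm_big; apply: uniq_perm => //; first exact: filter_uniq.
by move=> t; rewrite mem_filter; case: (boolP (t \in A)) => // /sAB ->.
Qed.

(* Unconditional summation of a family indexed by T, along the finite subsets
   of T. *)
Definition hassum (T : eqType) (f : T -> C) (s : C) : Prop :=
  forall e : R, 0 < e -> exists A : seq T, forall B : seq T,
    uniq B -> {subset A <= B} -> normc (\sum_(t <- B) f t - s) < e.

Definition bsum (T : eqType) (f : T -> R) (M : R) : Prop :=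
  forall B : seq T, uniq B -> \sum_(t <- B) f t <= M.

Section OneType.
Variable T : eqType.
Implicit Types (f g : T -> C) (A B : seq T).

Lemma hassum_uniq f (s t : C) : hassum f s -> hassum f t -> s = t.
Proof.
move=> hs ht; apply/eqP; rewrite -subr_eq0; apply/eqP.
apply: normc_small0 => e e0; have e2 : 0 < e / 2 by lra.
have [A hA] := hs _ e2; have [B hB] := ht _ e2.
have u : uniq (undup (A ++ B)) by exact: undup_uniq.
have := hA _ u; have := hB _ u; set S := \sum_(_ <- _) _.
move=> h1 h2.
have {}h1 : normc (S - t) < e / 2.
  by apply: h1 => x; rewrite mem_undup mem_cat => ->; rewrite orbT.
have {}h2 : normc (S - s) < e / 2.
  by apply: h2 => x; rewrite mem_undup mem_cat => ->.
have -> : s - t = (S - t) - (S - s) by ring.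
by have := le_normcD (S - t) (- (S - s)); rewrite normcN; lra.
Qed.

Lemma eq_hassum f g s : f =1 g -> hassum f s -> hassum g s.
Proof. by move=> /funext ->. Qed.

Lemma hassum_fin f A : uniq A -> (forall t, t \notin A -> f t = 0) ->
  hassum f (\sum_(t <- A) f t).
Proof.
move=> uA f0 e e0; exists A => B uB sAB; rewrite (sum_subD f uA uB sAB).
by rewrite addrC addKr big1 ?normc0// => t /f0.
Qed.

Lemma hassumD f g s t : hassum f s -> hassum g t ->
  hassum (fun x => f x + g x) (s + t).
Proof.
move=> hs ht e e0; have e2 : 0 < e / 2 by lra.
have [A hA] := hs _ e2; have [B hB] := ht _ e2.
have sl : {subset A <= A ++ B} by move=> x xA; rewrite mem_cat xA.
have sr : {subset B <= A ++ B} by move=> x xA; rewrite mem_cat xA orbT.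
exists (A ++ B) => D uD sD; rewrite big_split/=.
have h1 := hA D uD (fun x xA => sD x (sl _ xA)).
have h2 := hB D uD (fun x xA => sD x (sr _ xA)).
set S1 := \sum_(_ <- _) _ in h1 *; set S2 := \sum_(_ <- _) g _ in h2 *.
have -> : S1 + S2 - (s + t) = (S1 - s) + (S2 - t) by ring.
by have := le_normcD (S1 - s) (S2 - t); lra.
Qed.

Lemma hassumZ f s (c : C) : hassum f s -> hassum (fun x => c * f x) (c * s).
Proof.
move=> hs e e0.
have c0 : 0 < normc c + 1 by have := normc_ge0 c; lra.
have [A hA] := hs _ (divr_gt0 e0 c0); exists A => B uB sB.
rewrite -mulr_sumr -mulrBr normcM.
have := hA B uB sB; set x := normc (_ - _); rewrite ltr_pdivlMr// => h.
have : 0 <= x := normc_ge0 _; nra.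
Qed.

Lemma hassum_sum (I : Type) (r : seq I) (F : I -> T -> C) (S : I -> C) :
  (forall i, hassum (F i) (S i)) ->
  hassum (fun t => \sum_(i <- r) F i t) (\sum_(i <- r) S i).
Proof.
move=> h; elim: r => [|i r ih].
  rewrite big_nil; have := @hassum_fin (fun=> 0) [::] isT (fun _ _ => erefl).
  by rewrite big_nil; apply: eq_hassum => t; rewrite big_nil.
rewrite big_cons; apply: eq_hassum (hassumD (h i) ih) => t.
by rewrite big_cons.
Qed.

Lemma hassum_normc_le f s M :
  hassum f s -> bsum (fun t => normc (f t)) M -> normc s <= M.
Proof.
move=> hs hM; apply/ler_addgt0Pr => e e0.
have [A hA] := hs _ e0.
have sA : {subset A <= undup A} by move=> x; rewrite mem_undup.
have := hA (undup A) (undup_uniq _) sA.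
have := hM _ (undup_uniq A); have := normc_sum (undup A) predT f.
set S := \sum_(_ <- _) f _ => h1 h2 h3.
by have := normc_subD s S; rewrite normcB; lra.
Qed.

(** A finite set whose sum comes within [e] of the supremum leaves less than [e] for any disjoint
    finite set. *)
Lemma bsum_tail (g : T -> R) M : (forall t, 0 <= g t) -> bsum g M ->
  forall e : R, 0 < e -> exists2 A, uniq A & forall B, uniq B ->
    (forall t, t \in B -> t \notin A) -> \sum_(t <- B) g t < e.
Proof.
move=> g0 hM e e0.
pose X := [set x | exists2 B, uniq B & x = \sum_(t <- B) g t]%classic.
have hX : has_sup X.
  split; first by exists 0, [::]; rewrite ?big_nil.
  by exists M => _ [B uB ->]; exact: hM.
have [_ [A uA ->] hA] := sup_adherent e0 hX.
exists A => // B uB dB.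
have : \sum_(t <- A ++ B) g t <= sup X.
  apply: ub_le_sup; first by case: hX.
  exists (A ++ B) => //; rewrite cat_uniq uA uB andbT/=.
  by apply/hasPn => t /dB.
rewrite big_cat/=; lra.
Qed.

Lemma bsum_hassum_nneg (g : T -> R) M : (forall t, 0 <= g t) -> bsum g M ->
  exists s : C, hassum (fun t => (g t)%:C) s.
Proof.
move=> g0 hM.
pose X := [set x | exists2 B, uniq B & x = \sum_(t <- B) g t]%classic.
have hX : has_sup X.
  split; first by exists 0, [::]; rewrite ?big_nil.
  by exists M => _ [B uB ->]; exact: hM.
exists (sup X)%:C => e e0.
have [_ [A uA ->] hA] := sup_adherent e0 hX.
exists A => B uB sAB; rewrite -rmorph_sum -rmorphB normc_real distrC ger0_norm.
  by have := ler_sum_sub g0 uB uA sAB; lra.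
by rewrite subr_ge0; apply: ub_le_sup; [case: hX|exists B].
Qed.

Lemma bsum_hassum f M : bsum (fun t => normc (f t)) M -> exists s, hassum f s.
Proof.
move=> hM.
have key (p : T -> R) : (forall t, `|p t| <= normc (f t)) ->
    exists s, hassum (fun t => (p t)%:C) s.
  move=> hp.
  have [|s hs] := @bsum_hassum_nneg (fun t => normc (f t)) M _ hM.
    by move=> t; exact: normc_ge0.
  (* [p] is the difference of the nonnegative families [|f|] and [|f| - p], the second bounded by
     [2 |f|]. *)
  have [||s' hs'] := @bsum_hassum_nneg (fun t => normc (f t) - p t) (2 * M).
  - by move=> t; have := hp t; rewrite ler_norml; lra.
  - move=> B uB; apply: le_trans (_ : \sum_(t <- B) 2 * normc (f t) <= _).
      by apply: ler_sum => t _; have := hp t; rewrite ler_norml; lra.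
    by rewrite -mulr_sumr; have := hM _ uB; lra.
  exists (s + -1 * s').
  apply: eq_hassum (hassumD hs (hassumZ (-1) hs')) => t.
  by rewrite rmorphB/=; ring.
have [s hs] := key _ (fun t => Re_le_normc (f t)).
have [s' hs'] := key _ (fun t => Im_le_normc (f t)).
exists (s + 'i * s'); apply: eq_hassum (hassumD hs (hassumZ 'i hs')) => t.
by rewrite -complexE.
Qed.

(** Dominated convergence. One finite set [A] leaves a small tail of [g], hence of every [F n] and
    of [f]; on [A] the convergence is termwise and finite. *)
Lemma hassum_dominated (F : nat -> T -> C) (f : T -> C) (g : T -> R)
    (S : nat -> C) (s : C) M :
  bsum g M -> (forall n t, normc (F n t) <= g t) ->
  (forall t, tends (fun n => F n t) (f t)) ->
  (forall n, hassum (F n) (S n)) -> hassum f s -> tends S s.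
Proof.
move=> hM hFg hFf hFS hfs; apply/tendsCP => e e0.
have g0 t : 0 <= g t by apply: le_trans (hFg 0%N t); exact: normc_ge0.
have e4 : 0 < e / 8 by lra.
have [A uA hA] := bsum_tail g0 hM e4.
have hfg t : normc (f t) <= g t.
  apply/ler_addgt0Pr => d d0; have /tendsCP/(_ _ d0)[N hN] := hFf t.
  have := hN N (leqnn N); have := hFg N t.
  have := normc_subD (f t) (F N t); rewrite normcB; lra.
have tail (h : T -> C) (r : C) : hassum h r -> (forall t, normc (h t) <= g t) ->
    normc (\sum_(t <- A) h t - r) < e / 4.
  move=> hr hhg; have [B hB] := hr _ e4.
  pose D := undup (A ++ B); have uD : uniq D by exact: undup_uniq.
  have sA : {subset A <= D} by move=> t tA; rewrite mem_undup mem_cat tA.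
  have sB : {subset B <= D} by move=> t tA; rewrite mem_undup mem_cat tA orbT.
  have := hB _ uD sB; rewrite (sum_subD h uA uD sA); set X := \sum_(_ <- A) _.
  rewrite -big_filter; set Y := \sum_(_ <- _) _ => h1.
  have h2 : normc Y < e / 8.
    apply: le_lt_trans (normc_sum _ _ _) _.
    apply: le_lt_trans (ler_sum _ (fun t _ => hhg t)) _.
    apply: hA; first exact: filter_uniq.
    by move=> t; rewrite mem_filter => /andP[].
  have -> : X - r = (X + Y - r) - Y by ring.
  by have := le_normcD (X + Y - r) (- Y); rewrite normcN; lra.
have cvA : tends (fun n => \sum_(t <- A) F n t) (\sum_(t <- A) f t).
  elim: (A) => [|t B ih]; first rewrite big_nil.
    by apply: eq_tends (@tends_cst C 0) => n; rewrite big_nil.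
  by rewrite big_cons; apply: eq_tends (tendsD (hFf t) ih) => n; rewrite big_cons.
have /tendsCP/(_ _ e4)[N hN] := cvA; exists N => n /hN h3.
have h1 := tail _ _ (hFS n) (hFg n); have h2 := tail _ _ hfs hfg.
set X := \sum_(_ <- A) F _ _ in h1 h3; set Y := \sum_(_ <- A) f _ in h2 h3.
have -> : S n - s = (X - Y) + (- (X - S n) + (Y - s)) by ring.
have := le_normcD (X - Y) (- (X - S n) + (Y - s)).
have := le_normcD (- (X - S n)) (Y - s); rewrite normcN; lra.
Qed.

End OneType.

(** Reindexing tool for shifts and reflections of the integers, parity classes of pairs, and
    multiples of [N]. The partial inverse [h] turns a finite set of [U] into one of [T], losing only
    zero terms. *)
Lemma hassum_inj (T U : eqType) (g : T -> U) (h : U -> option T)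
    (f : U -> C) (s : C) :
  pcancel g h -> ocancel h g -> (forall u, h u = None -> f u = 0) ->
  hassum (f \o g) s -> hassum f s.
Proof.
move=> gh hg f0 hs e e0; have [A hA] := hs _ e0.
exists (map g A) => B uB sB.
have -> : \sum_(u <- B) f u = \sum_(t <- pmap h B) (f \o g) t.
  elim: (B) => [|u B' ih]; first by rewrite !big_nil.
  rewrite big_cons ih /=; case E: (h u) => [t|] /=.
    by rewrite big_cons /=; have := hg u; rewrite E /= => ->.
  by rewrite f0// add0r.
apply: hA; first by apply: pmap_uniq uB.
move=> t tA; rewrite mem_pmap; apply/mapP; exists (g t); last by rewrite gh.
by apply: sB; exact: map_f.
Qed.

Lemma hassum_prod (T U : eqType) (f : T -> C) (g : U -> C) (s t : C) M N :
  bsum (fun x => normc (f x)) M -> bsum (fun x => normc (g x)) N ->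
  hassum f s -> hassum g t ->
  hassum (fun p : T * U => f p.1 * g p.2) (s * t).
Proof.
move=> hM hN hf hg e e0.
have hMs := hassum_normc_le hf hM; have hNt := hassum_normc_le hg hN.
have M0 : 0 <= M by have := hM [::] isT; rewrite big_nil.
have N0 : 0 <= N by have := hN [::] isT; rewrite big_nil.
(* The total error will be at most [d (1 + 2 M + 2 N)]; [d <= 1] bounds the product of two errors by
   [d]. *)
pose d := Num.min 1 (e / (4 * (M + N + 1))).
have K0 : 0 < 4 * (M + N + 1) by lra.
have d0 : 0 < d by rewrite lt_min ltr01 divr_gt0.
have d1 : d <= 1 by rewrite ge_min lexx.
have de : d * (4 * (M + N + 1)) <= e by rewrite -ler_pdivlMr// ge_min lexx orbT.
have [A1 uA1 hA1] := bsum_tail (fun x => normc_ge0 (f x)) hM d0.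
have [A2 uA2 hA2] := bsum_tail (fun x => normc_ge0 (g x)) hN d0.
have [B1 hB1] := hf _ d0; have [B2 hB2] := hg _ d0.
pose D1 := undup (A1 ++ B1); pose D2 := undup (A2 ++ B2).
have uD1 : uniq D1 by exact: undup_uniq.
have uD2 : uniq D2 by exact: undup_uniq.
have sA1 : {subset A1 <= D1} by move=> x xA; rewrite mem_undup mem_cat xA.
have sB1 : {subset B1 <= D1} by move=> x xA; rewrite mem_undup mem_cat xA orbT.
have sA2 : {subset A2 <= D2} by move=> x xA; rewrite mem_undup mem_cat xA.
have sB2 : {subset B2 <= D2} by move=> x xA; rewrite mem_undup mem_cat xA orbT.
have uD : uniq [seq (x, y) | x <- D1, y <- D2] by apply: allpairs_uniq => // -[? ?] [].
exists [seq (x, y) | x <- D1, y <- D2] => B uB sB.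
rewrite (sum_subD _ uD uB sB) big_allpairs_dep/=.
have -> : \sum_(i <- D1) \sum_(j <- D2) f i * g j = (\sum_(i <- D1) f i) * (\sum_(j <- D2) g j).
  by rewrite big_distrlr.
have h1 := hB1 _ uD1 sB1; have h2 := hB2 _ uD2 sB2.
set X := \sum_(_ <- D1) _ in h1 *; set Y := \sum_(_ <- D2) _ in h2 *.
rewrite -big_filter; set Z := \sum_(_ <- _) _.
have hZ : normc Z <= d * N + M * d.
  apply: le_trans (normc_sum _ _ _) _.
  pose E := [seq p <- B | p \notin [seq (x, y) | x <- D1, y <- D2]].
  have uE : uniq E by exact: filter_uniq.
  pose P1 := undup (map fst E); pose P2 := undup (map snd E).
  have uP1 : uniq P1 by exact: undup_uniq.
  have uP2 : uniq P2 by exact: undup_uniq.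
  pose G (p : T * U) := normc (f p.1) * normc (g p.2).
  rewrite (eq_bigr G); last by move=> p _; rewrite normcM.
  (* A pair outside the rectangle has its first entry off [D1], or else its second off [D2]; each
     part is enclosed in a rectangle with one small side. *)
  rewrite -/E (bigID (fun p => p.1 \in D1))/= addrC; apply: lerD.
  - rewrite -big_filter.
    apply: (@le_trans _ _ (\sum_(p <- [seq (x, y) | x <- [seq x <- P1 | x \notin D1], y <- P2]) G p)).
      apply: ler_sum_sub.
      + by move=> p; rewrite mulr_ge0 ?normc_ge0.
      + by apply: allpairs_uniq => // [|-[? ?] []//]; exact: filter_uniq.
      + exact: filter_uniq.
      + move=> [x y]; rewrite mem_filter => /andP[/= xD pE].
        apply/allpairsP; exists (x, y); rewrite /= mem_filter xD !mem_undup.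
        by split=> //; apply/mapP; exists (x, y).
    rewrite big_allpairs_dep/= /G/= -big_distrlr/= ler_pM//.
    + by apply: sumr_ge0 => x _; exact: normc_ge0.
    + by apply: sumr_ge0 => x _; exact: normc_ge0.
    + apply: ltW; apply: hA1; first exact: filter_uniq.
      by move=> x; rewrite mem_filter => /andP[xD _]; apply: contra xD => /sA1.
    + exact: hN.
  - rewrite -big_filter.
    apply: (@le_trans _ _ (\sum_(p <- [seq (x, y) | x <- P1, y <- [seq y <- P2 | y \notin D2]]) G p)).
      apply: ler_sum_sub.
      + by move=> p; rewrite mulr_ge0 ?normc_ge0.
      + by apply: allpairs_uniq => // [|-[? ?] []//]; exact: filter_uniq.
      + exact: filter_uniq.
      + move=> [x y]; rewrite mem_filter => /andP[/= xD pE].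
        have yD : y \notin D2.
          move: pE; rewrite mem_filter => /andP[+ _]; apply: contra => yD.
          by apply/allpairsP; exists (x, y).
        apply/allpairsP; exists (x, y); rewrite /= mem_filter yD !mem_undup.
        by split=> //; apply/mapP; exists (x, y).
    rewrite big_allpairs_dep/= /G/= -big_distrlr/= ler_pM//.
    + by apply: sumr_ge0 => x _; exact: normc_ge0.
    + by apply: sumr_ge0 => x _; exact: normc_ge0.
    + exact: hM.
    + apply: ltW; apply: hA2; first exact: filter_uniq.
      by move=> x; rewrite mem_filter => /andP[xD _]; apply: contra xD => /sA2.
have -> : X * Y + Z - s * t = ((X - s) * (Y - t) + ((X - s) * t + s * (Y - t))) + Z by ring.
apply: le_lt_trans (le_normcD _ _) _.
have := le_normcD ((X - s) * (Y - t)) ((X - s) * t + s * (Y - t)).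
have := le_normcD ((X - s) * t) (s * (Y - t)).
rewrite !normcM.
have := normc_ge0 (X - s); have := normc_ge0 (Y - t).
have := normc_ge0 s; have := normc_ge0 t.
move: (normc s) (normc t) (normc (X - s)) (normc (Y - t)) hMs hNt h1 h2.
move=> ns nt x y hs ht hx hy nt0 ns0 y0 x0.
have a1 : x * y <= d by nra.
have a2 : x * nt <= d * N by nra.
have a3 : ns * y <= M * d by nra.
nra.
Qed.

Lemma bsum_int (g : nat -> R) (f : int -> R) (M : R) :
  (forall n, 0 <= g n) -> (forall N, \sum_(n < N) g n <= M) ->
  (forall n, f n <= g `|n|%N) -> bsum f (2 * M).
Proof.
move=> g0 hM hf B uB.
have [N hN] : exists N, forall n, n \in B -> (`|n| < N)%N.
  by exists (\max_(n <- B) `|n|%N).+1 => n nB; rewrite ltnS; exact: leq_bigmax_seq.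
pose A := [seq Posz n | n <- iota 0 N] ++ [seq Negz n | n <- iota 0 N].
have uA : uniq A.
  rewrite cat_uniq !map_inj_uniq ?iota_uniq/= ?andbT//; try by move=> ? ? [].
  by apply/hasPn => _ /mapP[n _ ->]; apply/negP => /mapP[].
apply: (@le_trans _ _ (\sum_(n <- B) g `|n|%N)); first by apply: ler_sum.
apply: (@le_trans _ _ (\sum_(n <- A) g `|n|%N)).
  apply: ler_sum_sub => // n nB; rewrite mem_cat.
  have := hN _ nB; case: n {nB} => n /= hn; apply/orP; [left|right]; apply: map_f.
    by rewrite mem_iota.
  by rewrite mem_iota/= ltnW.
have -> : 2 * M = M + M by ring.
have e0 K : iota 0 K = index_iota 0 K by rewrite /index_iota subn0.
rewrite big_cat/= !big_map !e0 !big_mkord; apply: lerD => //.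
(* [Negz n] has absolute value [n.+1], so the negative half is a sum of [N.+1] terms without its
   first one. *)
apply: le_trans (hM N.+1).
by rewrite big_ord_recl lerDr.
Qed.

End Summation.

(** * Infinite products *)

Section InfiniteProducts.
Variable R : realType.
Local Notation C := R[i].

Lemma normc_prod1D_le (a : nat -> C) (s : seq nat) :
  normc (\prod_(n <- s) (1 + a n)) <= expR (\sum_(n <- s) normc (a n)).
Proof.
elim: s => [|n s ih]; first by rewrite !big_nil normc1 expR0.
rewrite !big_cons normcM expRD; apply: ler_pM => //; rewrite ?normc_ge0//.
apply: le_trans (le_normcD _ _) _; rewrite normc1; exact: expR_ge1Dx.
Qed.

Lemma normc_prod1D_sub1_le (a : nat -> C) (s : seq nat) :
  normc (\prod_(n <- s) (1 + a n) - 1) <= expR (\sum_(n <- s) normc (a n)) - 1.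
Proof.
elim: s => [|n s ih]; first by rewrite !big_nil subrr normc0 expR0 subrr.
rewrite !big_cons expRD; set P := \prod_(_ <- _) _ in ih *.
have hP := normc_prod1D_le a s; rewrite -/P in hP.
have -> : (1 + a n) * P - 1 = (P - 1) + a n * P by ring.
have := le_normcD (P - 1) (a n * P); rewrite normcM.
have := expR_ge1Dx (normc (a n)); have := normc_ge0 (a n).
move: (expR (\sum_(_ <- _) _)) (expR (normc (a n))) (normc P) (normc_ge0 P) hP ih.
move=> E E' p p0 hP ih a0 h1 h2; apply: le_trans h2 _.
have : normc (a n) * p <= (E' - 1) * E by apply: ler_pM => //; lra.
lra.
Qed.

(** The partial products satisfy [P N.+1 - P N = P N * a N] and are bounded by [expR M], so up to a
    constant they are partial sums of an absolutely convergent series. *)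
Lemma prod1D_tends (a : nat -> C) (M : R) :
  (forall N, \sum_(n < N) normc (a n) <= M) ->
  exists l, tends (fun N => \prod_(n < N) (1 + a n)) l.
Proof.
move=> hM; pose P N := \prod_(n < N) (1 + a n).
have hP N : normc (P N) <= expR M.
  rewrite /P -(big_mkord predT (fun n => 1 + a n)).
  apply: le_trans (normc_prod1D_le _ _) _.
  by rewrite ler_expR big_mkord.
have [N|l hl] := @series_abs_cvg _ (fun n => P n * a n) (expR M * M).
  apply: (@le_trans _ _ (\sum_(n < N) expR M * normc (a n))).
    by apply: ler_sum => n _; rewrite normcM ler_wpM2r ?normc_ge0.
  by rewrite -mulr_sumr ler_wpM2l ?expR_ge0.
exists (l + 1); apply: eq_tends (tendsD hl (@tends_cst C 1)) => N.
elim: N => [|N ih]; first by rewrite !big_ord0 add0r.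
by rewrite big_ord_recr/= addrAC ih [RHS]big_ord_recr/= -/(P N); ring.
Qed.

Lemma tends_normc_le (u : nat -> C) (l : C) M :
  tends u l -> (forall n, normc (u n) <= M) -> normc l <= M.
Proof.
move=> /tendsCP h hM; apply/ler_addgt0Pr => e /h[N hN].
have := hN N (leqnn N); have := hM N; have := normc_subD l (u N).
by rewrite normcB; lra.
Qed.

Lemma tends_bounded (u : nat -> C) (l : C) :
  tends u l -> exists M, forall n, normc (u n) <= M.
Proof.
move=> /tendsCP/(_ 1 ltr01)[N hN].
exists (normc l + 1 + \sum_(n < N) normc (u n)) => n.
have s0 (r : seq 'I_N) P : 0 <= \sum_(n <- r | P n) normc (u n).
  by apply: sumr_ge0 => ? _; exact: normc_ge0.
have [Nn|nN] := leqP N n.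
  have := hN _ Nn; have := normc_subD (u n) l; have := s0 (index_enum 'I_N) predT; lra.
rewrite (bigD1 (Ordinal nN))//=; have := s0 (index_enum 'I_N) (fun i => i != Ordinal nN).
have := normc_ge0 l; lra.
Qed.

Lemma tends_inv_bounded (u : nat -> C) (l : C) :
  l != 0 -> tends u l -> exists M, forall n, normc (u n)^-1 <= M.
Proof.
move=> l0 hu; have [M hM] := tends_bounded (tendsV l0 hu).
by exists M => n; have := hM n; rewrite normcV.
Qed.

(** Beyond some [K] the norms add up to less than 1/3, which keeps every product over [[K, N)]
    within 1/2 of 1; the finitely many earlier factors are nonzero. *)
Lemma prod1D_neq0 (a : nat -> C) (M : R) (l : C) :
  (forall N, \sum_(n < N) normc (a n) <= M) -> (forall n, 1 + a n != 0) ->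
  tends (fun N => \prod_(n < N) (1 + a n)) l -> l != 0.
Proof.
move=> hM a0 hl.
have bM : bsum (fun n => normc (a n)) M.
  move=> B uB; have [N hN] : exists N, forall n, n \in B -> (n < N)%N.
    by exists (\max_(n <- B) n).+1 => n nB; rewrite ltnS; exact: leq_bigmax_seq.
  apply: le_trans (hM N); rewrite -(big_mkord predT (fun n => normc (a n))).
  apply: ler_sum_sub; rewrite ?iota_uniq//; first by move=> n; exact: normc_ge0.
  by move=> n /hN nN; rewrite mem_index_iota.
have e0 : 0 < 3^-1 :> R by lra.
have [A uA hA] := bsum_tail (fun n => normc_ge0 (a n)) bM e0.
have [K hK] : exists K, forall n, n \in A -> (n < K)%N.
  by exists (\max_(n <- A) n).+1 => n nB; rewrite ltnS; exact: leq_bigmax_seq.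
have tail N : 1 / 2 <= normc (\prod_(K <= n < N) (1 + a n)).
  pose s := \sum_(K <= n < N) normc (a n).
  have h1 : s < 3^-1.
    apply: hA; first exact: iota_uniq.
    move=> n; rewrite mem_index_iota => /andP[Kn _].
    by apply/negP => /hK; rewrite ltnNge Kn.
  have h2 := normc_prod1D_sub1_le a (index_iota K N); rewrite -/s in h2.
  have h3 := expR_sub1_le s.
  have h4 : 0 <= s by apply: sumr_ge0 => n _; exact: normc_ge0.
  have h5 := normc_subD 1 (\prod_(K <= n < N) (1 + a n)).
  rewrite normcB normc1 in h5.
  (* [expR_sub1_le] gives [expR s <= 1 / (1 - s)], which is at most 3/2 for [s < 1/3]. *)
  have h6 : expR s <= 3 / 2 by have := expR_gt0 s; nra.
  by move: h1 h2 h5 h6; lra.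
have p0 : \prod_(n < K) (1 + a n) != 0 by apply/prodf_neq0 => i _.
have q0 : 0 < normc (\prod_(n < K) (1 + a n)) by rewrite normc_gt0.
rewrite -normc_gt0; apply: lt_le_trans (_ : normc (\prod_(n < K) (1 + a n)) / 2 <= _); first lra.
apply/ler_addgt0Pr => e e1; have /tendsCP/(_ _ e1)[N hN] := hl.
have := hN (maxn N K) (leq_maxl _ _).
have := normc_subD (\prod_(n < maxn N K) (1 + a n)) l.
rewrite -(big_mkord predT (fun n => 1 + a n)).
rewrite (@big_cat_nat _ _ _ K)/= ?leq_maxr// big_mkord [normc (_ * _)]normcM.
have := tail (maxn N K); set t := normc (\prod_(K <= _ < _) _).
set p := normc (\prod_(_ < K) _) in q0 *; move=> ht.
have hpt : p / 2 <= p * t by nra.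
by lra.
Qed.

Lemma geometric_sum_le (r : R) N : 0 <= r -> r < 1 -> \sum_(n < N) r ^+ n <= (1 - r)^-1.
Proof.
move=> r0 r1; have h : 0 < 1 - r by lra.
rewrite -(ler_pM2l h) mulfV ?gt_eqF// -[1 - r]opprB mulNr -subrX1 opprB.
by rewrite lerBlDr lerDl exprn_ge0.
Qed.

Section QProduct.
Variables (z q : C).
Hypothesis q1 : normc q < 1.

(** The q-Pochhammer symbol [(z; q)_oo]. *)
Definition qprod (z q : C) : C := infprod (fun n => 1 - z * q ^+ n).

Lemma qprod_sum_le N : \sum_(n < N) normc (- (z * q ^+ n)) <= normc z / (1 - normc q).
Proof.
under eq_bigr do rewrite normcN normcM normcX.
by rewrite -mulr_sumr ler_wpM2l ?normc_ge0// geometric_sum_le ?normc_ge0.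
Qed.

Lemma qprod_tends : tends (fun N => \prod_(n < N) (1 - z * q ^+ n)) (qprod z q).
Proof.
have [l hl] := @prod1D_tends (fun n => - (z * q ^+ n)) _ qprod_sum_le.
by rewrite /qprod /infprod (tends_lim hl).
Qed.

Lemma qprod_neq0 : (forall n, z * q ^+ n != 1) -> qprod z q != 0.
Proof.
move=> h; apply: (@prod1D_neq0 (fun n => - (z * q ^+ n)) _ _ qprod_sum_le _ qprod_tends).
by move=> n; rewrite subr_eq0 eq_sym.
Qed.

End QProduct.

Arguments qprod_tends z {q} q1.
Arguments qprod_neq0 {z q} q1.

Lemma infprodM (f g : nat -> C) (l m : C) :
  tends (fun N => \prod_(n < N) f n) l -> tends (fun N => \prod_(n < N) g n) m ->
  infprod (fun n => f n * g n) = l * m.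
Proof.
move=> hf hg; apply: tends_lim; apply: eq_tends (tendsM hf hg) => N.
by rewrite big_split.
Qed.

Lemma qprod_rec (z q : C) : normc q < 1 -> qprod z q = (1 - z) * qprod (z * q) q.
Proof.
move=> q1; have hs n : (n <= n.+1)%N by [].
have h1 := tends_comp hs (qprod_tends z q1).
apply: (tends_uniq h1); apply: eq_tends (tendsM (@tends_cst C (1 - z)) (qprod_tends _ q1)) => N.
rewrite /= big_ord_recl expr0 mulr1; congr (_ * _); apply: eq_bigr => i _.
by rewrite exprS mulrA.
Qed.

End InfiniteProducts.

Arguments qprod_tends {R} z {q} q1.
Arguments qprod_neq0 {R z q} q1.

(** * The triple product identity *)

Section QBinomial.
Variables (F : fieldType) (p : F).

(** Gaussian binomial coefficients, through the q-Pascal rule rather than a quotient, so that the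
    q-binomial theorem holds for every [p]. *)
Fixpoint qbin (m k : nat) : F :=
  match m, k with
  | _, 0%N => 1
  | 0%N, _.+1 => 0
  | m'.+1, k'.+1 => p ^+ k * qbin m' k + qbin m' k'
  end.

Lemma qbin_small m k : (m < k)%N -> qbin m k = 0.
Proof.
elim: m k => [|m ih] [|k]//= mk.
by rewrite !ih ?mulr0 ?addr0//; exact: leq_trans mk.
Qed.

Lemma qbin0 m : qbin m 0 = 1. Proof. by case: m. Qed.

(** Splitting off the factor with [j = 0] leaves the product of order [m] at [t * p]; comparing
    coefficients is then the q-Pascal rule. *)
Lemma qbinomial_theorem m (t : F) :
  \prod_(j < m) (1 + t * p ^+ j) = \sum_(k < m.+1) qbin m k * p ^+ 'C(k, 2) * t ^+ k.
Proof.
elim: m t => [|m ih] t.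
  by rewrite big_ord0 big_ord1 /= bin0n/= expr0 !mulr1.
rewrite big_ord_recl expr0 mulr1.
rewrite (eq_bigr (fun j : 'I_m => 1 + (t * p) * p ^+ j)); last first.
  by move=> j _; rewrite /= exprS mulrA.
rewrite ih mulrDl mul1r mulr_sumr.
rewrite big_ord_recl [RHS]big_ord_recl/= !qbin0 -addrA; congr (_ + _).
have -> : \sum_(i < m) qbin m (bump 0 i) * p ^+ 'C(bump 0 i, 2) * (t * p) ^+ bump 0 i =
  \sum_(i < m.+1) qbin m i.+1 * p ^+ 'C(i.+1, 2) * (t * p) ^+ i.+1.
  by rewrite big_ord_recr/= qbin_small// !mul0r addr0.
rewrite -big_split/=; apply: eq_bigr => i _.
rewrite /bump/= add1n binS bin1 exprD !exprMn !exprS; ring.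
Qed.

Definition qpoch n : F := \prod_(i < n) (1 - p ^+ i.+1).

Lemma qpochS n : qpoch n.+1 = qpoch n * (1 - p ^+ n.+1).
Proof. by rewrite /qpoch big_ord_recr. Qed.

(** Induction on [j + k]: the two Pascal terms add up through [p^(k+1) (1 - p^(j+1)) + (1 - p^(k+1))
    = 1 - p^(j+k+2)]. *)
Lemma qbin_qpoch j k : qbin (j + k) k * (qpoch j * qpoch k) = qpoch (j + k).
Proof.
have [n] := ubnP (j + k); elim: n j k => // n ih [|j] [|k] jk.
- by rewrite /qpoch !big_ord0 qbin0 !mulr1.
- rewrite add0n /=; rewrite qbin_small// mulr0 add0r.
  have := ih 0%N k; rewrite !add0n => /(_ jk).
  rewrite {1 3}/qpoch big_ord0 !mul1r => e.
  by rewrite {1}/qpoch big_ord0 mul1r qpochS mulrA e.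
- by rewrite addn0 qbin0 mul1r {2}/qpoch big_ord0 mulr1.
- rewrite addSn/=.
  have e1 : qbin (j + k.+1) k.+1 * (qpoch j * qpoch k.+1) = qpoch (j + k.+1).
    by apply: ih; move: jk; lia.
  have e2 : qbin (j + k.+1) k * (qpoch j.+1 * qpoch k) = qpoch (j + k.+1).
    by rewrite -addSnnS; apply: ih; move: jk; lia.
  transitivity (p ^+ k.+1 * (1 - p ^+ j.+1) * qpoch (j + k.+1) +
    (1 - p ^+ k.+1) * qpoch (j + k.+1)).
    by rewrite -{1}e1 -e2 !qpochS; ring.
  by rewrite [RHS]qpochS -addSn exprD; ring.
Qed.

End QBinomial.

(** * Bilateral Gaussian series *)

Section Gaussian.
Variable R : realType.
Local Notation C := R[i].

(** The bound is explicit in [c] because [c] will also be a mesh [h] tending to 0: multiplied by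
    [h], it stays bounded. *)
Lemma bsum_expR_absz (c : R) (f : int -> R) (K : R) : 0 < c -> 0 <= K ->
  (forall n, f n <= K * expR (- (c * `|n%:~R|))) ->
  bsum f (2 * (K * (1 + c^-1))).
Proof.
move=> c0 K0 hf.
have r1 : expR (- c) < 1 by rewrite expR_lt1 oppr_lt0.
(* [1 + c^-1] is the inverse of [c / (1 + c)], which is at most [1 - expR (- c)] because
   [expR c >= 1 + c]. *)
have hr : (1 - expR (- c))^-1 <= 1 + c^-1.
  have e : (1 + c^-1) = ((c / (1 + c)))^-1.
    by rewrite invf_div mulrDl mul1r divff ?gt_eqF// addrC.
  rewrite e lef_pV2 ?posrE ?divr_gt0//; try lra.
  rewrite ler_pdivrMr; last lra.
  have := expR_ge1Dx c; rewrite expRN.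
  have E0 := expR_gt0 c; have := mulVf (lt0r_neq0 E0).
  have : 0 < (expR c)^-1 by rewrite invr_gt0.
  nra.
apply: (@bsum_int _ (fun n => K * expR (- c) ^+ n)).
- by move=> n; rewrite mulr_ge0 ?exprn_ge0 ?expR_ge0.
- move=> N; rewrite -mulr_sumr ler_wpM2l//.
  by apply: le_trans (geometric_sum_le N (expR_ge0 _) r1) hr.
- move=> n; apply: le_trans (hf n) _.
  by rewrite ler_wpM2l// -expRM_natl mulrN ler_expR lerN2 natr_absz intr_norm mulrC.
Qed.

(** Nonnegativity of the square of [2 a |x| - (|b| + 1)]. Keeping [- |x|] aside trades the Gaussian
    for a plain exponential decay, whose lattice sums are geometric. *)
Lemma gauss_exponent_le (a b x : R) : 0 < a ->
  - a * x ^+ 2 + b * x <= (`|b| + 1) ^+ 2 / (4 * a) - `|x|.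
Proof.
move=> a0.
have h : 4 * a * (- a * x ^+ 2 + b * x + `|x|) <= (`|b| + 1) ^+ 2.
  have h1 : b * x <= `|b| * `|x| by rewrite -normrM ler_norm.
  have -> : x ^+ 2 = `|x| ^+ 2 by rewrite real_normK ?num_real.
  have := sqr_ge0 (2 * a * `|x| - (`|b| + 1)); nra.
rewrite lerBrDr ler_pdivlMr; last lra.
by rewrite mulrC.
Qed.

Definition gterm (al be : C) (n : int) : C := cexp (al * n%:~R ^+ 2 + be * n%:~R).

Lemma Re_mul_int (z : C) (n : int) :
  complex.Re (z * n%:~R) = complex.Re z * n%:~R.
Proof.
rewrite -(rmorph_int (real_complex R)); case: z => a b /=.
by rewrite mulr0 subr0.
Qed.

Lemma normc_gterm al be n :
  normc (gterm al be n) = expR (complex.Re al * n%:~R ^+ 2 + complex.Re be * n%:~R).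
Proof.
rewrite normc_exp -rmorphXn/=; congr expR.
have D (z w : C) : complex.Re (z + w) = complex.Re z + complex.Re w by case: z w => [? ?] [].
by rewrite D !Re_mul_int rmorphXn.
Qed.

Lemma normc_gterm_le al be : complex.Re al < 0 -> exists2 K, 0 <= K &
  forall n, normc (gterm al be n) <= K * expR (- (1 * `|n%:~R|)).
Proof.
move=> al0; have a0 : 0 < - complex.Re al by rewrite oppr_gt0.
exists (expR ((`|complex.Re be| + 1) ^+ 2 / (4 * - complex.Re al))) => [|n].
  exact: expR_ge0.
rewrite normc_gterm -expRD ler_expR mul1r -[complex.Re al in leLHS]opprK.
exact: gauss_exponent_le.
Qed.

Lemma bsum_gterm al be : complex.Re al < 0 ->
  exists M, bsum (fun n => normc (gterm al be n)) M.
Proof.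
move=> /(@normc_gterm_le _ be)[K K0 hK].
by exists (2 * (K * (1 + 1^-1))); apply: bsum_expR_absz.
Qed.

(* Equals theta_3 with nome exp(al), at the point where exp(2 pi i v) is
   exp(be). *)
Definition jsum (al be : C) : C := xget 0 [set s | hassum (gterm al be) s]%classic.

Lemma jsumP al be : complex.Re al < 0 -> hassum (gterm al be) (jsum al be).
Proof.
move=> al0; have [M hM] := bsum_gterm be al0.
have [s hs] := bsum_hassum hM.
by rewrite /jsum; case: xgetP => [y -> //|/(_ s)/(_ hs)].
Qed.

Lemma jsum_eq al be s : complex.Re al < 0 -> hassum (gterm al be) s -> jsum al be = s.
Proof. by move=> al0; apply: hassum_uniq; exact: jsumP. Qed.

Lemma hassum_shift (f : int -> C) (s : C) (k : int) :
  hassum f s -> hassum (fun n => f (n + k)) s.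
Proof.
move=> hf; apply: (@hassum_inj _ _ _ (fun n => n - k) (fun n => Some (n + k))) => //.
- by move=> n; rewrite /= subrK.
- by move=> n; rewrite /= addrK.
- by apply: eq_hassum hf => n /=; rewrite subrK.
Qed.

Lemma hassumN (f : int -> C) (s : C) : hassum f s -> hassum (fun n => f (- n)) s.
Proof.
move=> hf; apply: (@hassum_inj _ _ _ (fun n => - n) (fun n => Some (- n))) => //.
- by move=> n; rewrite /= opprK.
- by move=> n; rewrite /= opprK.
- by apply: eq_hassum hf => n /=; rewrite opprK.
Qed.

Lemma jsumN al be : complex.Re al < 0 -> jsum al (- be) = jsum al be.
Proof.
move=> al0; apply: jsum_eq => //; apply: eq_hassum (hassumN (jsumP be al0)) => n.
by rewrite /gterm rmorphN/=; congr cexp; ring.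
Qed.

(** Quasi-periodicity of theta series, from the shift [n -> n + 1] of the summation index. *)
Lemma jsum_shift al be : complex.Re al < 0 ->
  jsum al (be + 2 * al) = cexp (- al - be) * jsum al be.
Proof.
move=> al0; apply: jsum_eq => //.
apply: eq_hassum (hassumZ (cexp (- al - be)) (hassum_shift 1 (jsumP be al0))) => n.
by rewrite /gterm -cexpD rmorphD/=; congr cexp; ring.
Qed.

Lemma jsum_2pi al be : complex.Re al < 0 ->
  jsum al (be + 2 * cpi R * 'i) = jsum al be.
Proof.
move=> al0; apply: jsum_eq => //; apply: eq_hassum (jsumP be al0) => n.
by rewrite /gterm [in RHS]mulrDl addrA [RHS]cexpD cexp_2pi_int mulr1.
Qed.

End Gaussian.

Section TripleProduct.
Variable R : realType.
Local Notation C := R[i].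
Variables al be : C.
Hypothesis al0 : complex.Re al < 0.

Let p := cexp (al *+ 2).

Lemma normc_cexp_lt1 (z : C) : (normc (cexp z) < 1) = (complex.Re z < 0).
Proof. by rewrite normc_exp expR_lt1. Qed.

Let p1 : normc p < 1.
Proof. by rewrite /p cexpMn normcX exprn_ilt1// ?normc_ge0// normc_cexp_lt1. Qed.

Let pn n : p ^+ n.+1 != 1.
Proof.
apply/eqP => e; have : normc (p ^+ n.+1) < 1 by rewrite normcX exprn_ilt1 ?normc_ge0.
by rewrite e normc1 ltxx.
Qed.

Let qpochE n : qpoch p n = \prod_(i < n) (1 - p * p ^+ i).
Proof. by apply: eq_bigr => i _; rewrite exprS. Qed.

Lemma qpoch_neq0 n : qpoch p n != 0.
Proof. by apply/prodf_neq0 => i _; rewrite subr_eq0 eq_sym. Qed.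

Let qpoch_tends : tends (qpoch p) (qprod p p).
Proof. by apply: eq_tends (qprod_tends p p1) => n; rewrite qpochE. Qed.

Let qprodpp0 : qprod p p != 0.
Proof. by apply: qprod_neq0 => // n; rewrite -exprS. Qed.

(** The Gaussian binomial with upper index [2 N] and lower index [N + n], extended by 0 so that the
    finite identity of every order is a sum over all integers, as dominated convergence requires. *)
Let coef (N : nat) (n : int) : C :=
  if (`|n| <= N)%N then
    qpoch p (N + N) / (qpoch p `|(N%:Z + n)%R|%N * qpoch p `|(N%:Z - n)%R|%N)
  else 0.

Lemma coef_qbin (N : nat) (k : nat) : (k <= N + N)%N ->
  coef N (k%:Z - N%:Z) = qbin p (N + N) k.
Proof.
move=> kN; rewrite /coef ifT; last by lia.
have -> : `|(N%:Z + (k%:Z - N%:Z))%R|%N = k by lia.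
have -> : `|(N%:Z - (k%:Z - N%:Z))%R|%N = (N + N - k)%N by lia.
have := qbin_qpoch p (N + N - k) k; rewrite subnK// => <-.
by rewrite [qpoch p k * _]mulrC mulfK// mulf_neq0 ?qpoch_neq0.
Qed.

(** Each of the three q-factorials tends to [(p; p)_oo]. *)
Lemma coef_tends n : tends (fun N => coef N n) (qprod p p)^-1.
Proof.
have h (f : nat -> nat) : (forall m, exists N, forall k, (N <= k)%N -> (m <= f k)%N) ->
    tends (fun N => qpoch p (f N)) (qprod p p).
  move=> hf; apply/tendsCP => e e0; have /tendsCP/(_ _ e0)[m hm] := qpoch_tends.
  by have [N hN] := hf m; exists N => k /hN/hm.
have h1 : tends (fun N => qpoch p (N + N)) (qprod p p).
  by apply: h => m; exists m => k; lia.
have h2 : tends (fun N : nat => qpoch p `|(N%:Z + n)%R|%N) (qprod p p).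
  by apply: h => m; exists (m + `|n|)%N => k; lia.
have h3 : tends (fun N : nat => qpoch p `|(N%:Z - n)%R|%N) (qprod p p).
  by apply: h => m; exists (m + `|n|)%N => k; lia.
have h4 := tendsM h1 (tendsV (mulf_neq0 qprodpp0 qprodpp0) (tendsM h2 h3)).
have -> : (qprod p p)^-1 = qprod p p / (qprod p p * qprod p p).
  by field.
apply/tendsCP => e e0; have /tendsCP/(_ _ e0)[N hN] := h4.
exists (maxn N `|n|%N) => k; rewrite geq_max => /andP[/hN + nk].
by rewrite /coef nk.
Qed.

Lemma coef_bounded : exists2 K, 0 <= K & forall N n, normc (coef N n) <= K.
Proof.
have [M hM] := tends_bounded qpoch_tends.
have [K hK] := tends_inv_bounded qprodpp0 qpoch_tends.
have M0 : 0 <= M := le_trans (normc_ge0 _) (hM 0%N).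
have K0 : 0 <= K := le_trans (normc_ge0 _) (hK 0%N).
exists (M * (K * K)) => [|N n]; first by rewrite !mulr_ge0.
rewrite /coef; case: ifP => _; last by rewrite normc0 !mulr_ge0.
rewrite invfM !normcM; apply: ler_pM; rewrite ?mulr_ge0 ?normc_ge0//.
by apply: ler_pM; rewrite ?normc_ge0.
Qed.

Let q := cexp al.
Let w := cexp be.

Let bin2_double k : ('C(k, 2) * 2 + k = k * k)%N.
Proof. by elim: k => // k ih; rewrite binS bin1; move: ih; lia. Qed.

Lemma finite_triple_product N :
  hassum (fun n => coef N n * gterm al be n)
    ((\prod_(i < N) (1 - (- (q * w)) * p ^+ i)) *
     (\prod_(i < N) (1 - (- (q / w)) * p ^+ i))).
Proof.
pose A := [seq k%:Z - N%:Z | k <- iota 0 (N + N).+1].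
have uA : uniq A by rewrite map_inj_uniq ?iota_uniq// => x y; lia.
have := @hassum_fin _ _ (fun n => coef N n * gterm al be n) A uA.
set X := \sum_(_ <- _) _; set Y := _ * _ => h; suff <- : X = Y.
  apply: h => n nA; rewrite /coef; case: ifP => [nN|]; last by rewrite mul0r.
  case/negP: nA; apply/mapP; exists `|(n + N%:Z)%R|%N; last by lia.
  by rewrite mem_iota; lia.
have q0 : q != 0 := cexp_neq0 _; have w0 : w != 0 := cexp_neq0 _.
have pq : p = q ^+ 2 by rewrite /p cexpMn.
rewrite /X /A big_map -[iota 0 _]/(index_iota 0 (N + N).+1) big_mkord.
(* Since [p = q^2], the factors are [1 + w q^(2 j + 1 - 2 N)]. Those with [j >= N] are the
   [1 + q w p^i]; those with [j < N], in reverse order, are the [1 + (q / w) p^i], each multiplied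
   by [w / q^(2 i + 1)]. *)
pose t := w * q / q ^+ (2 * N).
have := qbinomial_theorem p (N + N) t.
have -> : \prod_(j < N + N) (1 + t * p ^+ j) = w ^+ N / q ^+ (N * N) * Y.
  rewrite big_split_ord/= mulrC.
  have -> : \prod_(i < N) (1 + t * p ^+ (N + i)) = \prod_(i < N) (1 - (- (q * w)) * p ^+ i).
    apply: eq_bigr => i _; rewrite mulNr opprK /t pq -!exprM mulnDr exprD; congr (1 + _).
    by field; rewrite expf_neq0.
  have -> : \prod_(i < N) (1 + t * p ^+ i) =
      w ^+ N / q ^+ (N * N) * \prod_(i < N) (1 - (- (q / w)) * p ^+ i).
    rewrite (reindex_inj rev_ord_inj)/=.
    (* The first [N] odd numbers add up to [N^2]. *)
    have -> : w ^+ N / q ^+ (N * N) = \prod_(i < N) (w / q ^+ (2 * i).+1).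
      elim: (N) => [|M ih].
        by rewrite big_ord0 expr0 invr1 mulr1.
      rewrite big_ord_recr/= -ih.
      have -> : (M.+1 * M.+1 = M * M + (2 * M).+1)%N by lia.
      by rewrite exprD exprSr; field; rewrite !expf_neq0.
    rewrite -big_split/=; apply: eq_bigr => i _.
    rewrite /t pq -!exprM.
    have -> : (2 * N = 2 * (N - i.+1) + (2 * i).+2)%N by have := ltn_ord i; lia.
    rewrite exprD !exprS; field.
    by rewrite !expf_neq0// w0 q0.
  by rewrite /Y; ring.
move=> e; have c0 : w ^+ N / q ^+ (N * N) != 0 by rewrite mulf_neq0 ?invr_neq0 ?expf_neq0.
apply: (mulfI c0); rewrite e mulr_sumr; apply: eq_bigr => -[k kN] _ /=.
have kN' : (k <= N + N)%N by rewrite -ltnS.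
rewrite (coef_qbin kN') mulrCA -[RHS]mulrA; congr (_ * _).
have -> : gterm al be (k%:Z - N%:Z) =
    q ^+ (k * k) * q ^+ (N * N) / q ^+ (2 * N * k) * (w ^+ k / w ^+ N).
  rewrite /gterm /q /w -!cexp_natl -cexpD -!cexpB -cexpD; congr cexp.
  by rewrite rmorphB/= -!pmulrn !natrM; ring.
have -> : q ^+ (k * k) = q ^+ (2 * 'C(k, 2)) * q ^+ k.
  by rewrite -exprD [(2 * _)%N]mulnC bin2_double.
have -> : t ^+ k = w ^+ k * q ^+ k / q ^+ (2 * N * k).
  by rewrite /t !exprMn exprVn -exprM.
by rewrite pq -exprM; field; rewrite !expf_neq0.
Qed.

Lemma triple_product :
  jsum al be = qprod p p * qprod (- (q * w)) p * qprod (- (q / w)) p.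
Proof.
have [K K0 hK] := coef_bounded.
have [M hM] := bsum_gterm be al0.
have h1 : tends (fun N => (\prod_(i < N) (1 - (- (q * w)) * p ^+ i)) *
     (\prod_(i < N) (1 - (- (q / w)) * p ^+ i)))
   ((qprod p p)^-1 * jsum al be).
  apply: (@hassum_dominated _ _ (fun N n => coef N n * gterm al be n)
    (fun n => (qprod p p)^-1 * gterm al be n) (fun n => K * normc (gterm al be n)) _ _ (K * M)).
  - by move=> B uB; rewrite -mulr_sumr ler_wpM2l// hM.
  - by move=> N n; rewrite normcM ler_wpM2r ?normc_ge0.
  - by move=> n; apply: tendsM (coef_tends n) (@tends_cst C _).
  - exact: finite_triple_product.
  - exact: hassumZ (jsumP be al0).
have h2 := tendsM (qprod_tends (- (q * w)) p1) (qprod_tends (- (q / w)) p1).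
by rewrite -mulrA -(tends_uniq h1 h2) mulVKf.
Qed.

End TripleProduct.

Lemma leq_mul2_doubleS k M : (k <= M)%N -> (2 * k <= M.*2.+1)%N.
Proof. by rewrite mul2n; move=> kM; apply: leqW; rewrite leq_double. Qed.

(** * Jacobi's imaginary transformation *)

Section TrigBounds.
Variable R : realType.
Implicit Types t x : R.

(** On [[0, 1]] the quadratic bound gives [t / 2]; beyond, [sin t > sin 1 >= 1/2] while
    [t <= pi / 2 < 2]. *)
Lemma sin_ge_quarter t : 0 <= t <= pi / 2 -> t / 4 <= sin t.
Proof.
move=> /andP[t0 t1].
have h1 (x : R) : 0 <= x <= 1 -> x / 2 <= sin x.
  move=> /andP[x0 x1]; have := sin_sub_le x; rewrite ler_norml => /andP[+ _].
  nra.
have [t2|t2] := leP t 1; first by have := h1 t; rewrite t0 t2 => /(_ isT); lra.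
have p2 := pihalf_lt2 R; have p1 := pihalf_ge1 R.
have : sin 1 < sin t.
  by rewrite ltr_sin ?in_itv/=; [|apply/andP; split; lra|apply/andP; split; lra].
have := h1 1; rewrite lexx ler01 => /(_ isT); lra.
Qed.

(** [1 - cos x = 2 sin(x / 2)^2] and [sin(|x| / 2) >= |x| / 8]. This will bound the Fourier
    multiplier of a second difference from below. *)
Lemma sub1_cos_ge x : `|x| <= pi -> x ^+ 2 / 32 <= 1 - cos x.
Proof.
move=> hx; rewrite -cos_norm cos_half -(real_normK (num_real x)).
have x0 := normr_ge0 x.
have h : `|x| / 2 / 4 <= sin (`|x| / 2) by apply: sin_ge_quarter; apply/andP; split; lra.
have : (`|x| / 2 / 4) ^+ 2 <= sin (`|x| / 2) ^+ 2 by rewrite lerXn2r ?nnegrE//; lra.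
lra.
Qed.

Lemma cos_eq1_lt2pi x : 0 < x < 2 * pi -> cos x != 1.
Proof.
move=> /andP[x0 x1].
have inj (y : R) : 0 < y -> y <= pi -> cos y != 1.
  move=> y0 y1; apply/eqP; rewrite -(@cos0 R) => /cos_inj e.
  have := pi_ge0 R => p0; rewrite !in_itv/= lexx p0 (ltW y0) y1 in e.
  by have := e isT isT; lra.
have [h|h] := leP x pi; first exact: inj.
have -> : cos x = cos (pi *+ 2 - x).
  by rewrite -[RHS]cosN opprB -[RHS]cosD2pi subrK.
by apply: inj; rewrite -mulr_natl; lra.
Qed.

End TrigBounds.

(** * Gaussian sums over lattices and finite Fourier inversion *)

Section GaussianLattice.
Variable R : realType.
Local Notation C := R[i].

Lemma cpi_neq0 : cpi R != 0.
Proof. by rewrite fmorph_eq0 gt_eqF// pi_gt0. Qed.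

Lemma sqr_ge_expR (x : R) : 0 <= x -> x ^+ 2 <= 2 * expR x.
Proof. by move=> x0; have := expR_ge1Dxn 1 x0; rewrite /= !factS fact0; lra. Qed.

Lemma root_of_unity_sum (N : nat) (n : int) : (0 < N)%N ->
  \sum_(k < N) cexp (2 * cpi R * 'i * (k%:R * n%:~R / N%:R)) =
  if (N%:Z %| n)%Z then N%:R else 0.
Proof.
move=> N0; have N0' : N%:R != 0 :> C by rewrite pnatr_eq0 -lt0n.
pose z := cexp (2 * cpi R * 'i * (n%:~R / N%:R)).
have e (k : nat) : cexp (2 * cpi R * 'i * (k%:R * n%:~R / N%:R)) = z ^+ k.
  by rewrite -cexp_natl; congr cexp; ring.
under eq_bigr do rewrite e.
have zN : z ^+ N = 1.
  rewrite -e -[RHS](cexp_2pi_int R n); congr cexp; congr (_ * _).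
  by field.
case: ifPn => [/dvdzP[m nm]|dn].
  have -> : z = 1.
    rewrite /z -[RHS](cexp_2pi_int R m); congr cexp; congr (_ * _).
    by rewrite nm rmorphM/= -pmulrn mulfK.
  by under eq_bigr do rewrite expr1n; rewrite sumr_const card_ord.
(* [z] equals [exp(2 pi i r / N)] with [r] the remainder of [n], and [0 < r < N]. *)
have z1 : z - 1 != 0.
  rewrite subr_eq0; apply/eqP => z1.
  pose r := `|(n %% N%:Z)%Z|%N.
  have rn : (n %% N%:Z)%Z = r%:Z by rewrite /r gez0_abs// modz_ge0// -lt0n.
  have rN : (r < N)%N by rewrite -ltz_nat -rn ltz_pmod.
  have r0 : (0 < r)%N.
    by rewrite lt0n; apply: contra dn => /eqP r0; apply/dvdz_mod0P; rewrite rn r0.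
  have : z = cexp (2 * cpi R * 'i * (r%:R / N%:R)).
    rewrite /z (divz_eq n N%:Z) rn rmorphD rmorphM/= -!pmulrn.
    rewrite (_ : (_ + r%:R) / N%:R = (n %/ N)%Z%:~R + r%:R / N%:R) ?mulrDr; last by field.
    by rewrite cexpD cexp_2pi_int mul1r.
  rewrite z1; set t := _ * (_ / _).
  have -> : t = 'i * (2 * pi * (r%:R / N%:R))%:C.
    by rewrite /t !rmorphM/= fmorphV/= !rmorph_nat /cpi; ring.
  rewrite cexp_imag => /(congr1 (@complex.Re R))/= h.
  have := @cos_eq1_lt2pi R (2 * pi * (r%:R / N%:R)); rewrite -h eqxx; case/(_ _)/negP => //.
  have p0 := pi_gt0 R; have rp : 0 < r%:R / N%:R :> R by rewrite divr_gt0 ?ltr0n.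
  apply/andP; split; first by rewrite mulr_gt0// mulr_gt0.
  by rewrite gtr_pMr ?mulr_gt0// ltr_pdivrMr ?ltr0n// mul1r ltr_nat.
by apply: (mulfI z1); rewrite mulr0 -subrX1 zN subrr.
Qed.

Variables al A tau : C.
Hypothesis al0 : complex.Re al < 0.
Hypothesis ReA : 0 < complex.Re A.
Hypothesis Atau : A * tau = cpi R * 'i.
Hypothesis Atau2 : A * tau ^+ 2 = al.

(** By the two relations on [A] and [tau], [phi (y + k tau) = phi y * exp(- 2 pi i k y - al k^2)]:
    translation by [k tau] is multiplication by a character. This is what produces the theta series
    [jsum al]. *)
Let phi (y : C) : C := cexp (- (A * y ^+ 2)).

Let a := complex.Re A.
Let nA := normc A.

Let phi_norm_le V (y : C) (x : R) : normc (y - x%:C) <= V ->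
  normc (phi y) <= expR (- a * x ^+ 2 + (2 * nA * V) * `|x| + nA * V ^+ 2).
Proof.
move=> hV; rewrite /phi normc_exp ler_expR.
set d := y - x%:C in hV; have d0 := normc_ge0 d.
have -> : - (A * y ^+ 2) = (- x ^+ 2)%:C * A + (- (A * (2 * x%:C * d + d ^+ 2))).
  by rewrite /d rmorphN rmorphXn/=; ring.
have D (z w : C) : complex.Re (z + w) = complex.Re z + complex.Re w by case: z w => [? ?] [].
rewrite D; have -> : complex.Re ((- x ^+ 2)%:C * A) = - a * x ^+ 2.
  by rewrite /a; case: (A) => ? ? /=; ring.
rewrite -addrA lerD2l; apply: le_trans (Re_le_abs _) _.
rewrite normcN normcM -/nA.
have n0 : 0 <= nA := normc_ge0 _.
have h : normc (2 * x%:C * d + d ^+ 2) <= 2 * `|x| * V + V ^+ 2.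
  apply: le_trans (le_normcD _ _) _; rewrite normcX !normcM normc_real.
  have -> : normc (2 : C) = 2 by rewrite -(rmorph_nat (real_complex R)) normc_real normr_nat.
  apply: lerD; first by rewrite ler_wpM2l// mulr_ge0.
  by rewrite lerXn2r ?nnegrE// (le_trans d0).
apply: le_trans (ler_wpM2l n0 h) _; nra.
Qed.

(** First-order expansion of [phi] in direction [s], uniform on a strip along the real axis. The
    factor [expR (- |x|)] makes the remainders summable over a lattice of mesh [h], at the price of
    one power of [h]. *)
Let taylor V rho : 0 <= V -> 0 <= rho -> exists2 K, 0 <= K &
  forall (y s : C) (x h : R), 0 < h <= 1 -> normc (y - x%:C) <= V -> normc s <= rho ->
  normc (phi (y + s * h%:C) - phi y - s * h%:C * (- (2 * A * y) * phi y))
    <= K * h ^+ 2 * expR (- `|x|).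
Proof.
move=> V0 rho0; have n0 : 0 <= nA := normc_ge0 _.
(* [phi (y + s h) = phi y * cexp z] with [|z| <= h (c1 + c2 |x|)]. The growth this allows is
   absorbed by the Gaussian; [b] collects the coefficients of [|x|] in the exponent. *)
pose c2 := 2 * nA * rho; pose c1 := 2 * nA * V * rho + nA * rho ^+ 2.
pose b := 2 * c2 + 2 * nA * V.
exists (9 * expR (2 * c1 + nA * V ^+ 2 + (`|b| + 1) ^+ 2 / (4 * a))).
  by rewrite mulr_ge0 ?expR_ge0.
move=> y s x h /andP[h0 h1] hV hs.
have c20 : 0 <= c2 by rewrite /c2 !mulr_ge0.
have c10 : 0 <= c1 by rewrite /c1 addr_ge0 ?mulr_ge0 ?sqr_ge0.
have s0 := normc_ge0 s; have x0 := normr_ge0 x.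
have q0 : 0 <= 2 * nA * V * rho by rewrite !mulr_ge0.
pose L := c1 + c2 * `|x|; have L0 : 0 <= L by rewrite /L; nra.
pose z := - (2 * A * y * (s * h%:C)) - A * (s * h%:C) ^+ 2.
have hsq : normc s ^+ 2 <= rho ^+ 2 by rewrite lerXn2r ?nnegrE.
have hz : normc z <= h * L.
  apply: le_trans (le_normcD _ _) _; rewrite !normcN [normc (A * _ ^+ 2)]normcM normcX !normcM normc_real.
  have -> : normc (2 : C) = 2 by rewrite -(rmorph_nat (real_complex R)) normc_real normr_nat.
  rewrite (ger0_norm (ltW h0)) -/nA exprMn.
  have hy : normc y <= V + `|x|.
    have := le_normcD (y - x%:C) x%:C; rewrite subrK normc_real; lra.
  have y0 := normc_ge0 y.
  have e1 : nA * normc y * normc s <= nA * ((V + `|x|) * rho).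
    by rewrite -mulrA ler_wpM2l// ler_pM.
  have e2 : nA * (normc s ^+ 2 * h ^+ 2) <= nA * (rho ^+ 2 * h).
    by rewrite ler_wpM2l// ler_pM ?sqr_ge0//; nra.
  have := ler_wpM2r (ltW h0) e1; rewrite /L /c1 /c2; nra.
have -> : phi (y + s * h%:C) - phi y - s * h%:C * (- (2 * A * y) * phi y) =
    phi y * ((cexp z - 1 - z) - A * s ^+ 2 * (h ^+ 2)%:C).
  have -> : phi (y + s * h%:C) = phi y * cexp z.
    by rewrite /phi -cexpD; congr cexp; rewrite /z; ring.
  by rewrite /z rmorphXn/=; ring.
have E2 : 1 <= expR (2 * L) by apply: le_trans (expR_ge1Dx _); lra.
have hb : normc ((cexp z - 1 - z) - A * s ^+ 2 * (h ^+ 2)%:C) <= 9 * h ^+ 2 * expR (2 * L).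
  apply: le_trans (le_normcD _ _) _; rewrite normcN (normcM _ (_%:C)) normcM normcX normc_real -/nA.
  rewrite (ger0_norm (sqr_ge0 h)).
  have f1 : normc (cexp z - 1 - z) <= 8 * h ^+ 2 * expR (2 * L).
    apply: le_trans (normc_cexp_sub1D_le z) _.
    have z0 := normc_ge0 z.
    have g1 : normc z ^+ 2 <= h ^+ 2 * L ^+ 2 by rewrite -exprMn lerXn2r ?nnegrE// mulr_ge0// ltW.
    have g2 : expR (normc z) <= expR L by rewrite ler_expR; nra.
    have g3 := sqr_ge_expR L0.
    have g4 : expR (2 * L) = expR L * expR L by rewrite -expRD; congr expR; ring.
    have E0 := expR_ge0 L.
    have h20 := sqr_ge0 h.
    have g5 : normc z ^+ 2 * expR (normc z) <= h ^+ 2 * L ^+ 2 * expR L.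
      by rewrite ler_pM ?sqr_ge0 ?expR_ge0.
    have g6 : h ^+ 2 * L ^+ 2 * expR L <= h ^+ 2 * (2 * expR L) * expR L.
      by rewrite ler_wpM2r// ler_wpM2l.
    rewrite g4; nra.
  have f2 : nA * normc s ^+ 2 * h ^+ 2 <= h ^+ 2 * expR (2 * L).
    rewrite mulrC ler_wpM2l ?sqr_ge0//.
    have : nA * normc s ^+ 2 <= nA * rho ^+ 2 by rewrite ler_wpM2l.
    have := expR_ge1Dx (2 * L).
    have : nA * rho ^+ 2 <= L by rewrite /L /c1; have := mulr_ge0 c20 x0; have := q0; lra.
    lra.
  lra.
rewrite normcM; have p0 := normc_ge0 (phi y).
apply: le_trans (ler_pM p0 (normc_ge0 _) (phi_norm_le hV) hb) _.
have -> : forall u v w : R, u * (9 * v * w) = 9 * v * (u * w) by move=> *; ring.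
have -> : forall u v w : R, 9 * u * v * w = 9 * v * (u * w) by move=> *; ring.
apply: ler_wpM2l; first by rewrite mulr_ge0 ?sqr_ge0.
rewrite -!expRD ler_expR.
have := gauss_exponent_le b `|x| ReA; rewrite -/a normr_id real_normK ?num_real// /L /b.
lra.
Qed.

(* The sum of phi over the lattice v + h Z. *)
Let gsum (v : C) (h : R) : C :=
  cexp (- (A * v ^+ 2)) * jsum (- A * (h ^+ 2)%:C) (- (2 * A * v * h%:C)).

Let gsumP v h : 0 < h -> hassum (fun n => phi (v + n%:~R * h%:C)) (gsum v h).
Proof.
move=> h0; have ah0 : complex.Re (- A * (h ^+ 2)%:C) < 0.
  have -> : complex.Re (- A * (h ^+ 2)%:C) = - (complex.Re A * h ^+ 2).
    by case: (A) => ? ? /=; ring.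
  by rewrite oppr_lt0 mulr_gt0// exprn_gt0.
apply: eq_hassum (hassumZ _ (jsumP _ ah0)) => n.
by rewrite /gterm -cexpD /phi; congr cexp; rewrite rmorphXn/=; ring.
Qed.

Let reC (n : int) (h : R) : n%:~R * h%:C = (n%:~R * h)%:C :> C.
Proof. by rewrite rmorphM/= rmorph_int. Qed.

(** The lattice has about [1 / h] points per unit length, which the factor [h] compensates. *)
Let bound_step (h K : R) (f : int -> C) (s : C) : 0 < h <= 1 -> 0 <= K ->
  hassum f s -> (forall n, normc (f n) <= K * expR (- `|n%:~R * h|)) ->
  h * normc s <= 4 * K.
Proof.
move=> /andP[h0 h1] K0 hs hf.
have hb : bsum (fun n => normc (f n)) (2 * (K * (1 + h^-1))).
  apply: bsum_expR_absz => // n; apply: le_trans (hf n) _.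
  by rewrite normrM (ger0_norm (ltW h0)) [_ * h]mulrC.
have := ler_wpM2l (ltW h0) (hassum_normc_le hs hb).
have := mulfV (lt0r_neq0 h0); set w := h^-1 => e.
have -> : h * (2 * (K * (1 + w))) = 2 * K * h + 2 * K * (h * w) by ring.
rewrite e; nra.
Qed.

Let gsum_step V rho : 0 <= V -> 0 <= rho -> exists2 K, 0 <= K &
  forall (v s : C) (h : R), 0 < h <= 1 -> normc v <= V -> normc s <= rho ->
  normc (gsum (v + s * h%:C) h - gsum v h) <= K * h.
Proof.
move=> V0 rho0; have r0 : 0 <= rho + 1 by lra.
have [K K0 hK] := taylor V0 r0.
exists (4 * (K * (1 + rho))) => [|v s h hh hv hs]; first by rewrite !mulr_ge0//; lra.
have /andP[h0 h1] := hh.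
(* The last term is [- s] times a discrete derivative, whose lattice sum is 0 by invariance under
   [n -> n + 1]. It cancels the linear Taylor term, so each [d n] is of order [h^2]. *)
pose d (n : int) := phi (v + s * h%:C + n%:~R * h%:C) + -1 * phi (v + n%:~R * h%:C)
  + (- s) * (phi (v + (n + 1)%:~R * h%:C) + -1 * phi (v + n%:~R * h%:C)).
have hd : hassum d (gsum (v + s * h%:C) h - gsum v h).
  have g1 := gsumP v h0; have g2 := hassum_shift 1 g1.
  have := hassumD (hassumD (gsumP (v + s * h%:C) h0) (hassumZ (-1) g1))
    (hassumZ (- s) (hassumD g2 (hassumZ (-1) g1))).
  by rewrite !mulN1r subrr mulr0 addr0.
have K1 : 0 <= K * (1 + rho) * h ^+ 2 by rewrite !mulr_ge0 ?sqr_ge0//; lra.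
have H := bound_step hh K1 hd; rewrite -(ler_pM2l h0).
have -> : h * (4 * (K * (1 + rho)) * h) = 4 * (K * (1 + rho) * h ^+ 2) by ring.
apply: H => n; rewrite /d; set y := v + n%:~R * h%:C.
have hy : normc (y - (n%:~R * h)%:C) <= V by rewrite /y reC addrK.
have hs' : normc s <= rho + 1 by lra.
have h1' : normc (1 : C) <= rho + 1 by rewrite normc1; lra.
have t1 := hK y s _ h hh hy hs'; have t2 := hK y 1 _ h hh hy h1'.
have -> : v + s * h%:C + n%:~R * h%:C = y + s * h%:C by rewrite /y; ring.
have -> : v + (n + 1)%:~R * h%:C = y + 1 * h%:C by rewrite /y rmorphD/=; ring.
set p1 := phi (y + s * _) in t1 *; set p2 := phi (y + 1 * _) in t2 *.
set p0 := phi y in t1 t2 *; set q := - (2 * A * y) * p0 in t1 t2.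
have -> : p1 + -1 * p0 + - s * (p2 + -1 * p0) =
  (p1 - p0 - s * h%:C * q) - s * (p2 - p0 - 1 * h%:C * q) by ring.
apply: le_trans (le_normcD _ _) _; rewrite normcN normcM.
have := ler_pM (normc_ge0 s) (normc_ge0 _) hs t2.
have := normc_ge0 s; nra.
Qed.

(** The denominator [2 M + 1] is odd so that [[-M, M]] is a complete system of residues. *)
Let hN (M : nat) : R := (M.*2.+1)%:R^-1.

Let hN01 M : 0 < hN M <= 1.
Proof. by rewrite invr_gt0 ltr0n/= invf_le1 ?ltr0n// ler1n. Qed.

Let hNK M : (M.*2.+1)%:R * (hN M)%:C = 1 :> C.
Proof. by rewrite fmorphV/= rmorph_nat mulfV// pnatr_eq0. Qed.

(* As h tends to 0, h * gsum v h is a Riemann sum of the Gaussian integral, hence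
   asymptotically independent of v. *)
Let gsum_const w : exists2 K, 0 <= K & forall M,
  normc ((hN M)%:C * (gsum w (hN M) - gsum 0 (hN M))) <= K * hN M.
Proof.
have [K K0 hK] := gsum_step (normc_ge0 w) (normc_ge0 w).
exists K => // M; have /andP[h0 h1] := hN01 M; set h := hN M in h0 h1 *.
have e : (M.*2.+1)%:R * h = 1 by rewrite /h /hN mulfV// pnatr_eq0.
(* From 0 to [w] in [2 M + 1] steps [w h], each changing the sum by at most [K h]: the total change
   is at most [K], and the outer factor [h] makes it small. *)
have ind j : (j <= M.*2.+1)%N ->
    normc (gsum (j%:R * (w * h%:C)) h - gsum 0 h) <= j%:R * (K * h).
  elim: j => [|j ih] jM; first by rewrite !mul0r subrr normc0.
  have {}ih := ih (ltnW jM).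
  have hv : normc (j%:R * (w * h%:C)) <= normc w.
    rewrite mulrCA normcM -[leRHS]mulr1 ler_wpM2l ?normc_ge0//.
    rewrite -(rmorph_nat (real_complex R)) -rmorphM normc_real (ger0_norm (mulr_ge0 (ler0n _ _) (ltW h0))).
    by rewrite -[leRHS]e ler_wpM2r ?ler_nat ?(ltnW jM)// ltW.
  have := hK _ w h (hN01 M) hv (lexx _).
  have -> : j%:R * (w * h%:C) + w * h%:C = j.+1%:R * (w * h%:C) by rewrite -[j.+1]addn1 natrD; ring.
  set x := gsum _ h => h2; set x' := gsum (j%:R * _) h in ih h2.
  have -> : x - gsum 0 h = (x - x') + (x' - gsum 0 h) by ring.
  apply: le_trans (le_normcD _ _) _; rewrite -[j.+1]addn1 natrD; lra.
have := ind _ (leqnn _).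
have -> : (M.*2.+1)%:R * (w * h%:C) = w by rewrite mulrCA hNK mulr1.
rewrite mulrCA e mulr1 normcM normc_real (ger0_norm (ltW h0)) => H.
by rewrite mulrC ler_wpM2r// ltW.
Qed.

(** Riemann sums of the integral of [phi]: the factor common to all base points [v]. *)
Let J M := (hN M)%:C * gsum 0 (hN M).

Let J_bounded : exists2 K, 0 <= K & forall M, normc (J M) <= K.
Proof.
exists (4 * expR ((`|0 : R| + 1) ^+ 2 / (4 * a))) => [|M]; first by rewrite mulr_ge0 ?expR_ge0.
have /andP[h0 h1] := hN01 M; rewrite normcM normc_real (ger0_norm (ltW h0)).
apply: bound_step (hN01 M) (expR_ge0 _) (gsumP 0 h0) _ => n.
have h : normc (0 + n%:~R * (hN M)%:C - (n%:~R * hN M)%:C) <= 0.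
  by rewrite add0r reC subrr normc0.
apply: le_trans (phi_norm_le h) _; rewrite -expRD ler_expR.
have := gauss_exponent_le 0 (n%:~R * hN M) ReA; rewrite -/a expr0n/=; lra.
Qed.

Let e2 (v : C) := 2 * cpi R * 'i * v.

(** The character times [phi] is [phi] translated by [k tau], up to the factor [gterm]: a Fourier
    coefficient of the lattice values is again a lattice sum. *)
Let twist v h (k : int) : 0 < h ->
  hassum (fun n => cexp (- (2 * cpi R * 'i * (k%:~R * n%:~R * h%:C))) * phi (v + n%:~R * h%:C))
         (gterm al (e2 v) k * gsum (v + k%:~R * tau) h).
Proof.
move=> h0; apply: eq_hassum (hassumZ _ (gsumP _ h0)) => n.
rewrite /gterm /phi -!cexpD; congr cexp.
have -> : al * k%:~R ^+ 2 = A * tau ^+ 2 * k%:~R ^+ 2 by rewrite Atau2.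
have -> : e2 v * k%:~R = 2 * (A * tau) * v * k%:~R by rewrite Atau /e2; ring.
have -> : 2 * cpi R * 'i * (k%:~R * n%:~R * h%:C) = 2 * (A * tau) * (k%:~R * n%:~R * h%:C).
  by rewrite Atau; ring.
move: (A) (tau) => A' t'; ring.
Qed.

(* A second difference in n multiplies the twisted sum by a factor of order
   (k h)^2, while phi changes by O(h^2): this is the uniform decay in k that
   dominated convergence needs. *)
Let twist_decay v : exists2 K, 0 <= K & forall M (k : int), (`|k| <= M)%N -> k != 0 ->
  normc ((hN M)%:C * (gterm al (e2 v) k * gsum (v + k%:~R * tau) (hN M))) <= K / k%:~R ^+ 2.
Proof.
have [K K0 hK] := taylor (normc_ge0 v) (@ler01 R).
exists (8 * K) => [|M k kM k0]; first by rewrite mulr_ge0.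
have /andP[h0 h1] := hN01 M; set h := hN M in h0 h1 *.
have hX := twist v k h0; set X := _ * gsum _ _ in hX *.
pose th : R := 2 * pi * (k%:~R * h).
pose E : C := cexp ('i * th%:C).
have thE : 'i * th%:C = 2 * cpi R * 'i * (k%:~R * h%:C).
  by rewrite /th !rmorphM/= rmorph_int rmorph_nat /cpi; ring.
pose c (n : int) : C := cexp (- (2 * cpi R * 'i * (k%:~R * n%:~R * h%:C))).
have c1 n : normc (c n) = 1.
  rewrite /c (_ : _ * (k%:~R * n%:~R * h%:C) = 'i * (th * n%:~R)%:C); last first.
    by rewrite [in RHS]rmorphM/= rmorph_int [RHS]mulrA thE; ring.
  rewrite normc_exp (_ : - ('i * _) = 'i * (- (th * n%:~R))%:C); last by rewrite rmorphN; ring.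
  by rewrite /= !(mul0r, mulr0, mul1r) subr0 expR0.
have sh1 : hassum (fun n => c n * phi (v + (n + 1)%:~R * h%:C)) (E * X).
  apply: eq_hassum (hassumZ E (hassum_shift 1 hX)) => n.
  rewrite mulrA /c /E thE -cexpD; congr (cexp _ * _).
  by rewrite rmorphD/=; ring.
have sh2 : hassum (fun n => c n * phi (v + (n - 1)%:~R * h%:C)) (E^-1 * X).
  apply: eq_hassum (hassumZ E^-1 (hassum_shift (-1) hX)) => n.
  rewrite mulrA /c /E thE -cexpN -cexpD; congr (cexp _ * _).
  by rewrite rmorphB/=; ring.
have hd := hassumD (hassumD sh1 sh2) (hassumZ (- 2) hX).
have K1 : 0 <= 2 * K * h ^+ 2 by rewrite !mulr_ge0// ltW.
have H := bound_step (hN01 M) K1 hd.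
have H' : h * normc (E * X + E^-1 * X + - 2 * X) <= 8 * K * h ^+ 2.
  have -> : 8 * K * h ^+ 2 = 4 * (2 * K * h ^+ 2) by ring.
  apply: H => n; rewrite -/(c n) -!mulrDr mulrCA -!mulrDr normcM c1 mul1r.
  set y := v + n%:~R * h%:C.
  have hy : normc (y - (n%:~R * h)%:C) <= normc v by rewrite /y reC addrK.
  (* Directions 1 and -1 have opposite linear terms, so the second difference is of order [h^2]. *)
  have t1 := hK y 1 _ h (hN01 M) hy; have t2 := hK y (-1) _ h (hN01 M) hy.
  rewrite normc1 lexx in t1; rewrite normcN normc1 lexx in t2.
  have {}t1 := t1 isT; have {}t2 := t2 isT.
  have -> : v + (n + 1)%:~R * h%:C = y + 1 * h%:C by rewrite /y rmorphD/=; ring.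
  have -> : v + (n - 1)%:~R * h%:C = y + (-1) * h%:C by rewrite /y rmorphB/=; ring.
  set p1 := phi (y + 1 * _) in t1 *; set p2 := phi (y + (-1) * _) in t2 *.
  set p0 := phi y in t1 t2 *; set q := - (2 * A * y) * p0 in t1 t2.
  have -> : p1 + p2 + - 2 * p0 = (p1 - p0 - 1 * h%:C * q) + (p2 - p0 - -1 * h%:C * q) by ring.
  by apply: le_trans (le_normcD _ _) _; lra.
have EV : E^-1 = cos th +i* (- sin th).
  rewrite -cexpN (_ : - ('i * _) = 'i * (- th)%:C); last by rewrite rmorphN; ring.
  by rewrite cexp_imag cosN sinN.
have Ed : E + E^-1 - 2 = (- (2 * (1 - cos th)))%:C.
  rewrite EV /E cexp_imag; apply/eqP; rewrite eq_complex/=.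
  by apply/andP; split; apply/eqP; ring.
have kR : 0 < k%:~R ^+ 2 :> R by rewrite exprn_even_gt0//= intr_eq0.
(* [|k| <= M] gives [|th| <= pi], hence [1 - cos th >= th^2 / 32], and
   [th^2 = 4 pi^2 k^2 h^2 >= 16 k^2 h^2]. *)
have thb : k%:~R ^+ 2 * h ^+ 2 <= 2 * (1 - cos th).
  have p0 := pi_ge2 R.
  have hth : `|th| <= pi.
    have hk : 2 * `|k%:~R * h| <= 1.
      rewrite normrM (ger0_norm (ltW h0)) -intr_norm -natr_absz.
      have e1 : (M.*2.+1)%:R * h = 1 by rewrite /h /hN mulfV// pnatr_eq0.
      have e3 : 2 * (`|k|%N)%:R <= (M.*2.+1)%:R :> R by rewrite -natrM ler_nat leq_mul2_doubleS.
      by rewrite -[leRHS]e1 mulrA ler_wpM2r// ltW.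
    rewrite /th normrM (ger0_norm (x := 2 * pi)); last lra.
    nra.
  have := sub1_cos_ge hth; rewrite /th exprMn exprMn [(k%:~R * h) ^+ 2]exprMn.
  set kk := _ * h ^+ 2; have : 0 <= kk by rewrite mulr_ge0 ?sqr_ge0.
  have : 4 <= pi ^+ 2 :> R by nra.
  nra.
have Xe : E * X + E^-1 * X + - 2 * X = (- (2 * (1 - cos th)))%:C * X by rewrite -Ed; ring.
rewrite Xe normcM normc_real normrN ger0_norm in H'; last first.
  by apply: le_trans thb; rewrite mulr_ge0 ?sqr_ge0.
rewrite normcM normc_real (ger0_norm (ltW h0)) ler_pdivlMr//.
have X0 := normc_ge0 X; have h20 : 0 < h ^+ 2 by rewrite exprn_gt0.
rewrite -(ler_pM2r h20); apply: le_trans H'.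
have -> : h * normc X * k%:~R ^+ 2 * h ^+ 2 = h * ((k%:~R ^+ 2 * h ^+ 2) * normc X) by ring.
by rewrite ler_pM2l// ler_wpM2r.
Qed.

Let window (M : nat) : seq int := [seq k%:Z - M%:Z | k <- iota 0 M.*2.+1].

Let window_uniq M : uniq (window M).
Proof. by rewrite map_inj_uniq ?iota_uniq// => x y; lia. Qed.

Let mem_window M k : (k \in window M) = (`|k| <= M)%N.
Proof.
apply/mapP/idP => [[j]|kM]; first by rewrite mem_iota => jM ->; lia.
exists `|(k + M%:Z)%R|%N; last by lia.
by rewrite mem_iota; lia.
Qed.

(* Finite Fourier inversion on the lattice of mesh 1 / (2 M + 1). *)
Let inversion v M :
  \sum_(k <- window M) (hN M)%:C * (gterm al (e2 v) k * gsum (v + k%:~R * tau) (hN M)) = gsum v 1.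
Proof.
have /andP[h0 h1] := hN01 M.
have := @hassum_sum _ _ _ (window M) _ _ (fun k => hassumZ (hN M)%:C (twist v k h0)).
move=> /hassum_uniq; apply; set N := M.*2.+1.
have N0 : N%:R != 0 :> C by rewrite pnatr_eq0.
have hE : (hN M)%:C = N%:R^-1 by rewrite fmorphV/= rmorph_nat.
pose g (m : int) : int := m * N%:Z.
pose g' (n : int) : option int := if (N%:Z %| n)%Z then Some (n %/ N%:Z)%Z else None.
apply: (@hassum_inj _ _ _ g g').
- by move=> m; rewrite /g' /g dvdz_mull ?dvdzz// mulzK.
- by move=> n; rewrite /g'; case: ifP => //= hn; rewrite /g divzK.
- move=> n; rewrite /g'; case: ifPn => // hn _.
  under eq_bigr do rewrite mulrA.
  rewrite -mulr_suml (_ : \sum_(_ <- _) _ = 0) ?mul0r// -mulr_sumr.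
  rewrite (_ : \sum_(_ <- _) _ = 0) ?mulr0//.
  rewrite /window big_map -[iota 0 _]/(index_iota 0 N) big_mkord.
  have := root_of_unity_sum (- n) (ltn0Sn M.*2); rewrite dvdzE abszN -dvdzE (negbTE hn).
  (* Shifting the window to [[0, N)] takes out the constant [exp(2 pi i M n / N)]. *)
  move=> h; rewrite -[RHS](mulr0 (cexp (2 * cpi R * 'i * (M%:R * n%:~R / N%:R)))) -[in RHS]h.
  rewrite mulr_sumr; apply: eq_bigr => k _.
  by rewrite -cexpD; congr cexp; rewrite hE rmorphB rmorphN/= -!pmulrn; ring.
- apply: eq_hassum (gsumP v ltr01) => m /=.
  have e0 (k : int) : cexp (- (2 * cpi R * 'i * (k%:~R * (g m)%:~R * (hN M)%:C))) = 1.
    rewrite -[RHS](cexp_2pi_int R (- (k * m))); congr cexp.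
    by rewrite /g hE !(rmorphN, rmorphM)/= -pmulrn; field.
  under eq_bigr do rewrite e0 mul1r.
  rewrite big_const_seq count_predT size_map size_iota iter_addr_0.
  rewrite hE -mulrnAl -mulr_natr mulVf// mul1r; congr phi.
  by rewrite /g rmorphM/= -pmulrn -mulrA divff// mulr1 mulr1.
Qed.

Let g1 v := gsum v 1.

Let inv_sqr_sum (K : R) N : 0 <= K ->
  \sum_(n < N) K / (n.+1)%:R ^+ 2 <= 2 * K.
Proof.
move=> K0; rewrite -mulr_sumr mulrC ler_wpM2r//.
(* A telescoping form of the bound, strong enough for the induction. *)
suff : \sum_(n < N) (n.+1)%:R ^- 2 <= 2 * (1 - (N.+1)%:R^-1) :> R.
  have N0 : 0 < (N.+1)%:R^-1 :> R by rewrite invr_gt0 ltr0n.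
  by move=> h; apply: le_trans h _; rewrite mulrBr mulr1 gerBl mulr_ge0// ltW.
elim: N => [|N ih]; first by rewrite big_ord0 invr1 subrr mulr0.
rewrite big_ord_recr/=; apply: le_trans (lerD ih (lexx _)) _.
rewrite -[N.+2]addn1 natrD; have : 1 <= N.+1%:R :> R by rewrite ler1n.
move: (N.+1%:R) => x x1; rewrite -subr_ge0.
have -> : 2 * (1 - (x + 1)^-1) - (2 * (1 - x^-1) + x ^- 2) = (x - 1) / (x ^+ 2 * (x + 1)).
  by field; apply/andP; split; apply/eqP; lra.
by rewrite divr_ge0 ?mulr_ge0 ?sqr_ge0//; lra.
Qed.

(** [inversion] writes [g1 v] as a sum over [|k| <= M]; replacing each [gsum (v + k tau)] by
    [gsum 0] turns it into [J M] times the theta series. For fixed [k] the error tends to 0, and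
    [twist_decay] dominates it uniformly in [M]. *)
Let J_approx v : tends (fun M => g1 v - J M * jsum al (e2 v)) 0.
Proof.
have [K1 K10 hK1] := twist_decay v; have [K2 K20 hK2] := gsum_const v.
have [K3 K30 hK3] := J_bounded.
have [B hB] := bsum_gterm (e2 v) al0.
pose F M k := (if (`|k| <= M)%N
  then (hN M)%:C * (gterm al (e2 v) k * gsum (v + k%:~R * tau) (hN M)) else 0)
  + - J M * gterm al (e2 v) k.
(* The decay bound says nothing at [k = 0], where [K2 + K3] bounds the term directly. *)
pose D (k : int) := (if k == 0 then K2 + K3 else K1 / k%:~R ^+ 2)
  + K3 * normc (gterm al (e2 v) k).
have FS M : hassum (F M) (g1 v - J M * jsum al (e2 v)).
  rewrite -mulNr; apply: hassumD (hassumZ _ (jsumP _ al0)).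
  rewrite /g1 -(inversion v M).
  have := @hassum_fin R _ (fun k => if (`|k| <= M)%N then (hN M)%:C *
    (gterm al (e2 v) k * gsum (v + k%:~R * tau) (hN M)) else 0) _ (window_uniq M).
  have -> : \sum_(t <- window M) (if (`|t| <= M)%N then (hN M)%:C *
    (gterm al (e2 v) t * gsum (v + t%:~R * tau) (hN M)) else 0) =
    \sum_(k <- window M) (hN M)%:C * (gterm al (e2 v) k * gsum (v + k%:~R * tau) (hN M)).
    by rewrite big_seq [RHS]big_seq; apply: eq_bigr => k; rewrite mem_window => ->.
  by apply=> k; rewrite mem_window => /negbTE ->.
have z0 : hassum (fun _ : int => 0 : C) 0.
  by have := @hassum_fin R int (fun=> 0) [::] isT (fun _ _ => erefl); rewrite big_nil.
apply: (hassum_dominated (g := D) (M := 2 * (K2 + K3 + 2 * K1) + K3 * B) _ _ _ FS z0).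
- move=> S uS; rewrite big_split/=; apply: lerD; last first.
    by rewrite -mulr_sumr ler_wpM2l// hB.
  apply: (@bsum_int R (fun n => if n is n'.+1 then K1 / n%:R ^+ 2 else K2 + K3)) uS.
  + by case=> [|n]; rewrite ?addr_ge0// divr_ge0// sqr_ge0.
  + case=> [|N]; first by rewrite big_ord0 !addr_ge0 ?mulr_ge0.
    by rewrite big_ord_recl/= lerD2l; exact: inv_sqr_sum.
  + move=> k; case: ifPn => [/eqP->//|k0].
    have : (0 < `|k|)%N by rewrite absz_gt0.
    case E : `|k|%N => [//|n] _; rewrite -E natr_absz intr_norm.
    by rewrite real_normK ?num_real.
- move=> M k; apply: le_trans (le_normcD _ _) _; rewrite /D; apply: lerD; last first.
    by rewrite normcM normcN ler_wpM2r ?normc_ge0.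
  case: ifP => [kM|kM].
    case: ifPn => [/eqP->|k0]; last exact: hK1.
    rewrite mul0r addr0 /gterm expr0n/= !mulr0 addr0 cexp0 mul1r.
    have /andP[h0 h1] := hN01 M; have := hK2 M.
    have := le_normcD ((hN M)%:C * (gsum v (hN M) - gsum 0 (hN M))) (J M).
    rewrite -[J M]/(_ * _) -mulrDr subrK; have := hK3 M; rewrite /J; nra.
  rewrite normc0; case: ifP => _; first by rewrite addr_ge0.
  by rewrite divr_ge0// sqr_ge0.
- move=> k; have [K K0 hK] := gsum_const (v + k%:~R * tau).
  apply/tendsCP => e e0; set G := normc (gterm al (e2 v) k).
  have G0 : 0 <= G := normc_ge0 _.
  pose x := (G * K) / e; have x0 : 0 <= x by rewrite divr_ge0 ?mulr_ge0// ltW.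
  exists (maxn `|k|%N (Num.bound x)) => M; rewrite geq_max => /andP[kM xM].
  rewrite subr0 /F kM; have /andP[h0 h1] := hN01 M.
  set g := gterm _ _ _; rewrite (_ : _ + _ =
    g * ((hN M)%:C * (gsum (v + k%:~R * tau) (hN M) - gsum 0 (hN M)))); last by rewrite /J; ring.
  rewrite normcM -/g -/G; apply: le_lt_trans (ler_wpM2l G0 (hK M)) _.
  have hx : x < M.*2.+1%:R.
    apply: lt_le_trans (archi_boundP x0) _; rewrite ler_nat.
    by apply: leq_trans xM _; rewrite -addnn leqW// leq_addr.
  have e1 : (M.*2.+1)%:R * hN M = 1 by rewrite /hN mulfV// pnatr_eq0.
  have e3 : G * K = x * e by rewrite /x divfK// gt_eqF.
  have eh : 0 < e * hN M by rewrite mulr_gt0.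
  have e4 : x * (e * hN M) < (M.*2.+1)%:R * (e * hN M) by rewrite ltr_pM2r.
  by rewrite mulrA e3 -mulrA; apply: lt_le_trans e4 _; rewrite mulrCA e1 mulr1.
Qed.

(** Cross-multiplying the approximations at [v] and [w] eliminates [J M]. *)
Lemma gauss_proportional v w :
  gsum v 1 * jsum al (e2 w) = gsum w 1 * jsum al (e2 v).
Proof.
have h1 := tendsM (J_approx v) (@tends_cst C (jsum al (e2 w))).
have h2 := tendsM (J_approx w) (@tends_cst C (- jsum al (e2 v))).
have h3 := tendsD h1 h2; rewrite !mul0r addr0 in h3.
apply/eqP; rewrite -subr_eq0; apply/eqP.
apply: (tends_uniq (@tends_cst C _)); apply: eq_tends h3 => M.
by rewrite /g1; ring.
Qed.

End GaussianLattice.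

(** With [al = pi i t] one has [- A = pi i (- 1 / t)]: this is the transformation [t -> - 1 / t], as
    an equality of cross products at [v] and [w]. *)
Lemma jacobi_imaginary (R : realType) (al v w : R[i]) : complex.Re al < 0 ->
  let A := - cpi R ^+ 2 / al in
  let g v := cexp (- (A * v ^+ 2)) * jsum (- A) (2 * A * v) in
  g v * jsum al (2 * cpi R * 'i * w) = g w * jsum al (2 * cpi R * 'i * v).
Proof.
move=> al0 A g.
have al_neq0 : al != 0 by apply/eqP => e; move: al0; rewrite e /= ltxx.
have ReA : 0 < complex.Re A.
  have -> : A = (- pi ^+ 2)%:C * al^-1 by rewrite /A rmorphN rmorphXn.
  case: al al0 {A g al_neq0} => a b /= a0; rewrite mul0r subr0 mulNr -mulrN -mulNr.
  rewrite mulr_gt0 ?exprn_gt0 ?pi_gt0// mulNr oppr_gt0 pmulr_llt0// invr_gt0.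
  by rewrite ltr_pwDl ?sqr_ge0// exprn_even_gt0//= lt_eqF.
(* Forced by [A tau = pi i] and [A tau^2 = al]. *)
pose tau := - 'i * al / cpi R.
have Atau : A * tau = cpi R * 'i.
  have hf (c b : R[i]) : c != 0 -> b != 0 -> - c ^+ 2 / b * (- 'i * b / c) = c * 'i.
    by move=> c0 b0; field; rewrite c0 b0.
  exact: hf (cpi_neq0 R) al_neq0.
have Atau2 : A * tau ^+ 2 = al.
  rewrite expr2 mulrA Atau /tau; have := sqr_i R; rewrite expr2 => hi.
  transitivity (- ('i * 'i) * al); last by rewrite hi opprK mul1r.
  by have := cpi_neq0 R; move: (cpi R) => c c0; field.
have := gauss_proportional al0 ReA Atau Atau2 v w.
have ah : complex.Re (- A) < 0 by case: (A) ReA => a b /=; rewrite oppr_lt0.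
by rewrite /g expr1n !mulr1 !jsumN.
Qed.

(** * Theta functions *)

Section JsumProduct.
Variable R : realType.
Local Notation C := R[i].

Lemma divz2_add (n m : int) : (2 %| n - m)%Z ->
  exists jk : int * int, n = jk.1 + jk.2 /\ m = jk.1 - jk.2.
Proof.
move=> /dvdzP[k nm]; exists (n - k, k); split => /=; first by rewrite subrK.
by rewrite -addrA -opprD -mulr2n -mulr_natr -nm opprB addrC subrK.
Qed.

(* Split the double series according to the parity of n - m. *)
Lemma jsumM (al a b : C) : complex.Re al < 0 ->
  jsum (al / 2) a * jsum (al / 2) b =
  jsum al (a + b) * jsum al (a - b) +
  cexp (al / 2 + a) * (jsum al (a + b + al) * jsum al (a - b + al)).
Proof.
move=> al0; have ah0 : complex.Re (al / 2) < 0.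
  have -> : al / 2 = (2^-1)%:C * al by rewrite fmorphV/= rmorph_nat mulrC.
  by case: (al) al0 => x y /= ?; rewrite mul0r subr0; lra.
have [M1 hM1] := bsum_gterm a ah0; have [M2 hM2] := bsum_gterm b ah0.
have hL := hassum_prod hM1 hM2 (jsumP a ah0) (jsumP b ah0).
have hR (c d : C) := let: ex_intro _ hM3 := bsum_gterm c al0 in
  let: ex_intro _ hM4 := bsum_gterm d al0 in
  hassum_prod hM3 hM4 (jsumP c al0) (jsumP d al0).
pose F (p : int * int) := gterm (al / 2) a p.1 * gterm (al / 2) b p.2.
pose F1 p := if (2 %| p.1 - p.2)%Z then F p else 0.
pose F2 p := if (2 %| p.1 - p.2)%Z then 0 else F p.
apply: (hassum_uniq hL).
suff [h1 h2] : hassum F1 (jsum al (a + b) * jsum al (a - b)) /\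
    hassum F2 (cexp (al / 2 + a) * (jsum al (a + b + al) * jsum al (a - b + al))).
  apply: eq_hassum (hassumD h1 h2) => p.
  by rewrite /F1 /F2; case: ifP => _; rewrite ?addr0 ?add0r.
have odd2 (k : int) : (2 %| k * 2 + 1)%Z = false by apply/negP => /dvdzP[m]; lia.
pose half (n : int) : int := (n %/ 2)%Z.
have half2 (n : int) : half (n * 2) = n by rewrite /half mulzK.
have dbl (n : int) : n + n = n * 2 by rewrite mulr_natr.
split.
- apply: (@hassum_inj _ _ _ (fun p : int * int => (p.1 + p.2, p.1 - p.2))
    (fun p => if (2 %| p.1 - p.2)%Z then Some (half (p.1 + p.2), half (p.1 - p.2)) else None)).
  + move=> [j k] /=.
    have -> : j + k - (j - k) = k * 2 by rewrite -dbl; ring.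
    have -> : j + k + (j - k) = j * 2 by rewrite -dbl; ring.
    by rewrite dvdz_mull// !half2.
  + move=> [n m] /=; case: ifP => //= /divz2_add[[j k] /= [-> ->]].
    have -> : j + k - (j - k) = k * 2 by rewrite -dbl; ring.
    have -> : j + k + (j - k) = j * 2 by rewrite -dbl; ring.
    by rewrite !half2.
  + by move=> [n m] /=; rewrite /F1 /=; case: ifP.
  + apply: eq_hassum (hR (a + b) (a - b)) => -[j k] /=; rewrite /F1/=.
    have -> : j + k - (j - k) = k * 2 by rewrite -dbl; ring.
    rewrite dvdz_mull// /F/= /gterm -!cexpD; congr cexp.
    by rewrite rmorphB rmorphD/=; field.
(* The odd pairs are [(j + k + 1, j - k)]; the extra 1 produces the prefactor and the shift of both
   arguments by [al]. *)
- apply: (@hassum_inj _ _ _ (fun p : int * int => (p.1 + p.2 + 1, p.1 - p.2))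
    (fun p => if (2 %| p.1 - p.2)%Z then None
              else Some (half (p.1 + p.2 - 1), half (p.1 - p.2 - 1)))).
  + move=> [j k] /=.
    have -> : j + k + 1 - (j - k) = k * 2 + 1 by rewrite -dbl; ring.
    have -> : j + k + 1 + (j - k) - 1 = j * 2 by rewrite -dbl; ring.
    by rewrite odd2 addrK !half2.
  + move=> [n m] /=; case: ifPn => //= nm.
    have : (2 %| n - 1 - m)%Z by move: nm; rewrite /dvdz; lia.
    move=> /divz2_add[[j k] /= [e1 ->]].
    have -> : n = j + k + 1 by rewrite -e1 subrK.
    have -> : j + k + 1 - (j - k) - 1 = k * 2 by rewrite -dbl; ring.
    have -> : j + k + 1 + (j - k) - 1 = j * 2 by rewrite -dbl; ring.
    by rewrite !half2.
  + by move=> [n m] /=; rewrite /F2 /=; case: ifP.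
  + apply: eq_hassum (hassumZ _ (hR (a + b + al) (a - b + al))) => -[j k] /=; rewrite /F2/=.
    have -> : j + k + 1 - (j - k) = k * 2 + 1 by rewrite -dbl; ring.
    rewrite odd2.
    rewrite /F/= /gterm -!cexpD; congr cexp.
    by rewrite rmorphB !rmorphD/=; field.
Qed.

Lemma jsum_neq0 (al be : C) : complex.Re al < 0 ->
  (forall n, - (cexp al * cexp be) * cexp (al *+ 2) ^+ n != 1) ->
  (forall n, - (cexp al / cexp be) * cexp (al *+ 2) ^+ n != 1) ->
  jsum al be != 0.
Proof.
move=> al0 h1 h2; have p1 : normc (cexp (al *+ 2)) < 1.
  by rewrite cexpMn normcX exprn_ilt1// ?normc_ge0// normc_cexp_lt1.
rewrite triple_product// !mulf_neq0//; apply: qprod_neq0 => // n.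
rewrite -exprS; apply/eqP => e; have : normc (cexp (al *+ 2) ^+ n.+1) < 1.
  by rewrite normcX exprn_ilt1 ?normc_ge0.
by rewrite e normc1 ltxx.
Qed.

End JsumProduct.

Section ThetaFunctions.
Variable R : realType.
Local Notation C := R[i].
Local Notation pii := (cpi R * 'i).

Lemma Re_pii (t : C) : complex.Re (pii * t) = - (pi * complex.Im t).
Proof. by case: t => a b /=; ring. Qed.

Lemma cexp_pii : cexp pii = -1 :> C. Proof. by rewrite mulrC cexp_pi. Qed.

Lemma cexp_pii2 : cexp (pii / 2) = 'i%R :> C.
Proof. by rewrite -[RHS]complexiE -cexp_halfpi; congr cexp; ring. Qed.

Variable t : C.
Hypothesis t0 : 0 < complex.Im t.

Let al0 : complex.Re (pii * t) < 0.
Proof. by rewrite Re_pii oppr_lt0 mulr_gt0 ?pi_gt0. Qed.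

Lemma vartheta1_jsum u : vartheta1 u t =
  nomeX t 8^-1 / 'i * (cexp (pii * u) * jsum (pii * t) (2 * pii * u + pii + pii * t)).
Proof.
set p := cexp ((pii * t) *+ 2); set W := cexp (2 * pii * u).
have p1 : normc p < 1 by rewrite /p cexpMn normcX exprn_ilt1// ?normc_ge0// normc_cexp_lt1.
have W0 : W != 0 := cexp_neq0 _.
have np : nomeX t 1 = p by rewrite /nomeX /p mulr1 -mulr_natl; congr cexp; ring.
rewrite triple_product// -/p.
have -> : - (cexp (pii * t) * cexp (2 * pii * u + pii + pii * t)) = p * W.
  rewrite /p /W -!cexpD -mulN1r -cexp_pii -cexpD -[LHS]mulr1 -[X in _ * X](cexp_2pi_int R (-1)) -cexpD.
  by congr cexp; rewrite -mulr_natl rmorphN/=; ring.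
have -> : - (cexp (pii * t) / cexp (2 * pii * u + pii + pii * t)) = W^-1.
  rewrite /W -cexpB -cexpN -mulN1r -cexp_pii -cexpD; congr cexp; ring.
(* The factor [1 - W^-1] split off here is the one contained in [csin]. *)
rewrite (qprod_rec W^-1 p1).
have i0 : 'i%R != 0 :> C by rewrite -cexp_pii2 cexp_neq0.
rewrite /vartheta1 np.
have -> : infprod (fun n => 1 - p ^+ n.+1) = qprod p p.
  by congr infprod; apply/funext => n; rewrite exprS.
have -> : infprod (fun n => 1 - 2 * p ^+ n.+1 * ccos (2 * cpi R * u) + p ^+ (2 * n.+1)) =
    qprod (p * W) p * qprod (W^-1 * p) p.
  apply: etrans _ (@infprodM _ (fun n => 1 - p * W * p ^+ n) (fun n => 1 - W^-1 * p * p ^+ n)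
    _ _ (qprod_tends (p * W) p1) (qprod_tends (W^-1 * p) p1)).
  congr infprod; apply/funext => n.
  have -> : ccos (2 * cpi R * u) = (W + W^-1) / 2.
    by rewrite /ccos /W -cexpN; congr ((cexp _ + cexp _) / _); ring.
  rewrite mul2n -addnn exprD !exprS; field.
  by rewrite W0.
have -> : csin (cpi R * u) = cexp (pii * u) * (1 - W^-1) / (2 * 'i).
  rewrite /csin /W -cexpN mulrBr mulr1 -cexpD; congr ((cexp _ - cexp _) / _); ring.
move: (nomeX t 8^-1) (cexp (pii * u)) (qprod p p) (qprod (p * W) p) (qprod _ p) => *.
by field; rewrite i0 W0.
Qed.

(** The theta series over the half-integers, freed of the constant [exp(pi i t / 4)]. *)
Definition mtheta (v : C) : C := cexp (pii * v) * jsum (pii * t) (2 * pii * v + pii * t).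

Lemma vartheta2_jsum u : vartheta2 u t = nomeX t 8^-1 * mtheta u.
Proof.
rewrite /vartheta2 vartheta1_jsum /mtheta.
have -> : 2 * pii * (u + 2^-1) + pii + pii * t = 2 * pii * u + pii * t + 2 * cpi R * 'i.
  by field.
have i0 : 'i%R != 0 :> C by rewrite -cexp_pii2 cexp_neq0.
rewrite jsum_2pi// (_ : pii * (u + 2^-1) = pii * u + pii / 2); last by ring.
by rewrite cexpD cexp_pii2; field.
Qed.

Lemma vartheta3_jsum u : vartheta3 u t = jsum (pii * t) (2 * pii * u).
Proof.
rewrite /vartheta3 vartheta1_jsum.
have -> : 2 * pii * (u + (t + 1) / 2) + pii + pii * t =
  2 * pii * u + 2 * (pii * t) + 2 * cpi R * 'i by field.
rewrite jsum_2pi// jsum_shift// /nomeX.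
have -> : 'i^-1 = cexp (- (pii / 2)) :> C by rewrite cexpN cexp_pii2.
rewrite -!cexpD !mulrA -!cexpD (_ : cexp _ = 1) ?mul1r//.
by rewrite -[RHS](@cexp0 R); congr cexp; field.
Qed.

Lemma vartheta0_jsum u : vartheta0 u t = jsum (pii * t) (2 * pii * (u + 2^-1)).
Proof.
rewrite /vartheta0 vartheta1_jsum.
have -> : 2 * pii * (u + t / 2) + pii + pii * t =
  2 * pii * (u + 2^-1) + 2 * (pii * t) by field.
rewrite jsum_shift// /nomeX.
have -> : - 'i = cexp (- (pii / 2)) :> C.
  rewrite cexpN cexp_pii2 -[RHS]mul1r -[X in X / _]opprK -(sqrCi C) mulNr expr2 mulfK//.
  by rewrite -cexp_pii2 cexp_neq0.
have -> : 'i^-1 = cexp (- (pii / 2)) :> C by rewrite cexpN cexp_pii2.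
rewrite !mulrA -!cexpD (_ : cexp _ = 1) ?mul1r//.
by rewrite -[RHS](cexp_2pi_int R (-1)); congr cexp; rewrite rmorphN/=; field.
Qed.

Lemma mthetaN v : mtheta (- v) = mtheta v.
Proof.
rewrite /mtheta; set J := jsum (pii * t) (2 * pii * v - pii * t).
have -> : jsum (pii * t) (2 * pii * - v + pii * t) = J.
  by rewrite -jsumN//; congr jsum; ring.
have -> : jsum (pii * t) (2 * pii * v + pii * t) = cexp (- (2 * pii * v)) * J.
  have := jsum_shift (2 * pii * v - pii * t) al0; rewrite -/J.
  have -> : 2 * pii * v - pii * t + 2 * (pii * t) = 2 * pii * v + pii * t by ring.
  by move=> ->; congr (cexp _ * _); ring.
by rewrite mulrA -cexpD; congr (cexp _ * _); ring.
Qed.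

Lemma mthetaD1 v : mtheta (v + 1) = - mtheta v.
Proof.
rewrite /mtheta (_ : 2 * pii * (v + 1) + pii * t = 2 * pii * v + pii * t + 2 * cpi R * 'i); last by ring.
by rewrite jsum_2pi// mulrDr mulr1 cexpD cexp_pii mulrN1 mulNr.
Qed.

(** [mtheta] is even and changes sign under [v -> v + 1]; compare [-1/2] with [1/2]. *)
Lemma mtheta_half : mtheta 2^-1 = 0.
Proof.
have := mthetaD1 (- 2^-1); rewrite mthetaN.
have -> : - 2^-1 + 1 = 2^-1 :> C by field.
move=> h; have : mtheta 2^-1 * 2 = 0 by rewrite mulr_natr mulr2n {1}h addNr.
by move=> /eqP; rewrite mulf_eq0 pnatr_eq0 orbF => /eqP.
Qed.

Lemma vartheta2N v : vartheta2 (- v) t = vartheta2 v t.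
Proof. by rewrite !vartheta2_jsum mthetaN. Qed.

Lemma vartheta2D1 v : vartheta2 (v + 1) t = - vartheta2 v t.
Proof. by rewrite !vartheta2_jsum mthetaD1 mulrN. Qed.

Lemma vartheta3D1 v : vartheta3 (v + 1) t = vartheta3 v t.
Proof.
rewrite !vartheta3_jsum (_ : 2 * pii * (v + 1) = 2 * pii * v + 2 * cpi R * 'i); last by ring.
by rewrite jsum_2pi.
Qed.

Lemma vartheta3D_half v : vartheta3 (v + 2^-1) t = vartheta0 v t.
Proof. by rewrite vartheta3_jsum vartheta0_jsum. Qed.

Lemma vartheta1D1 v : vartheta1 (v + 1) t = - vartheta1 v t.
Proof.
have h x : vartheta1 x t = vartheta2 (x - 2^-1) t by rewrite /vartheta2 subrK.
by rewrite !h -vartheta2D1; congr (vartheta2 _ t); ring.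
Qed.

Lemma vartheta1N v : vartheta1 (- v) t = - vartheta1 v t.
Proof.
have h x : vartheta1 x t = vartheta2 (x - 2^-1) t by rewrite /vartheta2 subrK.
rewrite !h -vartheta2D1 -[LHS]vartheta2N; congr (vartheta2 _ t); by field.
Qed.

Let q_lt1 : normc (cexp (pii * t)) < 1.
Proof. by rewrite normc_cexp_lt1. Qed.

Let p_lt1 : normc (cexp ((pii * t) *+ 2)) < 1.
Proof. by rewrite cexpMn normcX exprn_ilt1// ?normc_ge0. Qed.

Let ne1 (z : C) n : normc z < 1 -> z * cexp ((pii * t) *+ 2) ^+ n != 1.
Proof.
move=> z1; apply/eqP => e; have : normc (z * cexp ((pii * t) *+ 2) ^+ n) < 1.
  rewrite normcM normcX; apply: le_lt_trans z1; rewrite ler_piMr ?normc_ge0//.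
  by rewrite exprn_ile1 ?normc_ge0// ltW.
by rewrite e normc1 ltxx.
Qed.

Lemma vartheta3_0_neq0 : vartheta3 0 t != 0.
Proof.
rewrite vartheta3_jsum mulr0; apply: jsum_neq0 => // n; rewrite cexp0 ?divr1 ?mulr1;
  by apply: ne1; rewrite normcN.
Qed.

Lemma vartheta0_0_neq0 : vartheta0 0 t != 0.
Proof.
rewrite vartheta0_jsum add0r; apply: jsum_neq0 => // n;
  rewrite (_ : 2 * pii / 2 = pii) ?cexp_pii; (try by field);
  by apply: ne1; rewrite normcN ?invrN ?invr1 ?mulrN1 ?normcN.
Qed.

Lemma vartheta2_0_neq0 : vartheta2 0 t != 0.
Proof.
rewrite vartheta2_jsum mulf_neq0 ?cexp_neq0//.
rewrite /mtheta !mulr0 cexp0 mul1r add0r; apply: jsum_neq0 => // n.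
  by apply: ne1; rewrite normcN normcM mulr_ilt1 ?normc_ge0.
(* The second product starts with the factor [1 + 1], so [n = 0] is treated apart. *)
rewrite divff ?cexp_neq0//; case: n => [|n].
  by rewrite expr0 mulr1 -subr_eq0 -opprD oppr_eq0 -mulr2n pnatr_eq0.
by rewrite exprS mulrA; apply: ne1; rewrite mulN1r normcN.
Qed.

End ThetaFunctions.

(** * The addition formula at half the modulus *)

Section ThetaIdentities.
Variable R : realType.
Local Notation C := R[i].
Local Notation pii := (cpi R * 'i).
Variable t : C.
Hypothesis t0 : 0 < complex.Im t.
Implicit Types x y z : C.

Local Notation th1 x := (vartheta1 x (t / 2)).
Local Notation th2 x := (vartheta2 x (t / 2)).

Lemma Im_half_gt0 : 0 < complex.Im (t / 2).
Proof.
have -> : t / 2 = (2^-1)%:C * t by rewrite fmorphV/= rmorph_nat mulrC.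
by case: (t) t0 => x y /= ?; rewrite mul0r addr0; lra.
Qed.

Let t20 := Im_half_gt0.

(** [jsumM] separates the variables: [a + b] involves only [x] and [a - b] only [y]. Of the
    constant, only its being nonzero enters the weight relations. *)
Lemma vartheta1_addition : exists2 c, c != 0 & forall x y,
  vartheta1 (x + y) (t / 2) * vartheta1 (x - y) (t / 2) =
  c * (vartheta3 (2 * x) t * vartheta2 (2 * y) t
       - vartheta2 (2 * x) t * vartheta3 (2 * y) t).
Proof.
pose k1 : C := nomeX (t / 2) 8^-1 / 'i; pose k2 : C := nomeX t 8^-1.
have k20 : k2 != 0 by rewrite cexp_neq0.
have i0 : 'i%R != 0 :> C by rewrite -cexp_pii2 cexp_neq0.
have k10 : k1 != 0 by rewrite mulf_neq0 ?cexp_neq0 ?invr_eq0.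
have al0 : complex.Re (pii * t) < 0 by rewrite Re_pii oppr_lt0 mulr_gt0 ?pi_gt0.
exists (- (k1 ^+ 2 / k2)) => [|x y].
  by rewrite oppr_eq0 mulf_neq0 ?expf_neq0 ?invr_eq0.
rewrite !(vartheta1_jsum t20) !(vartheta3_jsum t0) !(vartheta2_jsum t0) -/k1 -/k2.
set a := 2 * pii * (x + y) + pii + _; set b := 2 * pii * (x - y) + pii + _.
have e2 : pii * (t / 2) = pii * t / 2 by rewrite mulrA.
have := @jsumM R (pii * t) a b al0; rewrite -e2 => h.
transitivity (k1 ^+ 2 * (cexp (pii * (x + y)) * cexp (pii * (x - y))) *
  (jsum (pii * (t / 2)) a * jsum (pii * (t / 2)) b)); first by ring.
have j1 : jsum (pii * t) (a + b) = cexp (- (2 * pii * x)) * mtheta t (2 * x).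
  rewrite /mtheta mulrA -cexpD (_ : - (2 * pii * x) + pii * (2 * x) = 0) ?cexp0 ?mul1r; last by ring.
  rewrite -[RHS](jsum_2pi _ al0); congr (jsum _ _); rewrite /a /b; by field.
have j2 : jsum (pii * t) (a - b) = jsum (pii * t) (2 * pii * (2 * y)).
  by congr (jsum _ _); rewrite /a /b; ring.
have j3 : jsum (pii * t) (a + b + pii * t) =
    cexp (- (pii * t) - 2 * pii * (2 * x)) * jsum (pii * t) (2 * pii * (2 * x)).
  rewrite -(jsum_shift _ al0) -[RHS](jsum_2pi _ al0); congr (jsum _ _); rewrite /a /b; by field.
have j4 : jsum (pii * t) (a - b + pii * t) = cexp (- (2 * pii * y)) * mtheta t (2 * y).
  rewrite /mtheta mulrA -cexpD (_ : - (2 * pii * y) + pii * (2 * y) = 0) ?cexp0 ?mul1r; last by ring.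
  by congr (jsum _ _); rewrite /a /b; ring.
rewrite h j1 j2 j3 j4; set m1 := mtheta _ _; set m2 := mtheta _ _; set P1 := jsum _ _; set P2 := jsum _ _.
have -> : cexp (pii * (x + y)) * cexp (pii * (x - y)) = cexp (2 * pii * x).
  by rewrite -cexpD; congr cexp; ring.
have -> : cexp (pii * (t / 2) + a) = - cexp (pii * t + 2 * pii * x + 2 * pii * y).
  rewrite -mulN1r -cexp_pii -cexpD; congr cexp; rewrite /a; by field.
rewrite !cexpN !(cexpD, cexpB) (_ : 2 * pii * (2 * x) = 2 * pii * x + 2 * pii * x); last by ring.
rewrite !(cexpD, cexpN); field.
by rewrite k20 !cexp_neq0.
Qed.

End ThetaIdentities.

(* Kept abstract: conversion would otherwise unfold the infinite products. *)
Section AdditionConsequences.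
Variables (C : numFieldType) (f P M Z : C -> C) (c : C).
Hypothesis addf : forall x y,
  f (x + y) * f (x - y) = c * (P (2 * x) * M (2 * y) - M (2 * x) * P (2 * y)).
Hypothesis fD1 : forall x, f (x + 1) = - f x.
Hypothesis MD1 : forall x, M (x + 1) = - M x.
Hypothesis PD1 : forall x, P (x + 1) = P x.
Hypothesis PZ : forall x, P (x + 2^-1) = Z x.

Let g x := f (x + 2^-1).

Lemma addition_sqr z : f z ^+ 2 = c * (P (2 * z) * M 0 - M (2 * z) * P 0).
Proof. by have := addf z 0; rewrite addr0 subr0 mulr0 expr2. Qed.

Lemma addition_shift_sqr z : g z ^+ 2 = c * (P (2 * z) * M 0 + M (2 * z) * P 0).
Proof.
have := addf (z + 2^-1) 0; rewrite addr0 subr0 mulr0 expr2 => ->.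
have -> : 2 * (z + 2^-1) = 2 * z + 1 by field.
by rewrite MD1 PD1; ring.
Qed.

(** By [addf] every term is a polynomial in [P] and [M] at [2 x], [2 y] and 0, where the identity is
    immediate. *)
Lemma addition_minus x y : f (x + y) * f (x - y) * g 0 ^+ 2 =
  f x ^+ 2 * g y ^+ 2 - g x ^+ 2 * f y ^+ 2.
Proof. by rewrite addf !addition_shift_sqr !addition_sqr mulr0; ring. Qed.

Lemma addition_shift_minus x y : g (x + y) * g (x - y) * g 0 ^+ 2 =
  g x ^+ 2 * g y ^+ 2 - f x ^+ 2 * f y ^+ 2.
Proof.
have := addition_minus (x + 2^-1) y.
have -> : x + 2^-1 + y = x + y + 2^-1 by ring.
have -> : x + 2^-1 - y = x - y + 2^-1 by ring.
have e : g (x + 2^-1) = - f x by rewrite /g -fD1; congr f; field.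
by rewrite e sqrrN -/(g _) -/(g (x - y)) -/(g x).
Qed.

Lemma addition_mixed x y :
  (f (x + y) * g (x - y) + g (x + y) * f (x - y)) * Z 0 =
  2 * (f x * g x) * Z (2 * y).
Proof.
(* Quarter shifts of both arguments mix [f] with [g]. In the sum of the two instances the terms with
   [P (2 x + 1/2)] cancel by antiperiodicity of [M], and [z] survives only in [Z (2 z)]; comparison
   with [z = 0] removes the rest. *)
have key z : f (x + z) * g (x - z) + g (x + z) * f (x - z) =
    - 2 * c * M (2 * x + 2^-1) * Z (2 * z).
  have := addf (x + 4^-1) (z - 4^-1); have := addf (x + 4^-1) (z + 4^-1).
  have -> : x + 4^-1 + (z + 4^-1) = x + z + 2^-1 by field.
  have -> : x + 4^-1 - (z + 4^-1) = x - z by ring.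
  have -> : x + 4^-1 + (z - 4^-1) = x + z by ring.
  have -> : x + 4^-1 - (z - 4^-1) = x - z + 2^-1 by field.
  have -> : 2 * (x + 4^-1) = 2 * x + 2^-1 by field.
  have -> : 2 * (z + 4^-1) = 2 * z + 2^-1 by field.
  have -> : 2 * (z - 4^-1) = 2 * z - 2^-1 by field.
  rewrite -!/(g _) => -> ->.
  have -> : 2 * z + 2^-1 = 2 * z - 2^-1 + 1 by field.
  rewrite MD1 !PD1.
  have -> : Z (2 * z) = P (2 * z - 2^-1).
    by rewrite -PZ -[RHS]PD1; congr P; field.
  by ring.
have k0 := key 0; rewrite addr0 subr0 mulr0 in k0; rewrite key.
transitivity (- 2 * c * M (2 * x + 2^-1) * Z 0 * Z (2 * y)); first by ring.
by rewrite -k0; ring.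
Qed.

(** At [y = 1/4] the zero of [M] kills one term, so the product becomes a single theta function, to
    which the modular transformation applies. *)
Lemma addition_prod v : M 2^-1 = 0 ->
  f v * g v = - c * P 2^-1 * M (2 * v + 2^-1).
Proof.
move=> M0; have := addf (v + 4^-1) (4^-1).
have -> : v + 4^-1 + 4^-1 = v + 2^-1 by field.
rewrite addrK mulrC => ->.
have -> : 2 * (v + 4^-1) = 2 * v + 2^-1 by field.
have -> : 2 * 4^-1 = 2^-1 :> C by field.
by rewrite M0; ring.
Qed.

End AdditionConsequences.

Lemma addition_relations (C : numFieldType) (f P M Z T1 T2 : C -> C) (c r v : C) :
  (forall x y, f (x + y) * f (x - y) = c * (P (2 * x) * M (2 * y) - M (2 * x) * P (2 * y))) ->
  (forall x, f (x + 1) = - f x) -> (forall x, M (x + 1) = - M x) ->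
  (forall x, P (x + 1) = P x) -> (forall x, P (x + 2^-1) = Z x) -> r != 0 ->
  (forall k, T1 k = f (k / (2 * r))) -> (forall k, T2 k = f (k / (2 * r) + 2^-1)) ->
  [/\ T1 (1 + (v + 1)) * T1 v * T2 0 ^+ 2 =
        T1 (v + 1) ^+ 2 * T2 1 ^+ 2 - T2 (v + 1) ^+ 2 * T1 1 ^+ 2,
      T2 (1 + (v + 1)) * T2 v * T2 0 ^+ 2 =
        T2 (v + 1) ^+ 2 * T2 1 ^+ 2 - T1 (v + 1) ^+ 2 * T1 1 ^+ 2 &
      (T1 (1 + (v + 1)) * T2 v + T2 (1 + (v + 1)) * T1 v) * Z 0 =
        2 * (T1 (v + 1) * T2 (v + 1)) * Z (1 / r)] /\
  [/\ T1 1 ^+ 2 = c * (P (1 / r) * M 0 - M (1 / r) * P 0),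
      T2 1 ^+ 2 = c * (P (1 / r) * M 0 + M (1 / r) * P 0) &
      T2 0 ^+ 2 = 2 * c * P 0 * M 0].
Proof.
move=> addf fD1 MD1 PD1 PZ r0 f1 f2; rewrite !f1 !f2.
have e1 : 2 * (1 / (2 * r)) = 1 / r by field.
have e2 : (1 + (v + 1)) / (2 * r) = (v + 1) / (2 * r) + 1 / (2 * r) by ring.
have e3 : v / (2 * r) = (v + 1) / (2 * r) - 1 / (2 * r) by ring.
rewrite e2 e3 -e1 mul0r.
(* Centred at [v + 1], the arguments [v + 2] and [v] are [z + y] and [z - y]. *)
move: (1 / (2 * r)) ((v + 1) / (2 * r)) => y z.
split; split.
- exact: (addition_minus addf).
- exact: (addition_shift_minus addf).
- exact: (addition_mixed addf).
- exact: (addition_sqr addf).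
- exact: (addition_shift_sqr addf).
have := addition_shift_sqr addf MD1 PD1 0.
by rewrite mulr0 => ->; ring.
Qed.

(** * Crossing symmetry of the weights *)

Section Modular.
Variable R : realType.
Local Notation C := R[i].
Local Notation pii := (cpi R * 'i).

Lemma Re_pii_div_gt0 (t : C) : 0 < complex.Im t -> 0 < complex.Re (pii / t).
Proof.
move=> t0; have -> : pii / t = pi%:C * ('i%C * t^-1) by rewrite -complexiE mulrA.
case: t t0 => a b /= b0; rewrite !(mul0r, mul1r, add0r, sub0r, subr0, mulrN, mulNr, opprK).
rewrite mulr_gt0 ?pi_gt0// divr_gt0// ltr_pwDr ?sqr_ge0//.
by rewrite exprn_even_gt0//= gt_eqF.
Qed.

(** [jacobi_imaginary] at the points [w + 1/2 + t/2] and 0, followed by the triple product at the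
    transformed nome; everything independent of [w] goes into [c]. *)
Lemma mtheta_modular (t : C) : 0 < complex.Im t -> exists c, forall w,
  let Z := cexp (2 * pii * w / t) in let P := cexp (- (2 * pii / t)) in
  mtheta t (w + 2^-1) = c * cexp (- (pii * (w ^+ 2 + w) / t)) * (qprod Z P * qprod (P / Z) P).
Proof.
move=> t0; have tn0 : t != 0 by apply/eqP => e; move: t0; rewrite e ltxx.
have al0 : complex.Re (pii * t) < 0 by rewrite Re_pii oppr_lt0 mulr_gt0 ?pi_gt0.
have pi0 := cpi_neq0 R.
have i0 : 'i%R != 0 :> C by rewrite -cexp_pii2 cexp_neq0.
have i2 : 'i%R ^+ 2 = -1 :> C := sqrCi C.
pose A : C := pii / t.
have eA : - cpi R ^+ 2 / (pii * t) = A.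
  have -> : - cpi R ^+ 2 / (pii * t) = (-1) * cpi R ^+ 2 / (pii * t) by ring.
  rewrite -i2 /A; move: (cpi R) ('i%R : C) pi0 i0 => b i b0 i1; field.
  by rewrite b0 i1 tn0.
have nA : complex.Re (- A) < 0.
  by have := Re_pii_div_gt0 t0; rewrite -/A; case: (A) => a b /=; rewrite oppr_lt0.
(* The value at the reference point 0 will be divided out. *)
have g0 : jsum (- A) 0 != 0.
  have q1 : normc (cexp (- A)) < 1 by rewrite normc_cexp_lt1.
  have ne n : - cexp (- A) * cexp ((- A) *+ 2) ^+ n != 1.
    apply/eqP => /(congr1 (@normc R)); rewrite normcM normcN cexpMn -exprM normcX normc1.
    rewrite -exprS => e; have : normc (cexp (- A)) ^+ (2 * n).+1 < 1.
      by rewrite exprn_ilt1 ?normc_ge0.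
    by rewrite e ltxx.
  by apply: jsum_neq0 => // n; rewrite cexp0 ?mulr1 ?divr1.
exists (cexp (pii / 2) * cexp (- (A * (2^-1 + t / 2) ^+ 2)) *
   (jsum (pii * t) 0 / jsum (- A) 0) * qprod (cexp (- A *+ 2)) (cexp (- A *+ 2))) => w Z P.
have := jacobi_imaginary (w + 2^-1 + t / 2) 0 al0; rewrite eA /=.
rewrite !mulr0 expr0n/= mulr0 oppr0 cexp0 mul1r.
have PA : cexp (- A *+ 2) = P by rewrite /P -mulr_natl /A; congr cexp; ring.
have -> : jsum (- A) (2 * A * (w + 2^-1 + t / 2)) = qprod P P * (qprod Z P * qprod (P / Z) P).
  rewrite triple_product// PA.
  have -> : - (cexp (- A) * cexp (2 * A * (w + 2^-1 + t / 2))) = Z.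
    rewrite -cexpD -mulN1r -(cexp_pii R) -cexpD.
    rewrite (_ : pii + (- A + 2 * A * (w + 2^-1 + t / 2)) = 2 * pii * w / t + 2 * cpi R * 'i * 1%:~R).
      by rewrite cexpD cexp_2pi_int mulr1.
    by rewrite (_ : 1%:~R = 1 :> C)// /A; field.
  have -> : - (cexp (- A) / cexp (2 * A * (w + 2^-1 + t / 2))) = P / Z.
    rewrite -cexpB -mulN1r -(cexp_pii R) -cexpD /P /Z -cexpB.
    by congr cexp; rewrite /A; field.
  by rewrite -(mulrA (qprod P P)).
have -> : 2 * cpi R * 'i * (w + 2^-1 + t / 2) = 2 * pii * (w + 2^-1 + t / 2) by ring.
move=> h; rewrite /mtheta.
have -> : 2 * pii * (w + 2^-1) + pii * t = 2 * pii * (w + 2^-1 + t / 2) by field.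
rewrite PA; move: h; set J := jsum (pii * t) (_ * (_ + _)); set J0 := jsum (pii * t) 0.
set X := qprod Z P * _; set Y := qprod P P; move: (jsum (- A) 0) g0 => g g0 h.
have -> : J = cexp (- (A * (w + 2^-1 + t / 2) ^+ 2)) * (Y * X) * J0 / g.
  by rewrite h; field.
have E : cexp (pii * (w + 2^-1)) * cexp (- (A * (w + 2^-1 + t / 2) ^+ 2)) =
    cexp (pii / 2) * cexp (- (A * (2^-1 + t / 2) ^+ 2)) * cexp (- (pii * (w ^+ 2 + w) / t)).
  by rewrite -!cexpD; congr cexp; rewrite /A; field.
rewrite -(mulrA (cexp (- _))) -(mulrA (cexp (- _))) mulrA E.
move: (cexp _) (cexp _) (cexp _) => E1 E2 E3; ring.
Qed.

Lemma theta12_modular (t : C) : 0 < complex.Im t -> exists c, forall v,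
  let Z := cexp (2 * pii * (2 * v) / t) in let P := cexp (- (2 * pii / t)) in
  vartheta1 v (t / 2) * vartheta2 v (t / 2) =
  c * cexp (- (pii * ((2 * v) ^+ 2 + 2 * v) / t)) * (qprod Z P * qprod (P / Z) P).
Proof.
move=> t0; have [c hc] := mtheta_modular t0.
have [d d0 hd] := vartheta1_addition t0.
have M0 : vartheta2 2^-1 t = 0 by rewrite vartheta2_jsum// mtheta_half// mulr0.
have := @addition_prod C (fun v => vartheta1 v (t / 2)) (fun v => vartheta3 v t)
  (fun v => vartheta2 v t) d hd _ M0 => hp.
exists (- d * vartheta3 2^-1 t * nomeX t 8^-1 * c) => v Z P.
apply: etrans (hp v) _; rewrite vartheta2_jsum// hc -/Z -/P.
by move: (qprod _ _) (qprod _ _) (cexp _) (vartheta3 _ _) (nomeX _ _) => *; ring.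
Qed.

End Modular.

(** * Double infinite products *)

Section DoubleProduct.
Variable R : realType.
Local Notation C := R[i].
Variables q1 q2 : C.
Hypothesis q11 : normc q1 < 1.
Hypothesis q21 : normc q2 < 1.

(** Linear in [|z|] for bounded [z]; at [z q1^m] this is geometric in [m], whence convergence of the
    outer product. *)
Lemma normc_qprod_sub1_le (z : C) : normc (qprod z q2 - 1) <=
  normc z / (1 - normc q2) * expR (normc z / (1 - normc q2)).
Proof.
set s := normc z / _; apply: (@tends_normc_le _ (fun N => \prod_(n < N) (1 - z * q2 ^+ n) - 1)).
  by apply: eq_tends (tendsD (qprod_tends z q21) (@tends_cst C (-1))) => n.
move=> N; have h := normc_prod1D_sub1_le (fun n => - (z * q2 ^+ n)) (index_iota 0 N).
rewrite !big_mkord in h; apply: le_trans h _.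
apply: le_trans (_ : expR s - 1 <= _); last exact: expR_sub1_le.
by rewrite lerD2r ler_expR; exact: qprod_sum_le.
Qed.

Lemma dqpoch_tends (z : C) :
  tends (fun N => \prod_(m < N) qprod (z * q1 ^+ m) q2) (dqpoch z q1 q2).
Proof.
pose S := normc z / (1 - normc q2).
have q0 : 0 < 1 - normc q2 by rewrite subr_gt0.
have S0 : 0 <= S by rewrite divr_ge0 ?normc_ge0// ltW.
have [N|l hl] := @prod1D_tends R (fun m => qprod (z * q1 ^+ m) q2 - 1)
    (S * expR S * (1 - normc q1)^-1).
  apply: (@le_trans _ _ (\sum_(m < N) (S * expR S) * normc q1 ^+ m)); last first.
    rewrite -mulr_sumr; apply: ler_wpM2l; first by rewrite mulr_ge0 ?expR_ge0.
    exact: (geometric_sum_le N (normc_ge0 q1) q11).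
  apply: ler_sum => m _; apply: le_trans (normc_qprod_sub1_le _) _.
  rewrite normcM normcX.
  have -> : normc z * normc q1 ^+ m / (1 - normc q2) = S * normc q1 ^+ m by rewrite mulrAC.
  have m0 : 0 <= normc q1 ^+ m by rewrite exprn_ge0 ?normc_ge0.
  have m1 : normc q1 ^+ m <= 1 by rewrite exprn_ile1 ?normc_ge0// ltW.
  rewrite mulrAC ler_wpM2r// ler_wpM2l// ler_expR; nra.
have e : (fun N => \prod_(m < N) (1 + (qprod (z * q1 ^+ m) q2 - 1))) =
    (fun N => \prod_(m < N) qprod (z * q1 ^+ m) q2).
  by apply/funext => N; apply: eq_bigr => m _; rewrite addrC subrK.
rewrite e in hl; suff -> : dqpoch z q1 q2 = l by [].
exact: tends_lim hl.
Qed.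

Lemma dqpoch_rec (z : C) : dqpoch z q1 q2 = qprod z q2 * dqpoch (z * q1 ^+ 1) q1 q2.
Proof.
have hs n : (n <= n.+1)%N by [].
have h1 := tends_comp hs (@dqpoch_tends z); apply: (tends_uniq h1).
apply: eq_tends (tendsM (@tends_cst C (qprod z q2)) (@dqpoch_tends (z * q1 ^+ 1))) => N.
rewrite /= big_ord_recl expr0 mulr1; congr (_ * _); apply: eq_bigr => i _.
by rewrite expr1 exprS mulrA.
Qed.

End DoubleProduct.

(** With [z = x^(2 u)] the crossed variable is [(x^2 z)^-1]. The eight double products on either
    side agree or have arguments differing by a factor [x^4], so [hD] reduces their quotient to
    single products [q], exactly those of the theta functions. *)
Lemma crossing_products (F : fieldType) (D q N M : F -> F) (x p z e0 e1 : F) :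
  x != 0 -> z != 0 ->
  (forall y, D y = q y * D (y * x ^+ 4)) -> (forall y, q y = (1 - y) * q (y * p)) ->
  (forall y, N y = D (p * x ^+ 2 * y) * D (x ^+ 2 * y) * D (p / y) * D (x ^+ 4 / y)) ->
  (forall y, M y = D (p * x ^+ 2 / y) * D (x ^+ 2 / y) * D (p * y) * D (x ^+ 4 * y)) ->
  e1 = x ^+ 2 * z * e0 ->
  N (x ^+ 2 * z)^-1 * M z * (e1 * (q (x ^+ 2 * z)^-1 * q (p * (x ^+ 2 * z)))) =
  - (N z * M (x ^+ 2 * z)^-1 * (e0 * (q z^-1 * q (p * z)))).
Proof.
move=> x0 z0 hD hq hN hM ->.
have -> : N (x ^+ 2 * z)^-1 = D (p / z) * D z^-1 * D (p * x ^+ 2 * z) * D (x ^+ 6 * z).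
  by rewrite hN !invrK; congr (D _ * D _ * D _ * D _); field; rewrite ?x0 ?z0.
have -> : M (x ^+ 2 * z)^-1 =
    D (p * x ^+ 4 * z) * D (x ^+ 4 * z) * D (p / (x ^+ 2 * z)) * D (x ^+ 2 / z).
  by rewrite hM !invrK; congr (D _ * D _ * D _ * D _); field; rewrite ?x0 ?z0.
rewrite hN hM.
have -> : D z^-1 = q z^-1 * D (x ^+ 4 / z) by rewrite hD [_ * x ^+ 4]mulrC.
have -> : D (p * z) = q (p * z) * D (p * x ^+ 4 * z).
  by rewrite hD; congr (_ * D _); ring.
have -> : D (x ^+ 2 * z) = q (x ^+ 2 * z) * D (x ^+ 6 * z).
  by rewrite hD; congr (_ * D _); ring.
have -> : D (p / (x ^+ 2 * z)) = q (p / (x ^+ 2 * z)) * D (p * x ^+ 2 / z).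
  by rewrite hD; congr (_ * D _); field; rewrite x0 z0.
(* The sign arises here: [x^2 z (1 - (x^2 z)^-1) = - (1 - x^2 z)]. *)
rewrite (hq (x ^+ 2 * z)^-1) (hq (x ^+ 2 * z)).
rewrite ![_ * p]mulrC.
move: (D (p / z)) (D (x ^+ 4 / z)) (D (p * x ^+ 2 * z)) (D (x ^+ 6 * z)).
move: (D (p * x ^+ 2 / z)) (D (x ^+ 2 / z)) (D (p * x ^+ 4 * z)) (D (x ^+ 4 * z)).
move: (q (p / _)) (q z^-1) (q (p * z)) (q (p * _)) => *; field.
by rewrite x0 z0.
Qed.

Section RCrossing.
Variable R : realType.
Local Notation C := R[i].
Local Notation pii := (cpi R * 'i).
Variables K K' lambda : C.
Hypothesis tau0 : 0 < complex.Im (tau K K').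
Hypothesis x1 : `|xx K lambda| < 1.

Local Notation r := (rr K' lambda).
Local Notation t := (tau K K').
Local Notation p := (pp K K').
Local Notation x := (xx K lambda).
Local Notation th1 := (theta1 K K' lambda).
Local Notation th2 := (theta2 K K' lambda).

Let pi0 : cpi R != 0 := cpi_neq0 R.
Let i0 : 'i%R != 0 :> C.
Proof. by rewrite -cexp_pii2 cexp_neq0. Qed.

Lemma K_neq0 : K != 0.
Proof.
by apply/eqP => e; move: tau0; rewrite /tau e mulr0 mul0r ltxx.
Qed.

Lemma K'_neq0 : K' != 0.
Proof.
by apply/eqP => e; move: tau0; rewrite /tau e invr0 mulr0 ltxx.
Qed.

Lemma lambda_neq0 : lambda != 0.
Proof.
apply/eqP => e; move: x1.
by rewrite /xx /xpow e mulr0 !mul0r oppr0 cexp0 normr1 ltxx.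
Qed.

Let K0 := K_neq0.
Let K'0 := K'_neq0.
Let l0 := lambda_neq0.

Lemma pp_tau : p = cexp (- (2 * pii / t)).
Proof.
rewrite /pp /tau; congr cexp.
by field; rewrite ?i0 ?K0 ?K'0.
Qed.

Lemma normc_pp_lt1 : normc p < 1.
Proof.
rewrite pp_tau normc_cexp_lt1 -mulrA.
have := Re_pii_div_gt0 tau0; case: (pii / t) => a b /= a0; lra.
Qed.

Lemma normc_xx_lt1 : normc x < 1.
Proof. by move: x1; rewrite normr_normc ltcR. Qed.

Lemma xpow_neq0 (s : C) : xpow K lambda s != 0. Proof. exact: cexp_neq0. Qed.

Lemma xpowD (s s' : C) : xpow K lambda (s + s') = xpow K lambda s * xpow K lambda s'.
Proof. by rewrite /xpow -cexpD; congr cexp; field. Qed.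

Lemma xpowN (s : C) : xpow K lambda (- s) = (xpow K lambda s)^-1.
Proof. by rewrite /xpow -cexpN; congr cexp; field. Qed.

Lemma xpow2 : xpow K lambda 2 = x ^+ 2.
Proof. by rewrite /xx expr2 -xpowD; congr xpow; ring. Qed.

Let zp (u : C) := xpow K lambda (2 * u * - ((r - 1) / (2 * r))).

(** As [exp(2 pi i (u / r) / tau) = x^(- 2 u)] and [exp(- 2 pi i / tau) = p], the modular
    transformation lands on the variables of [R0]. *)
Lemma theta12_product : exists c, forall u,
  th1 u * th2 u = c * cexp (- (pii * ((u / r) ^+ 2 + u / r) / t)) *
    (qprod (xpow K lambda (2 * u))^-1 p * qprod (p * xpow K lambda (2 * u)) p).
Proof.
have [c hc] := theta12_modular tau0; exists c => u.
have r0 : r != 0 by rewrite /rr mulf_neq0 ?invr_eq0.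
have /= := hc (u / (2 * r)); rewrite -pp_tau.
have -> : 2 * (u / (2 * r)) = u / r by field.
have -> : cexp (2 * pii * (u / r) / t) = (xpow K lambda (2 * u))^-1.
  rewrite -xpowN /xpow /tau /rr; congr cexp.
  by field; rewrite ?i0 ?K0 ?K'0 ?l0.
by rewrite invrK.
Qed.

Lemma R0_crossing u :
  R0_num K K' lambda (- u - 1) * R0_den K K' lambda u * (zp (- u - 1) * (th1 (1 + u) * th2 (1 + u)))
  = - (R0_num K K' lambda u * R0_den K K' lambda (- u - 1) * (zp u * (th1 u * th2 u))).
Proof.
have [c hc] := theta12_product; rewrite !hc.
pose z := xpow K lambda (2 * u).
have z0 : z != 0 by exact: xpow_neq0.
have x0 : x != 0 by exact: xpow_neq0.
have r0 : r != 0 by rewrite /rr mulf_neq0 ?invr_eq0.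
have zS : xpow K lambda (2 * (1 + u)) = x ^+ 2 * z by rewrite mulrDr mulr1 xpowD xpow2.
have z' : xpow K lambda (2 * (- u - 1)) = (x ^+ 2 * z)^-1.
  by rewrite -zS -xpowN; congr xpow; ring.
have x4 : normc (x ^+ 4) < 1 by rewrite normcX exprn_ilt1 ?normc_ge0 ?normc_xx_lt1.
pose D y := dqpoch y (x ^+ 4) p; pose q y := qprod y p.
have hD y : D y = q y * D (y * x ^+ 4).
  by rewrite /D (dqpoch_rec x4 normc_pp_lt1) expr1.
have hq y : q y = (1 - y) * q (y * p) by exact: qprod_rec normc_pp_lt1.
pose E (v : C) := zp v * (c * cexp (- (pii * ((v / r) ^+ 2 + v / r) / t))).
pose e1 := zp (- u - 1) * (c * cexp (- (pii * (((1 + u) / r) ^+ 2 + (1 + u) / r) / t))).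
(* The quadratic exponents at [1 + u] and at [u] differ by a linear one, which the prefactors of
   [R0] complete to exactly [x^2 z]. *)
have he : e1 = x ^+ 2 * z * E u.
  rewrite /e1 /E -zS /zp /xpow.
  transitivity (c * (cexp (- (cpi R * lambda * (2 * (- u - 1) * - ((r - 1) / (2 * r))) / (2 * K))) *
    cexp (- (pii * (((1 + u) / r) ^+ 2 + (1 + u) / r) / t)))); first by ring.
  transitivity (c * (cexp (- (cpi R * lambda * (2 * (1 + u)) / (2 * K))) *
    (cexp (- (cpi R * lambda * (2 * u * - ((r - 1) / (2 * r))) / (2 * K))) *
    cexp (- (pii * ((u / r) ^+ 2 + u / r) / t))))); last by ring.
  rewrite -!cexpD; congr (_ * cexp _); rewrite /tau /rr.
  by field; rewrite ?i0 ?K0 ?K'0 ?l0.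
pose N y := D (p * x ^+ 2 * y) * D (x ^+ 2 * y) * D (p / y) * D (x ^+ 4 / y).
pose M y := D (p * x ^+ 2 / y) * D (x ^+ 2 / y) * D (p * y) * D (x ^+ 4 * y).
have eN v : R0_num K K' lambda v = N (xpow K lambda (2 * v)) by [].
have eM v : R0_den K K' lambda v = M (xpow K lambda (2 * v)) by [].
rewrite !eN !eM zS z' -/z.
have := crossing_products x0 z0 hD hq (fun y => erefl (N y)) (fun y => erefl (M y)) he.
rewrite /e1 /E /q; move: (qprod _ _) (qprod _ _) (qprod _ _) (qprod _ _) => q1 q2 q3 q4.
move: (N _) (M _) (N _) (M _) (zp _) (zp _) (cexp _) (cexp _) => n1 m1 n2 m2 z1 z2 E1 E2.
by rewrite !mulrA.
Qed.

Lemma theta1N u : th1 (- u) = - th1 u.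
Proof. by rewrite /theta1 mulNr vartheta1N// Im_half_gt0. Qed.

Lemma theta2N u : th2 (- u) = th2 u.
Proof. by rewrite /theta2 mulNr vartheta2N// Im_half_gt0. Qed.

Lemma theta2_0_neq0 : th2 0 != 0.
Proof. by rewrite /theta2 mul0r vartheta2_0_neq0// Im_half_gt0. Qed.

Lemma R0_crossing_ratio u : R0_den K K' lambda u != 0 -> R0_den K K' lambda (- u - 1) != 0 ->
  R0 K K' lambda (- u - 1) * (th1 (1 + u) * th2 (1 + u)) =
  - (R0 K K' lambda u * (th1 u * th2 u)).
Proof.
move=> d0 d1; have h := R0_crossing u.
have e v : R0 K K' lambda v = zp v * (R0_num K K' lambda v / R0_den K K' lambda v) by [].
rewrite !e; move: h d0 d1; move: (th1 _ * _) (th1 _ * _) (zp _) (zp _) => Y X z2 z1.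
move: (R0_num _ _ _ _) (R0_num _ _ _ _) (R0_den _ _ _ _) (R0_den _ _ _ _) => n2 n1 m2 m1.
move=> h m10 m20; have mm : m1 * m2 != 0 by rewrite mulf_neq0.
apply: (mulIf mm); transitivity (n1 * m1 * (z1 * X)); first by field.
by rewrite h; field.
Qed.

Definition wa u := R0 K K' lambda u * Ra K K' lambda u.
Definition wb u := R0 K K' lambda u * Rb K K' lambda u.
Definition wc u := R0 K K' lambda u * Rc K K' lambda u.
Definition wd u := R0 K K' lambda u * Rd K K' lambda u.

(** In all four cases the quotient of the two sides without [R0] is, up to sign, [theta1 theta2] at
    [1 + u] over the same product at [u]; this is what [R0] compensates. *)
Lemma weights_crossing u :
  R_regular K K' lambda u -> R_regular K K' lambda (- u - 1) ->
  [/\ wa (- u - 1) = - wb u, wb (- u - 1) = - wa u,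
      wc (- u - 1) = wc u & wd (- u - 1) = wd u].
Proof.
move=> /and3P[h1 h2 h3] /and3P[k1 k2 k3].
have := R0_crossing_ratio h3 k3.
have e1 : 1 + (- u - 1) = - u by ring.
have e2 : - u - 1 = - (1 + u) by ring.
rewrite e1 theta1N oppr_eq0 in k1; rewrite e1 theta2N in k2.
rewrite /wa /wb /wc /wd /Ra /Rb /Rc /Rd e1 !theta1N !theta2N.
have -> : th1 (- u - 1) = - th1 (1 + u) by rewrite e2 theta1N.
have -> : th2 (- u - 1) = th2 (1 + u) by rewrite e2 theta2N.
move: h1 h2 k1 k2 theta2_0_neq0.
move: (th1 (1 + u)) (th2 (1 + u)) (th1 u) (th2 u) (th1 1) (th2 1) (th2 0).
move: (R0 _ _ _ _) (R0 _ _ _ _) => r0 r1 f1 g1 f0 g0 k h g nf1 ng1 nf0 ng0 ng e.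
have -> : r1 = - (r0 * (f0 * g0)) / (f1 * g1) by rewrite -e; field; rewrite nf1 ng1.
by split; field; rewrite ?nf1 ?ng1 ?nf0 ?ng0 ?ng.
Qed.

End RCrossing.

(** * Quadratic relations between the weights *)

Section WeightRelations.
Variable F : fieldType.
Hypothesis two0 : 2 != 0 :> F.
(** Dictionary: [f0, f1, f2] and [g0, g1, g2] are [theta1] and [theta2] at [v, v + 1, v + 2];
    [k, h, g] are [theta1 1, theta2 1, theta2 0]; [Z, P, M] are [vartheta0, vartheta3, vartheta2],
    with index 0 at 0 and index 1 at [1 / r]. The capital weights below belong to [v + 1], the small
    ones to [v], all without [R0]. *)
Variables (f0 f1 f2 g0 g1 g2 k h g c Z0 Z1 P0 P1 M0 M1 : F).
Hypothesis (nf1 : f1 != 0) (nf2 : f2 != 0) (ng1 : g1 != 0) (ng2 : g2 != 0) (ng : g != 0).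
Hypothesis (nc : c != 0) (nZ0 : Z0 != 0) (nZ1 : Z1 != 0) (nP0 : P0 != 0) (nM0 : M0 != 0)
  (nM1 : M1 != 0).
Hypothesis add1 : f2 * f0 * g ^+ 2 = f1 ^+ 2 * h ^+ 2 - g1 ^+ 2 * k ^+ 2.
Hypothesis add2 : g2 * g0 * g ^+ 2 = g1 ^+ 2 * h ^+ 2 - f1 ^+ 2 * k ^+ 2.
Hypothesis mix : (f2 * g0 + g2 * f0) * Z0 = 2 * (f1 * g1) * Z1.
Hypothesis sqk : k ^+ 2 = c * (P1 * M0 - M1 * P0).
Hypothesis sqh : h ^+ 2 = c * (P1 * M0 + M1 * P0).
Hypothesis sqg : g ^+ 2 = 2 * c * P0 * M0.

Let A := h * g1 / (g * g2).
Let B := h * f1 / (g * f2).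
Let C := k * g1 / (g * f2).
Let D := - (k * f1 / (g * g2)).
Let a := h * g0 / (g * g1).
Let b := h * f0 / (g * f1).
Let c' := k * g0 / (g * f1).
Let d := - (k * f0 / (g * g1)).

Let xi2 := - 2^-1 * (Z0 * P1 / (Z1 * P0)).
Let eta2 := - (M0 * P1 / (M1 * P0)).
Let al := (1 + eta2) / 2.
Let de := (1 - eta2) / 2.

Lemma fusion_AdDb : A * d = D * b.
Proof. by rewrite /A /D /d /b; field; rewrite ?nf1 ?nf2 ?ng1 ?ng2 ?ng. Qed.

Lemma fusion_BcCa : B * c' = C * a.
Proof. by rewrite /B /C /c' /a; field; rewrite ?nf1 ?nf2 ?ng1 ?ng2 ?ng. Qed.

Lemma fusion_sym : A * b + C * c' = B * a + D * d.
Proof.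
(* The numerator of the difference of the two sides; after multiplication by [g^2] the addition
   relations make it vanish. *)
pose N := h ^+ 2 * g1 ^+ 2 * (f2 * f0) + k ^+ 2 * g1 ^+ 2 * (g2 * g0)
  - h ^+ 2 * f1 ^+ 2 * (g2 * g0) - k ^+ 2 * f1 ^+ 2 * (f2 * f0).
have N0 : N = 0.
  have g20 : g ^+ 2 != 0 by rewrite expf_neq0.
  apply: (mulIf g20); rewrite mul0r.
  transitivity (h ^+ 2 * g1 ^+ 2 * (f2 * f0 * g ^+ 2) + k ^+ 2 * g1 ^+ 2 * (g2 * g0 * g ^+ 2)
    - h ^+ 2 * f1 ^+ 2 * (g2 * g0 * g ^+ 2) - k ^+ 2 * f1 ^+ 2 * (f2 * f0 * g ^+ 2)).
    by rewrite /N; ring.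
  by rewrite add1 add2; ring.
apply/eqP; rewrite -subr_eq0; apply/eqP.
transitivity (N / (g ^+ 2 * f1 * g1 * f2 * g2)); last by rewrite N0 mul0r.
by rewrite /N /A /B /C /D /a /b /c' /d; field; rewrite ?nf1 ?nf2 ?ng1 ?ng2 ?ng.
Qed.

Let diff : h ^+ 2 - k ^+ 2 = 2 * c * M1 * P0. Proof. by rewrite sqk sqh; ring. Qed.

Let diff0 : h ^+ 2 - k ^+ 2 != 0.
Proof. by rewrite diff !mulf_neq0. Qed.

(** Through [sqk] and [sqh], the entries [(1 + eta^2) / 2] and [(1 - eta^2) / 2] of Q are in the
    ratio of [- k^2] to [h^2], which explains the formula for [eta^2]. *)
Let alE : al = - k ^+ 2 / (h ^+ 2 - k ^+ 2).
Proof.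
by rewrite diff sqk /al /eta2; field; rewrite ?two0 ?nc ?nM1 ?nP0.
Qed.

Let deE : de = h ^+ 2 / (h ^+ 2 - k ^+ 2).
Proof.
by rewrite diff sqh /de /eta2; field; rewrite ?two0 ?nc ?nM1 ?nP0.
Qed.

Lemma crossing_diag : al * (A * a - B * b) = de * (D * c' - C * d).
Proof.
rewrite alE deE /A /B /C /D /a /b /c' /d; field.
by rewrite ?nf1 ?nf2 ?ng1 ?ng2 ?ng ?diff0.
Qed.

Let mixE : f2 * g0 + g2 * f0 = 2 * (f1 * g1) * Z1 / Z0.
Proof. by rewrite -mix mulfK. Qed.

Let sum_ratio : (h ^+ 2 + k ^+ 2) / g ^+ 2 = P1 / P0.
Proof. by rewrite sqg sqk sqh; field; rewrite ?two0 ?nc ?nM0 ?nP0. Qed.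

Let f2f0 : f2 * f0 = (f1 ^+ 2 * h ^+ 2 - g1 ^+ 2 * k ^+ 2) / g ^+ 2.
Proof. by rewrite -add1 mulfK// expf_neq0. Qed.

Let g2g0 : g2 * g0 = (g1 ^+ 2 * h ^+ 2 - f1 ^+ 2 * k ^+ 2) / g ^+ 2.
Proof. by rewrite -add2 mulfK// expf_neq0. Qed.

(** Origin of [xi^2]: [mix] produces the factor [Z1 / Z0], [T] the factor [P1 / P0], and the
    quotient of the two is what Q has to compensate. *)
Lemma crossing_mixed1 : al * (A * d) + de * (B * c') = - xi2 * (A * c' + C * b).
Proof.
have L : al * (A * d) + de * (B * c') =
    k * h / (g ^+ 2 * f2 * g2) * (de * (g2 * g0) - al * (f2 * f0)).
  by rewrite /A /B /d /c'; move: al de => x y; field; rewrite ?nf1 ?nf2 ?ng1 ?ng2 ?ng.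
have E : A * c' + C * b = k * h / (g ^+ 2 * f2 * g2) * (g1 / f1) * (f2 * g0 + g2 * f0).
  by rewrite /A /C /b /c'; field; rewrite ?nf1 ?nf2 ?ng1 ?ng2 ?ng.
(* The terms in [f1^2] cancel and [g1^2 (h^4 - k^4)] remains, divisible by the common denominator
   [h^2 - k^2] of [al] and [de]. *)
have T : de * (g2 * g0) - al * (f2 * f0) = g1 ^+ 2 * (P1 / P0).
  by rewrite g2g0 f2f0 -sum_ratio alE deE; field; rewrite ?ng ?diff0.
rewrite L E T mixE /xi2; field.
by rewrite ?two0 ?nf1 ?nf2 ?ng1 ?ng2 ?ng ?nZ0 ?nZ1 ?nP0.
Qed.

Lemma crossing_mixed2 : de * (A * d) + al * (B * c') = - xi2 * (B * d + D * a).
Proof.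
have L : de * (A * d) + al * (B * c') =
    k * h / (g ^+ 2 * f2 * g2) * (al * (g2 * g0) - de * (f2 * f0)).
  by rewrite /A /B /d /c'; move: al de => x y; field; rewrite ?nf1 ?nf2 ?ng1 ?ng2 ?ng.
have E : B * d + D * a = - (k * h / (g ^+ 2 * f2 * g2) * (f1 / g1) * (f2 * g0 + g2 * f0)).
  by rewrite /B /D /a /d; field; rewrite ?nf1 ?nf2 ?ng1 ?ng2 ?ng.
have T : al * (g2 * g0) - de * (f2 * f0) = - (f1 ^+ 2 * (P1 / P0)).
  by rewrite g2g0 f2f0 -sum_ratio alE deE; field; rewrite ?ng ?diff0.
rewrite L E T mixE /xi2; field.
by rewrite ?two0 ?nf1 ?nf2 ?ng1 ?ng2 ?ng ?nZ0 ?nZ1 ?nP0.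
Qed.

End WeightRelations.

(** * Fusion *)

Section TensorSums.
Variable F : fieldType.

Lemma tensmx_suml (I : finType) m n p q (G : I -> 'M[F]_(m, n)) (B : 'M[F]_(p, q)) :
  (\sum_i G i) *t B = \sum_i G i *t B.
Proof.
apply/matrixP => i j; rewrite !mxE !summxE mulr_suml.
by apply: eq_bigr => k _; rewrite !mxE.
Qed.

Lemma tensmx_sumr (I : finType) m n p q (B : 'M[F]_(m, n)) (G : I -> 'M[F]_(p, q)) :
  B *t (\sum_i G i) = \sum_i B *t G i.
Proof.
apply/matrixP => i j; rewrite !mxE !summxE mulr_sumr.
by apply: eq_bigr => k _; rewrite !mxE.
Qed.

Lemma tensmxZl m n p q (c : F) (A : 'M[F]_(m, n)) (B : 'M[F]_(p, q)) :
  (c *: A) *t B = c *: (A *t B).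
Proof. by apply/matrixP => i j; rewrite !mxE mulrA. Qed.

Lemma tensmxZr m n p q (c : F) (A : 'M[F]_(m, n)) (B : 'M[F]_(p, q)) :
  A *t (c *: B) = c *: (A *t B).
Proof. by apply/matrixP => i j; rewrite !mxE mulrCA. Qed.

Lemma tensmx11 m n : 1%:M *t 1%:M = 1%:M :> 'M[F]_(m * n).
Proof.
apply/matrixP => i j; case: (mxtens_indexP i) => i1 i2; case: (mxtens_indexP j) => j1 j2.
rewrite tensmxE !mxE (inj_eq (can_inj (@mxtens_indexK m n))) xpair_eqE.
by case: (i1 == j1); case: (i2 == j2); rewrite ?mulr1 ?mulr0 ?mul0r.
Qed.

Let swap_idx n (i : 'I_(n * n)) : 'I_(n * n) :=
  mxtens_index ((mxtens_unindex i).2, (mxtens_unindex i).1).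

Let swap_idxK n (i : 'I_(n * n)) : swap_idx (swap_idx i) = i.
Proof. by case: (mxtens_indexP i) => a b; rewrite /swap_idx !mxtens_indexK. Qed.

Let flip_mxE n (i j : 'I_(n * n)) : flip_mx F n i j = (i == swap_idx j)%:R.
Proof. by rewrite mxE -(can_eq (@mxtens_unindexK n n)) mxtens_indexK. Qed.

Lemma flip_tensmx n (A B : 'M[F]_n) :
  flip_mx F n *m (A *t B) *m flip_mx F n = B *t A.
Proof.
have flipl (M : 'M[F]_(n * n)) i j : (flip_mx F n *m M) i j = M (swap_idx i) j.
  rewrite mxE (bigD1 (swap_idx i))//= big1 => [|k nk].
    by rewrite flip_mxE swap_idxK eqxx mul1r addr0.
  rewrite flip_mxE; have -> : (i == swap_idx k) = false; last by rewrite mul0r.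
  by apply: contraNF nk => /eqP ->; rewrite swap_idxK.
have flipr (M : 'M[F]_(n * n)) i j : (M *m flip_mx F n) i j = M i (swap_idx j).
  rewrite mxE (bigD1 (swap_idx j))//= big1 => [|k /negPf nk].
    by rewrite flip_mxE eqxx mulr1 addr0.
  by rewrite flip_mxE nk mulr0.
by apply/matrixP => i j; rewrite flipr flipl !mxE !mxtens_indexK mulrC.
Qed.

Lemma flip_sum_tensmx (I : finType) n (G H : I -> 'M[F]_n) :
  flip_mx F n *m (\sum_i G i *t H i) *m flip_mx F n = \sum_i H i *t G i.
Proof.
rewrite mulmx_sumr mulmx_suml; apply: eq_bigr => i _; exact: flip_tensmx.
Qed.

Lemma ptrmx1_sum_tensmx (I : finType) m n (G : I -> 'M[F]_m) (H : I -> 'M[F]_n) :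
  ptrmx1 (\sum_i G i *t H i) = \sum_i (G i)^T *t H i.
Proof.
apply/matrixP => i j; rewrite mxE !summxE; apply: eq_bigr => k _.
by rewrite !mxE !mxtens_indexK.
Qed.

Lemma sum_delta (G : 'I_2 -> 'I_2 -> F) i j :
  \sum_(x : 'I_2 * 'I_2) G x.1 x.2 * ((i == x.1) && (j == x.2))%:R = G i j.
Proof.
rewrite (bigD1 (i, j))//= !eqxx mulr1 big1 ?addr0// => -[k l] /=.
rewrite xpair_eqE negb_and eq_sym [l == j]eq_sym.
by case: (i == k) => //=; case: (j == l) => //=; rewrite mulr0.
Qed.

Definition slice (A : 'M[F]_(2 * 2)) (x : 'I_2 * 'I_2) : 'M[F]_2 :=
  \matrix_(p, q) A (mxtens_index (p, x.1)) (mxtens_index (q, x.2)).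

Lemma forall_site (P : pred 'I_4) :
  [forall m, P m] = [&& P V1, P V2, P V1bar & P V2bar].
Proof.
apply/forallP/and4P => [h|[h1 h2 h3 h4] m]; first by split.
have e k (hk : (k < 4)%N) : Ordinal hk = inord k by apply: val_inj; rewrite /= inordK.
by case: m => [[|[|[|[|//]]]] hm]; rewrite e.
Qed.

Lemma site_idx (i1 i2 i3 i4 : 'I_2) :
  let s := site (mxtens_index (mxtens_index (i1, i2), mxtens_index (i3, i4))) in
  [/\ tnth s V1 = i1, tnth s V2 = i2, tnth s V1bar = i3 & tnth s V2bar = i4].
Proof.
by rewrite /= /site !mxtens_indexK /=; split; rewrite (tnth_nth i1) /= inordK.
Qed.

Lemma act_onE (k l : 'I_4) (A : 'M[F]_(2 * 2)) (i1 i2 i3 i4 j1 j2 j3 j4 : 'I_2) :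
  let i := mxtens_index (mxtens_index (i1, i2), mxtens_index (i3, i4)) in
  let j := mxtens_index (mxtens_index (j1, j2), mxtens_index (j3, j4)) in
  act_on k l A i j =
  A (mxtens_index (tnth (site i) k, tnth (site i) l))
    (mxtens_index (tnth (site j) k, tnth (site j) l)) *+
  [&& (V1 \notin [:: k; l]) ==> (i1 == j1), (V2 \notin [:: k; l]) ==> (i2 == j2),
      (V1bar \notin [:: k; l]) ==> (i3 == j3) & (V2bar \notin [:: k; l]) ==> (i4 == j4)].
Proof.
rewrite /= mxE forall_site.
have /= [-> -> -> ->] := site_idx i1 i2 i3 i4.
by have /= [-> -> -> ->] := site_idx j1 j2 j3 j4.
Qed.

Let matrix16P (M N : 'M[F]_((2 * 2) * (2 * 2))) :
  (forall i1 i2 i3 i4 j1 j2 j3 j4 : 'I_2,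
     M (mxtens_index (mxtens_index (i1, i2), mxtens_index (i3, i4)))
       (mxtens_index (mxtens_index (j1, j2), mxtens_index (j3, j4))) =
     N (mxtens_index (mxtens_index (i1, i2), mxtens_index (i3, i4)))
       (mxtens_index (mxtens_index (j1, j2), mxtens_index (j3, j4)))) -> M = N.
Proof.
move=> h; apply/matrixP => i j.
case: (mxtens_indexP i) => i12 i34; case: (mxtens_indexP i12) => i1 i2.
case: (mxtens_indexP i34) => i3 i4.
case: (mxtens_indexP j) => j12 j34; case: (mxtens_indexP j12) => j1 j2.
by case: (mxtens_indexP j34) => j3 j4.
Qed.

Let distinct :
  ((V1 == V2) = false) * ((V1 == V1bar) = false) * ((V1 == V2bar) = false) *
  ((V2 == V1bar) = false) * ((V2 == V2bar) = false) * ((V1bar == V2bar) = false) *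
  ((V2 == V1) = false) * ((V1bar == V1) = false) * ((V2bar == V1) = false) *
  ((V1bar == V2) = false) * ((V2bar == V2) = false) * ((V2bar == V1bar) = false).
Proof. by do !split; rewrite -val_eqE /= !inordK. Qed.

Lemma act_on_unbarred (A : 'M[F]_(2 * 2)) : act_on V1 V2 A = A *t 1%:M.
Proof.
apply: matrix16P => i1 i2 i3 i4 j1 j2 j3 j4.
have /= -> := act_onE V1 V2 A i1 i2 i3 i4 j1 j2 j3 j4.
have /= [-> -> _ _] := site_idx i1 i2 i3 i4; have /= [-> -> _ _] := site_idx j1 j2 j3 j4.
rewrite !inE !eqxx !distinct /=.
rewrite tensmxE mxE (inj_eq (can_inj (@mxtens_indexK 2 2))) xpair_eqE.
by rewrite mulr_natr.
Qed.

Lemma act_on_barred (A : 'M[F]_(2 * 2)) : act_on V1bar V2bar A = 1%:M *t A.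
Proof.
apply: matrix16P => i1 i2 i3 i4 j1 j2 j3 j4.
have /= -> := act_onE V1bar V2bar A i1 i2 i3 i4 j1 j2 j3 j4.
have /= [_ _ -> ->] := site_idx i1 i2 i3 i4; have /= [_ _ -> ->] := site_idx j1 j2 j3 j4.
rewrite !inE !eqxx !distinct /=.
rewrite tensmxE mxE (inj_eq (can_inj (@mxtens_indexK 2 2))) xpair_eqE.
by rewrite mulr_natl ?andbT.
Qed.

Lemma act_on_V1_V2bar (A : 'M[F]_(2 * 2)) : act_on V1 V2bar A =
  \sum_(x : 'I_2 * 'I_2) (slice A x *t 1%:M) *t (1%:M *t delta_mx x.1 x.2).
Proof.
apply: matrix16P => i1 i2 i3 i4 j1 j2 j3 j4.
have /= -> := act_onE V1 V2bar A i1 i2 i3 i4 j1 j2 j3 j4.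
have /= [-> _ _ ->] := site_idx i1 i2 i3 i4; have /= [-> _ _ ->] := site_idx j1 j2 j3 j4.
rewrite !inE !eqxx !distinct /= summxE.
rewrite -(sum_delta (fun k l => A (mxtens_index (i1, k)) (mxtens_index (j1, l))) i4 j4).
rewrite -sumrMnl; apply: eq_bigr => x _; rewrite !tensmxE !mxE.
by case: (i2 == j2); case: (i3 == j3); case: ((_ == x.1) && _);
  rewrite /= ?(mulr0, mul0r, mulr1, mul1r, mul0rn).
Qed.

Lemma act_on_V2_V2bar (A : 'M[F]_(2 * 2)) : act_on V2 V2bar A =
  \sum_(x : 'I_2 * 'I_2) (1%:M *t slice A x) *t (1%:M *t delta_mx x.1 x.2).
Proof.
apply: matrix16P => i1 i2 i3 i4 j1 j2 j3 j4.
have /= -> := act_onE V2 V2bar A i1 i2 i3 i4 j1 j2 j3 j4.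
have /= [_ -> _ ->] := site_idx i1 i2 i3 i4; have /= [_ -> _ ->] := site_idx j1 j2 j3 j4.
rewrite !inE !eqxx !distinct /= summxE.
rewrite -(sum_delta (fun k l => A (mxtens_index (i2, k)) (mxtens_index (j2, l))) i4 j4).
rewrite -sumrMnl; apply: eq_bigr => x _; rewrite !tensmxE !mxE.
by case: (i1 == j1); case: (i3 == j3); case: ((_ == x.1) && _);
  rewrite /= ?(mulr0, mul0r, mulr1, mul1r, mul0rn).
Qed.

Lemma act_on_V1_V1bar (A : 'M[F]_(2 * 2)) : act_on V1 V1bar A =
  \sum_(x : 'I_2 * 'I_2) (slice A x *t 1%:M) *t (delta_mx x.1 x.2 *t 1%:M).
Proof.
apply: matrix16P => i1 i2 i3 i4 j1 j2 j3 j4.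
have /= -> := act_onE V1 V1bar A i1 i2 i3 i4 j1 j2 j3 j4.
have /= [-> _ -> _] := site_idx i1 i2 i3 i4; have /= [-> _ -> _] := site_idx j1 j2 j3 j4.
rewrite !inE !eqxx !distinct /= summxE.
rewrite -(sum_delta (fun k l => A (mxtens_index (i1, k)) (mxtens_index (j1, l))) i3 j3).
rewrite -sumrMnl; apply: eq_bigr => x _; rewrite !tensmxE !mxE.
by case: (i2 == j2); case: (i4 == j4); case: ((_ == x.1) && _);
  rewrite /= ?(mulr0, mul0r, mulr1, mul1r, mul0rn).
Qed.

Lemma act_on_V2_V1bar (A : 'M[F]_(2 * 2)) : act_on V2 V1bar A =
  \sum_(x : 'I_2 * 'I_2) (1%:M *t slice A x) *t (delta_mx x.1 x.2 *t 1%:M).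
Proof.
apply: matrix16P => i1 i2 i3 i4 j1 j2 j3 j4.
have /= -> := act_onE V2 V1bar A i1 i2 i3 i4 j1 j2 j3 j4.
have /= [_ -> -> _] := site_idx i1 i2 i3 i4; have /= [_ -> -> _] := site_idx j1 j2 j3 j4.
rewrite !inE !eqxx !distinct /= summxE.
rewrite -(sum_delta (fun k l => A (mxtens_index (i2, k)) (mxtens_index (j2, l))) i3 j3).
rewrite -sumrMnl; apply: eq_bigr => x _; rewrite !tensmxE !mxE.
by case: (i1 == j1); case: (i4 == j4); case: ((_ == x.1) && _);
  rewrite /= ?(mulr0, mul0r, mulr1, mul1r, mul0rn).
Qed.

(* The block of A_(1 j) B_(2 j) with indices x in the space V_j. *)
Definition pair_block (A B : 'M[F]_(2 * 2)) (x : 'I_2 * 'I_2) : 'M[F]_(2 * 2) :=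
  \sum_(k < 2) slice A (x.1, k) *t slice B (k, x.2).

(** [H] places a matrix unit in one of the two barred spaces; the product of units contracts the
    inner index. *)
Lemma sum_pair_delta (G : 'I_2 * 'I_2 -> 'I_2 * 'I_2 -> 'M[F]_(2 * 2))
    (H : 'M[F]_2 -> 'M[F]_(2 * 2)) : H 0 = 0 ->
  \sum_(x : 'I_2 * 'I_2) \sum_(y : 'I_2 * 'I_2)
     G x y *t H (delta_mx x.1 x.2 *m delta_mx y.1 y.2) =
  \sum_(z : 'I_2 * 'I_2) (\sum_(k < 2) G (z.1, k) (k, z.2)) *t H (delta_mx z.1 z.2).
Proof.
move=> H0.
transitivity (\sum_(e < 2) \sum_(k < 2) \sum_(y : 'I_2 * 'I_2)
   G (e, k) y *t H (delta_mx e k *m delta_mx y.1 y.2)).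
  by rewrite [RHS]pair_bigA; apply: eq_bigr => -[].
transitivity (\sum_(e < 2) \sum_(f < 2) (\sum_(k < 2) G (e, k) (k, f)) *t H (delta_mx e f));
  last by rewrite [LHS]pair_bigA; apply: eq_bigr => -[].
apply: eq_bigr => e _.
transitivity (\sum_(k < 2) \sum_(f < 2) G (e, k) (k, f) *t H (delta_mx e f)); last first.
  by rewrite exchange_big; apply: eq_bigr => f _; rewrite tensmx_suml.
apply: eq_bigr => k _.
transitivity (\sum_(k' < 2) \sum_(f < 2) G (e, k) (k', f) *t H (delta_mx e k *m delta_mx k' f)).
  by rewrite [RHS]pair_bigA; apply: eq_bigr => -[].
rewrite (bigD1 k)//= [X in _ + X]big1 ?addr0.
  by apply: eq_bigr => f _; rewrite mul_delta_mx.
move=> k' nk; apply: big1 => f _.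
by rewrite mul_delta_mx_0 1?eq_sym// H0 tensmx0.
Qed.

Lemma act_on_pair_V2bar (A B : 'M[F]_(2 * 2)) : act_on V1 V2bar A *m act_on V2 V2bar B =
  \sum_(x : 'I_2 * 'I_2) pair_block A B x *t (1%:M *t delta_mx x.1 x.2).
Proof.
rewrite act_on_V1_V2bar act_on_V2_V2bar mulmx_suml.
under eq_bigr do rewrite mulmx_sumr.
rewrite -(@sum_pair_delta (fun x y => slice A x *t slice B y) (fun M => 1%:M *t M)) ?tensmx0//.
apply: eq_bigr => x _; apply: eq_bigr => y _.
by rewrite !tensmx_mul !mulmx1 !mul1mx.
Qed.

Lemma act_on_pair_V1bar (A B : 'M[F]_(2 * 2)) : act_on V1 V1bar A *m act_on V2 V1bar B =
  \sum_(x : 'I_2 * 'I_2) pair_block A B x *t (delta_mx x.1 x.2 *t 1%:M).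
Proof.
rewrite act_on_V1_V1bar act_on_V2_V1bar mulmx_suml.
under eq_bigr do rewrite mulmx_sumr.
rewrite -(@sum_pair_delta (fun x y => slice A x *t slice B y) (fun M => M *t 1%:M)) ?tens0mx//.
apply: eq_bigr => x _; apply: eq_bigr => y _.
by rewrite !tensmx_mul !mulmx1 !mul1mx.
Qed.

End TensorSums.

Section Fusion.
Variable F : fieldType.
Hypothesis two0 : 2 != 0 :> F.

Local Notation Cd := (sym_coord F).
Local Notation Bs := (sym_basis F).
Local Notation Pi := (symproj F).
Local Notation I2 := ('I_2 * 'I_2)%type.

Lemma sym_coord_proj : Cd *m Pi = Cd.
Proof. by rewrite -(sym_coordK two0) mulmxA (sym_basisK two0) mul1mx. Qed.

Definition fused_block (A B : 'M[F]_(2 * 2)) (x : I2) : 'M[F]_3 :=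
  Cd *m pair_block A B x *m Bs.

(** [x] and [y] each hold the row and column index of a matrix unit in one tensor factor. *)
Definition sym_unit (x y : I2) : 'M[F]_3 :=
  Cd *m (delta_mx x.1 x.2 *t delta_mx y.1 y.2) *m Bs.

Lemma fused_expansion A B A' B' :
  restr_sym (act_on V1bar V2bar Pi
    *m (act_on V1 V2 Pi *m act_on V1 V2bar A *m act_on V2 V2bar B)
    *m (act_on V1 V2 Pi *m act_on V1 V1bar A' *m act_on V2 V1bar B')) =
  \sum_(z : I2 * I2) (fused_block A B z.2 *m fused_block A' B' z.1) *t sym_unit z.1 z.2.
Proof.
rewrite /restr_sym act_on_unbarred act_on_barred -!(mulmxA (Pi *t 1%:M)).
rewrite act_on_pair_V2bar act_on_pair_V1bar.
set X := \sum_x _; set Y := \sum_x _.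
(* The outer projections are absorbed by [sym_coord]. The inner one on the unbarred spaces is kept:
   it factors through [V^(2)] and cuts the product into two fused blocks. *)
have assoc (X' Y' : 'M[F]_((2 * 2) * (2 * 2))) (W : 'M[F]_((2 * 2) * (2 * 2), 3 * 3)) :
    (Cd *t Cd) *m ((1%:M *t Pi) *m ((Pi *t 1%:M) *m X') *m ((Pi *t 1%:M) *m Y')) *m W =
    (Cd *t Cd) *m X' *m ((Pi *t 1%:M) *m (Y' *m W)).
  have {2}<- : (Cd *t Cd) *m (1%:M *t Pi) *m (Pi *t 1%:M) = Cd *t Cd.
    by rewrite tensmx_mul mulmx1 sym_coord_proj tensmx_mul mulmx1 sym_coord_proj.
  by rewrite !mulmxA.
rewrite assoc.
transitivity (\sum_(x : I2) \sum_(y : I2)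
    (fused_block A B y *m fused_block A' B' x) *t sym_unit x y); last first.
  by rewrite [LHS]pair_bigA; apply: eq_bigr => -[].
rewrite exchange_big mulmx_sumr mulmx_suml; apply: eq_bigr => y _.
rewrite mulmx_suml !mulmx_sumr; apply: eq_bigr => x _.
rewrite !tensmx_mul !mul1mx -(sym_coordK two0) /fused_block /sym_unit.
rewrite -!mulmxA; congr (_ *t (_ *m _)).
by rewrite mulmxA tensmx_mul mul1mx mulmx1.
Qed.

Let entry (M : 'M[F]_(2 * 2)) (z : I2 * I2) :=
  M (mxtens_index (z.1.1, z.2.1)) (mxtens_index (z.1.2, z.2.2)).

(** Expanding the unbarred factor in the same compressed units as the barred one turns the exchange
    of the factors into a relabelling of indices. *)
Let compress_sum (M : 'M[F]_(2 * 2)) :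
  Cd *m M *m Bs = \sum_(z : I2 * I2) entry M z *: sym_unit z.1 z.2.
Proof.
have {1}-> : M = \sum_(z : I2 * I2)
    entry M z *: (delta_mx z.1.1 z.1.2 *t delta_mx z.2.1 z.2.2).
  apply/matrixP => i j; rewrite summxE.
  case: (mxtens_indexP i) => i1 i2; case: (mxtens_indexP j) => j1 j2.
  rewrite (bigD1 ((i1, j1), (i2, j2)))//= big1 => [|[[p q] [p' q']] nz].
    by rewrite mxE tensmxE !mxE !eqxx !mulr1 addr0.
  rewrite mxE tensmxE !mxE /=; move: nz; rewrite !xpair_eqE ![_ == i1]eq_sym ![_ == i2]eq_sym.
  rewrite ![_ == j1]eq_sym ![_ == j2]eq_sym.
  by case: (i1 == p); case: (j1 == q); case: (i2 == p'); case: (j2 == q') => //= _;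
    rewrite ?mulr0 ?mul0r ?mulr0.
rewrite mulmx_sumr mulmx_suml; apply: eq_bigr => z _.
by rewrite -scalemxAr -scalemxAl.
Qed.

Let pair_blockE (A B : 'M[F]_(2 * 2)) x p p' q q' :
  pair_block A B x (mxtens_index (p, p')) (mxtens_index (q, q')) =
  \sum_(k < 2) A (mxtens_index (p, x.1)) (mxtens_index (q, k)) *
                B (mxtens_index (p', k)) (mxtens_index (q', x.2)).
Proof. by rewrite summxE; apply: eq_bigr => k _; rewrite tensmxE !mxE. Qed.

Let pair_block_mulE (A B A' B' : 'M[F]_(2 * 2)) x y z : entry (pair_block A B x *m pair_block A' B' y) z =
  \sum_(v : I2) \sum_(w : I2)
    (A (mxtens_index (z.1.1, x.1)) (mxtens_index (v.1, w.1)) *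
     B (mxtens_index (z.2.1, w.1)) (mxtens_index (v.2, x.2))) *
    (A' (mxtens_index (v.1, y.1)) (mxtens_index (z.1.2, w.2)) *
     B' (mxtens_index (v.2, w.2)) (mxtens_index (z.2.2, y.2))).
Proof.
rewrite /entry mxE (reindex (@mxtens_index 2 2)) /=; last first.
  by exists (@mxtens_unindex 2 2) => i _; rewrite (mxtens_indexK, mxtens_unindexK).
apply: eq_bigr => -[q q'] _; rewrite !pair_blockE mulr_suml /=.
rewrite -(pair_bigA _ (fun k l =>
  (A (mxtens_index (z.1.1, x.1)) (mxtens_index (q, k)) *
   B (mxtens_index (z.2.1, k)) (mxtens_index (q', x.2))) *
  (A' (mxtens_index (q, y.1)) (mxtens_index (z.1.2, l)) *
   B' (mxtens_index (q', l)) (mxtens_index (z.2.2, y.2))))).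
by apply: eq_bigr => k _; rewrite mulr_sumr.
Qed.

(** Exchanging the two spaces conjugates by the flip, which is absorbed by [sym_coord] on the left
    and by the equal middle rows of [sym_basis] on the right. *)
Lemma sym_unitC x y : sym_unit x y = sym_unit y x.
Proof.
have coordC (v w : 'M[F]_(2 * 2, 3)) :
    (forall i1 i2 j, v (mxtens_index (i1, i2)) j = w (mxtens_index (i2, i1)) j) ->
    Cd *m v = Cd *m w.
  move=> h; have hf : v = flip_mx F 2 *m w.
    apply/matrixP => k j; case: (mxtens_indexP k) => k1 k2; rewrite h.
    rewrite mxE (bigD1 (mxtens_index (k2, k1)))//= big1 ?addr0 => [|l nl].
      by rewrite mxE !mxtens_indexK eqxx mul1r.
    rewrite mxE mxtens_indexK; case: eqP => [e|_]; last by rewrite mul0r.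
    case: (mxtens_indexP l) nl e => l1 l2; rewrite mxtens_indexK /= => nl [e1 e2].
    by rewrite e1 e2 eqxx in nl.
  rewrite hf mulmxA; congr (_ *m _).
  have := sym_coord_proj; rewrite /symproj -scalemxAr mulmxDr mulmx1 => /(congr1 ( *:%R 2)).
  rewrite scalerA divff// scale1r scaler_nat mulr2n => /addIr.
  exact.
rewrite /sym_unit -!mulmxA; apply: coordC => i1 i2 j.
rewrite !mxE !(reindex (@mxtens_index 2 2)) /=; first last.
- by exists (@mxtens_unindex 2 2) => i _; rewrite (mxtens_indexK, mxtens_unindexK).
- by exists (@mxtens_unindex 2 2) => i _; rewrite (mxtens_indexK, mxtens_unindexK).
rewrite (reindex_inj (h := fun k : I2 => (k.2, k.1))) /=; last by move=> [? ?] [? ?] [-> ->].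
apply: eq_bigr => -[k l] _; rewrite !tensmxE [X in X * _]mulrC; congr (_ * _).
by rewrite !mxE; case: j => [[|[|[|//]]] ?]; case: k => [[|[|//]] ?]; case: l => [[|[|//]] ?].
Qed.

(** The relation [P A P = A], in coordinates. *)
Definition flip_sym (A : 'M[F]_(2 * 2)) := forall p e q f,
  A (mxtens_index (p, e)) (mxtens_index (q, f)) = A (mxtens_index (e, p)) (mxtens_index (f, q)).

(** Blockwise form of [R^(2,1) Pi = R^(2,1)]. *)
Definition fusing (A B : 'M[F]_(2 * 2)) := forall x,
  Cd *m pair_block A B x *m Pi = Cd *m pair_block A B x.

(** Flipping every factor exchanges the roles of barred and unbarred spaces. Of the four operators
    the outer two stay in place and the middle two are interchanged, which is harmless because both
    are [B]. *)
Let entry_transpose A B B' (z y : I2 * I2) : flip_sym A -> flip_sym B -> flip_sym B' ->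
  entry (pair_block A B z.1 *m pair_block B B' z.2) y =
  entry (pair_block A B y.1 *m pair_block B B' y.2) z.
Proof.
move=> sA sB sB'; rewrite !pair_block_mulE exchange_big.
apply: eq_bigr => -[k l] _; apply: eq_bigr => -[q q'] _ /=.
by rewrite sA [B _ _ in X in X * _]sB [X in _ * (X * _)]sB sB' mulrACA.
Qed.

Lemma fused_flip A B B' : flip_sym A -> flip_sym B -> flip_sym B' ->
    fusing A B -> fusing B B' ->
  flip_mx F 3 *m (\sum_(z : I2 * I2)
    (fused_block A B z.2 *m fused_block B B' z.1) *t sym_unit z.1 z.2) *m flip_mx F 3 =
  \sum_(z : I2 * I2)
    (fused_block A B z.1 *m fused_block B B' z.2) *t sym_unit z.1 z.2.
Proof.
move=> sA sB sB' fAB fBB'; rewrite flip_sum_tensmx.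
(* Fusion removes the projection between the two blocks, so their product can be computed before
   compression. *)
have prodE x y : fused_block A B x *m fused_block B B' y =
    \sum_(z : I2 * I2) entry (pair_block A B x *m pair_block B B' y) z *: sym_unit z.1 z.2.
  rewrite -compress_sum /fused_block.
  transitivity (Cd *m pair_block A B x *m (Bs *m Cd) *m pair_block B B' y *m Bs).
    by rewrite !mulmxA.
  by rewrite (sym_coordK two0) fAB mulmxA.
under eq_bigr do rewrite prodE tensmx_sumr.
under [RHS]eq_bigr do rewrite prodE tensmx_suml.
rewrite exchange_big; apply: eq_bigr => y _ /=.
rewrite (reindex_inj (h := fun z : I2 * I2 => (z.2, z.1))) /=; last by move=> [? ?] [? ?] [-> ->].
apply: eq_bigr => z _.
by rewrite tensmxZr tensmxZl entry_transpose// sym_unitC.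
Qed.

(** After the flip both sides carry the same units; [cr1] and [cr2] then move [Q] through one block
    each, in the order reversed by transposition. *)
Lemma fused_crossing (Q : 'M[F]_3) A B B' A2 B2 B2' :
    flip_sym A -> flip_sym B -> flip_sym B' -> fusing A B -> fusing B B' ->
    (forall x, Q *m fused_block A2 B2 x = (fused_block B B' x)^T *m Q) ->
    (forall x, Q *m fused_block B2 B2' x = (fused_block A B x)^T *m Q) ->
  (Q *t 1%:M) *m (\sum_(z : I2 * I2)
    (fused_block A2 B2 z.2 *m fused_block B2 B2' z.1) *t sym_unit z.1 z.2) =
  ptrmx1 (flip_mx F 3 *m (\sum_(z : I2 * I2)
    (fused_block A B z.2 *m fused_block B B' z.1) *t sym_unit z.1 z.2) *m flip_mx F 3)
    *m (Q *t 1%:M).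
Proof.
move=> sA sB sB' fAB fBB' cr1 cr2; rewrite fused_flip// ptrmx1_sum_tensmx.
rewrite mulmx_sumr mulmx_suml; apply: eq_bigr => z _.
rewrite !tensmx_mul mul1mx mulmx1; congr (_ *t _).
by rewrite trmx_mul mulmxA cr1 -mulmxA cr2 mulmxA.
Qed.

End Fusion.

(** * Blocks of the eight-vertex matrix *)

Section EightVertex.
Variable F : fieldType.
Hypothesis two0 : 2 != 0 :> F.

Definition eight_vertex (a b c d : F) : 'M[F]_(2 * 2) :=
  mx_of_rows _ _ [:: [:: a; 0; 0; d]; [:: 0; b; c; 0]; [:: 0; c; b; 0]; [:: d; 0; 0; a]].

Lemma eight_vertex_flip_sym a b c d : flip_sym (eight_vertex a b c d).
Proof.
by move=> p e q f; rewrite !mxE; case: p => [[|[|//]] ?]; case: e => [[|[|//]] ?];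
  case: q => [[|[|//]] ?]; case: f => [[|[|//]] ?].
Qed.

Variables a b c d a' b' c' d' : F.
Local Notation X := (pair_block (eight_vertex a b c d) (eight_vertex a' b' c' d')).

Definition pair_block_rows (x : 'I_2 * 'I_2) : seq (seq F) :=
  match x.1 == 0, x.2 == 0 with
  | true, true => [:: [:: a * a'; 0; 0; d * c']; [:: 0; a * b'; d * d'; 0];
                     [:: 0; c * c'; b * a'; 0]; [:: c * d'; 0; 0; b * b']]
  | true, false => [:: [:: 0; a * d'; d * b'; 0]; [:: a * c'; 0; 0; d * a'];
                      [:: c * b'; 0; 0; b * d']; [:: 0; c * a'; b * c'; 0]]
  | false, true => [:: [:: 0; b * c'; c * a'; 0]; [:: b * d'; 0; 0; c * b'];
                      [:: d * a'; 0; 0; a * c']; [:: 0; d * b'; a * d'; 0]]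
  | false, false => [:: [:: b * b'; 0; 0; c * d']; [:: 0; b * a'; c * c'; 0];
                       [:: 0; d * d'; a * b'; 0]; [:: d * c'; 0; 0; a * a']]
  end.

Lemma pair_block_eight_vertex x : X x = mx_of_rows _ _ (pair_block_rows x).
Proof.
case: x => e f; apply/matrixP => i j; rewrite summxE !big_ord_recl big_ord0 addr0.
case: (mxtens_indexP i) => p p'; case: (mxtens_indexP j) => q q'; rewrite !tensmxE !mxE.
by case: p => [[|[|//]] ?]; case: p' => [[|[|//]] ?]; case: q => [[|[|//]] ?];
  case: q' => [[|[|//]] ?]; case: e => [[|[|//]] ?]; case: f => [[|[|//]] ?];
  rewrite /= ?(mul0r, mulr0, addr0, add0r).
Qed.

(** The middle coordinate adds two rows and the middle basis vector averages two columns, hence sums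
    in the middle row and halves in the middle column. *)
Definition fused_block_rows (x : 'I_2 * 'I_2) : seq (seq F) :=
  let h := (a * b' + c * c' + (b * a' + d * d')) / 2 in
  match x.1 == 0, x.2 == 0 with
  | true, true => [:: [:: a * a'; 0; d * c']; [:: 0; h; 0]; [:: c * d'; 0; b * b']]
  | true, false => [:: [:: 0; (a * d' + d * b') / 2; 0];
      [:: a * c' + c * b'; 0; d * a' + b * d']; [:: 0; (c * a' + b * c') / 2; 0]]
  | false, true => [:: [:: 0; (b * c' + c * a') / 2; 0];
      [:: b * d' + d * a'; 0; c * b' + a * c']; [:: 0; (d * b' + a * d') / 2; 0]]
  | false, false => [:: [:: b * b'; 0; c * d']; [:: 0; h; 0]; [:: d * c'; 0; a * a']]
  end.

Lemma fused_block_eight_vertex x :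
  fused_block (eight_vertex a b c d) (eight_vertex a' b' c' d') x =
  mx_of_rows 3 3 (fused_block_rows x).
Proof.
rewrite /fused_block pair_block_eight_vertex; case: x => e f; apply/matrixP => i j.
rewrite !mxE !big_ord_recl big_ord0 !mxE !big_ord_recl !big_ord0 !mxE.
by case: i => [[|[|[|//]]] ?]; case: j => [[|[|[|//]]] ?];
  case: e => [[|[|//]] ?]; case: f => [[|[|//]] ?]; rewrite /=; ring.
Qed.

Hypothesis AdDb : a * d' = d * b'.
Hypothesis BcCa : b * c' = c * a'.
Hypothesis sym_rel : a * b' + c * c' = b * a' + d * d'.

(** Reduces an entry identity to a combination [z] known to vanish; [ring] or [field] then checks
    [x - y = z]. *)
Lemma eq_of_sub (x y z : F) : z = 0 -> x - y = z -> x = y.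
Proof. by move=> -> /subr0_eq. Qed.

Lemma eight_vertex_fusing : fusing (eight_vertex a b c d) (eight_vertex a' b' c' d').
Proof.
have z1 : (a * d' - d * b') / 2 = 0 by rewrite AdDb subrr mul0r.
have z2 : (b * c' - c * a') / 2 = 0 by rewrite BcCa subrr mul0r.
have z3 : (a * b' + c * c' - (b * a' + d * d')) / 2 = 0 by rewrite sym_rel subrr mul0r.
move=> x; rewrite -(sym_coordK two0) mulmxA -/(fused_block _ _ x) fused_block_eight_vertex.
rewrite pair_block_eight_vertex; case: x => e f; apply/matrixP => i j.
do 2 rewrite ?mxE ?big_ord_recl ?big_ord0.
case: i => [[|[|[|//]]] ?]; case: j => [[|[|[|[|//]]]] ?];
  case: e => [[|[|//]] ?]; case: f => [[|[|//]] ?]; rewrite /=.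
all: try by ring.
(* Every remaining entry is, up to sign, one of the three relations halved. *)
all: first
  [ by apply: (eq_of_sub z1); field
  | by apply: (eq_of_sub z2); field | by apply: (eq_of_sub z3); field
  | by apply/esym/(eq_of_sub z1); field | by apply/esym/(eq_of_sub z2); field
  | by apply/esym/(eq_of_sub z3); field ].
Qed.

End EightVertex.

Section BlockCrossing.
Variable F : fieldType.
Hypothesis two0 : 2 != 0 :> F.

(** Q written with the squares of [xi] and [eta]: [al] and [de] will be [(1 + eta^2) / 2] and
    [(1 - eta^2) / 2]. *)
Definition crossing_mx (xi2 al de : F) : 'M[F]_3 :=
  mx_of_rows 3 3 [:: [:: al; 0; de]; [:: 0; xi2; 0]; [:: de; 0; al]].

Variables a b c d a' b' c' d' xi2 al de : F.
Hypothesis AdDb : a * d' = d * b'.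
Hypothesis BcCa : b * c' = c * a'.
Hypothesis diag : al * (a * a' - b * b') = de * (d * c' - c * d').
Hypothesis mixed1 : al * (a * d') + de * (b * c') = - xi2 * (a * c' + c * b').
Hypothesis mixed2 : de * (a * d') + al * (b * c') = - xi2 * (b * d' + d * a').

(** The left block is the crossed one: weights [- b, - a, c, d] as in [weights_crossing], with the
    two factors in reverse order. *)
Lemma fused_block_crossing x :
  crossing_mx xi2 al de *m
    fused_block (eight_vertex (- b') (- a') c' d') (eight_vertex (- b) (- a) c d) x =
  (fused_block (eight_vertex a b c d) (eight_vertex a' b' c' d') x)^T
    *m crossing_mx xi2 al de.
Proof.
have z1 : al * (a * a' - b * b') - de * (d * c' - c * d') = 0 by rewrite diag subrr.
have e1 : a * d' - d * b' = 0 by rewrite AdDb subrr.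
have e2 : b * c' - c * a' = 0 by rewrite BcCa subrr.
(* The fused blocks contain the averages of [a d'] and [d b'], and of [b c'] and [c a']; the added
   halves of [e1] and [e2] adapt the mixed relations to them. *)
have z2 : - xi2 * (a * c' + c * b') - (al * (a * d') + de * (b * c')) +
    (al * (a * d' - d * b') + de * (b * c' - c * a')) / 2 = 0.
  by rewrite e1 e2 mixed1 subrr !mulr0 addr0 mul0r addr0.
have z3 : - xi2 * (b * d' + d * a') - (de * (a * d') + al * (b * c')) +
    (de * (a * d' - d * b') + al * (b * c' - c * a')) / 2 = 0.
  by rewrite e1 e2 mixed2 subrr !mulr0 addr0 mul0r addr0.
rewrite !fused_block_eight_vertex; case: x => e f; apply/matrixP => i j.
do 2 rewrite ?mxE ?big_ord_recl ?big_ord0.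
case: i => [[|[|[|//]]] ?]; case: j => [[|[|[|//]]] ?];
  case: e => [[|[|//]] ?]; case: f => [[|[|//]] ?]; rewrite /=.
all: first
  [ by ring | by apply: (eq_of_sub z1); ring | by apply/esym/(eq_of_sub z1); ring
  | by apply: (eq_of_sub z2); field | by apply: (eq_of_sub z3); field ].
Qed.

End BlockCrossing.

(** * Crossing of the fused matrix *)

Section FusedCrossing.
Variable R : realType.
Local Notation C := R[i].
Variables K K' lambda : C.
Hypothesis tau0 : 0 < complex.Im (tau K K').
Hypothesis x1 : `|xx K lambda| < 1.

Local Notation r := (rr K' lambda).
Local Notation t := (tau K K').
Local Notation th1 := (theta1 K K' lambda).
Local Notation th2 := (theta2 K K' lambda).
Local Notation regular := (R_regular K K' lambda).
Local Notation wa := (wa K K' lambda).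
Local Notation wb := (wb K K' lambda).
Local Notation wc := (wc K K' lambda).
Local Notation wd := (wd K K' lambda).
Local Notation xi2 := (xi_sq K K' lambda).
Local Notation eta2 := (eta_sq K K' lambda).

Hypothesis Z1 : vartheta0 (1 / r) t != 0.
Hypothesis M1 : vartheta2 (1 / r) t != 0.
Hypothesis P1 : vartheta3 (1 / r) t != 0.

Lemma Rmx_eight_vertex u : Rmx K K' lambda u = eight_vertex (wa u) (wb u) (wc u) (wd u).
Proof.
rewrite /Rmx /wa /wb /wc /wd.
move: (R0 _ _ _ _) (Ra _ _ _ _) (Rb _ _ _ _) (Rc _ _ _ _) (Rd _ _ _ _) => s a b c d.
apply/matrixP => i j; rewrite !mxE.
by case: i => [[|[|[|[|//]]]] ?]; case: j => [[|[|[|[|//]]]] ?]; rewrite /= ?mulr0.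
Qed.

Let two0 : 2 != 0 :> C. Proof. by rewrite pnatr_eq0. Qed.

Let r0 : r != 0.
Proof. by rewrite /rr mulf_neq0 ?invr_eq0 ?(K'_neq0 tau0) ?(lambda_neq0 x1). Qed.

Let al := (1 + eta2) / 2.
Let de := (1 - eta2) / 2.

Lemma theta_relations v : exists2 c, c != 0 &
  [/\ th1 (1 + (v + 1)) * th1 v * th2 0 ^+ 2 =
        th1 (v + 1) ^+ 2 * th2 1 ^+ 2 - th2 (v + 1) ^+ 2 * th1 1 ^+ 2,
      th2 (1 + (v + 1)) * th2 v * th2 0 ^+ 2 =
        th2 (v + 1) ^+ 2 * th2 1 ^+ 2 - th1 (v + 1) ^+ 2 * th1 1 ^+ 2 &
      (th1 (1 + (v + 1)) * th2 v + th2 (1 + (v + 1)) * th1 v) * vartheta0 0 t =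
        2 * (th1 (v + 1) * th2 (v + 1)) * vartheta0 (1 / r) t] /\
  [/\ th1 1 ^+ 2 = c * (vartheta3 (1 / r) t * vartheta2 0 t - vartheta2 (1 / r) t * vartheta3 0 t),
      th2 1 ^+ 2 = c * (vartheta3 (1 / r) t * vartheta2 0 t + vartheta2 (1 / r) t * vartheta3 0 t) &
      th2 0 ^+ 2 = 2 * c * vartheta3 0 t * vartheta2 0 t].
Proof.
have [c c0 hc] := vartheta1_addition tau0; exists c; first exact: c0.
apply: (@addition_relations _ (fun y => vartheta1 y (t / 2)) (fun y => vartheta3 y t)
  (fun y => vartheta2 y t) (fun y => vartheta0 y t) th1 th2 c r v hc).
- by move=> y; apply: vartheta1D1; apply: Im_half_gt0.
- by move=> y; apply: vartheta2D1.
- by move=> y; apply: vartheta3D1.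
- by move=> y; apply: vartheta3D_half.
- exact: r0.
- by move=> k; rewrite /theta1.
- by move=> k; rewrite /theta2 /vartheta2.
Qed.

(** The relations between theta quotients, with both sides multiplied by the values of [R0] at
    [v + 1] and at [v]. *)
Lemma weight_relations v : regular (v + 1) -> regular v ->
  [/\ wa (v + 1) * wd v = wd (v + 1) * wb v,
      wb (v + 1) * wc v = wc (v + 1) * wa v &
      wa (v + 1) * wb v + wc (v + 1) * wc v = wb (v + 1) * wa v + wd (v + 1) * wd v] /\
  [/\ al * (wa (v + 1) * wa v - wb (v + 1) * wb v) =
        de * (wd (v + 1) * wc v - wc (v + 1) * wd v),
      al * (wa (v + 1) * wd v) + de * (wb (v + 1) * wc v) =
        - xi2 * (wa (v + 1) * wc v + wc (v + 1) * wb v) &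
      de * (wa (v + 1) * wd v) + al * (wb (v + 1) * wc v) =
        - xi2 * (wb (v + 1) * wd v + wd (v + 1) * wa v)].
Proof.
move=> /and3P[nf2 ng2 _] /and3P[nf1 ng1 _].
have [c nc [[add1 add2 mix] [sqk sqh sqg]]] := theta_relations v.
have nP0 := vartheta3_0_neq0 tau0; have nM0 := vartheta2_0_neq0 tau0.
have nZ0 := vartheta0_0_neq0 tau0; have ng := theta2_0_neq0 lambda tau0.
rewrite /wa /wb /wc /wd /Ra /Rb /Rc /Rd /al /de /xi_sq /eta_sq.
move: nf1 ng1 nf2 ng2 nc add1 add2 mix sqk sqh sqg nP0 nM0 nZ0 ng Z1 M1.
rewrite (addrC 1 v).
move: (th1 (v + 1)) (th2 (v + 1)) => f1 g1.
move: (th1 (1 + (v + 1))) (th2 (1 + (v + 1))) (th1 v) (th2 v) => f2 g2 f0 g0.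
move: (th1 1) (th2 1) (th2 0) (R0 _ _ _ _) (R0 _ _ _ _) => k h g s' s.
move: (vartheta0 0 t) (vartheta2 0 t) (vartheta3 0 t) => Z0 M0 P0.
move: (vartheta0 _ t) (vartheta2 _ t) (vartheta3 _ t) => Z' M' P'.
move=> nf1 ng1 nf2 ng2 nc add1 add2 mix sqk sqh sqg nP0 nM0 nZ0 ng nZ1 nM1.
have := fusion_AdDb f0 k h nf1 ng1 ng2 ng; have := fusion_BcCa g0 k h nf1 nf2 ng1 ng.
have := fusion_sym nf1 nf2 ng1 ng2 ng add1 add2.
have := crossing_diag two0 f0 g0 nf1 nf2 ng1 ng2 ng nc nP0 nM1 sqk sqh.
have := crossing_mixed1 two0 nf1 nf2 ng1 ng2 ng nc nZ0 nZ1 nP0 nM0 nM1 add1 add2 mix sqk sqh sqg.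
have := crossing_mixed2 two0 nf1 nf2 ng1 ng2 ng nc nZ0 nZ1 nP0 nM0 nM1 add1 add2 mix sqk sqh sqg.
move: (_ / 2) (_ / 2) (- 2^-1 * _) => al' be xi.
move: (h * g1 / (g * g2)) (h * f1 / (g * f2)) (k * g1 / (g * f2)) (k * f1 / (g * g2)) => A B C' D.
move: (h * g0 / (g * g1)) (h * f0 / (g * f1)) (k * g0 / (g * f1)) (k * f0 / (g * g1)) => a b c' d.
move=> E6 E5 E4 E3 E2 E1; split; split.
- by rewrite mulrACA E1; ring.
- by rewrite mulrACA E2; ring.
- by transitivity (s * s' * (A * b + C' * c')); [ring|rewrite E3; ring].
- by transitivity (s * s' * (al' * (A * a - B * b))); [ring|rewrite E4; ring].
- by transitivity (s * s' * (al' * (A * - d) + be * (B * c'))); [ring|rewrite E5; ring].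
by transitivity (s * s' * (be * (A * - d) + al' * (B * c'))); [ring|rewrite E6; ring].
Qed.

Lemma R22_expansion u : R22 K K' lambda u =
  \sum_(z : ('I_2 * 'I_2) * ('I_2 * 'I_2))
    (fused_block (Rmx K K' lambda (u + 1)) (Rmx K K' lambda u) z.2 *m
     fused_block (Rmx K K' lambda u) (Rmx K K' lambda (u - 1)) z.1) *t sym_unit C z.1 z.2.
Proof. by rewrite /R22 /R21 (fused_expansion two0) subrK. Qed.

Lemma R_fusing v : regular (v + 1) -> regular v ->
  fusing (Rmx K K' lambda (v + 1)) (Rmx K K' lambda v).
Proof.
move=> h1 h0; have [[e1 e2 e3] _] := weight_relations h1 h0.
by rewrite !Rmx_eight_vertex; apply: eight_vertex_fusing.
Qed.

Lemma R_block_crossing v x : regular (v + 1) -> regular v ->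
    regular (- (v + 1) - 1) -> regular (- v - 1) ->
  crossing_mx xi2 al de *m
    fused_block (Rmx K K' lambda (- v - 1)) (Rmx K K' lambda (- (v + 1) - 1)) x =
  (fused_block (Rmx K K' lambda (v + 1)) (Rmx K K' lambda v) x)^T *m crossing_mx xi2 al de.
Proof.
move=> h1 h0 k1 k0; have [[e1 e2 _] [e3 e4 e5]] := weight_relations h1 h0.
rewrite !Rmx_eight_vertex.
have [-> -> -> ->] := weights_crossing tau0 x1 h0 k0.
have [-> -> -> ->] := weights_crossing tau0 x1 h1 k1.
exact: fused_block_crossing.
Qed.

Lemma R22_crossing_mul u : R22_regular K K' lambda u -> R22_regular K K' lambda (- u - 1) ->
  (crossing_mx xi2 al de *t 1%:M) *m R22 K K' lambda (- u - 1) =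
  ptrmx1 (flip_mx _ 3 *m R22 K K' lambda u *m flip_mx _ 3) *m (crossing_mx xi2 al de *t 1%:M).
Proof.
move=> /and3P[h2 h1 h0] /and3P[k0 k1 k2].
(* The second pair [(u, u - 1)] is [(v + 1, v)] at [v = u - 1]. *)
have eu : u - 1 + 1 = u by rewrite subrK.
have e0 : - u - 1 + 1 = - (u - 1) - 1 by ring.
have e2 : - u - 1 - 1 = - (u + 1) - 1 by ring.
have hu : regular (u - 1 + 1) by rewrite eu.
have ku : regular (- (u - 1 + 1) - 1) by rewrite eu.
rewrite e0 in k0; rewrite e2 in k2.
have sym v : flip_sym (Rmx K K' lambda v).
  by rewrite Rmx_eight_vertex; apply: eight_vertex_flip_sym.
rewrite (R22_expansion (- u - 1)) (R22_expansion u).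
apply: (fused_crossing two0 (sym _) (sym _) (sym _) (R_fusing h2 h1)).
- by have := R_fusing hu h0; rewrite eu.
- by move=> x; rewrite e0; have := R_block_crossing x hu h0 ku k0; rewrite eu.
- by move=> x; rewrite e2; exact: (R_block_crossing x h2 h1 k2 k1).
Qed.

Let xi2_neq0 : xi2 != 0.
Proof.
have P0 := vartheta3_0_neq0 tau0; have Z0 := vartheta0_0_neq0 tau0.
rewrite /xi_sq; move: P0 Z0 P1 Z1.
move: (vartheta3 _ t) (vartheta3 _ t) (vartheta0 _ t) (vartheta0 _ t) => a b e f a0 b0 e0 f0.
by rewrite mulf_neq0 ?oppr_eq0 ?invr_eq0// mulf_neq0 ?invr_eq0// mulf_neq0.
Qed.

Let eta2_neq0 : eta2 != 0.
Proof.
have P0 := vartheta3_0_neq0 tau0; have M0 := vartheta2_0_neq0 tau0.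
rewrite /eta_sq; move: P0 M0 P1 M1.
move: (vartheta3 _ t) (vartheta3 _ t) (vartheta2 _ t) (vartheta2 _ t) => a b e f a0 b0 e0 f0.
by rewrite oppr_eq0 mulf_neq0 ?invr_eq0// mulf_neq0.
Qed.

(** Q has eigenvalues 1, [xi^2], [eta^2] in an orthogonal basis independent of them, so its inverse
    has the same form with inverted parameters. *)
Lemma crossing_mx_unit : crossing_mx xi2 al de \in unitmx.
Proof.
have := xi2_neq0; have := eta2_neq0; rewrite /al /de.
move: xi2 eta2 => x y y0 x0.
suff /mulmx1_unit[] : crossing_mx x ((1 + y) / 2) ((1 - y) / 2) *m
  crossing_mx x^-1 ((1 + y^-1) / 2) ((1 - y^-1) / 2) = 1%:M by [].
apply/matrixP => i j; do 2 rewrite ?mxE ?big_ord_recl ?big_ord0.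
by case: i => [[|[|[|//]]] ?]; case: j => [[|[|[|//]]] ?]; rewrite /=; field; rewrite ?x0 ?y0.
Qed.

End FusedCrossing.

Lemma QmxE (R : realType) (xi eta : R[i]) : Qmx xi eta =
  2^-1 *: mx_of_rows 3 3 [:: [:: 1 + eta ^+ 2; 0; 1 - eta ^+ 2];
                             [:: 0; 2 * xi ^+ 2; 0];
                             [:: 1 - eta ^+ 2; 0; 1 + eta ^+ 2]].
Proof.
have two0 : 2 != 0 :> R[i] by rewrite pnatr_eq0.
have ss : ((Num.sqrt (2 : R))^-1)%:C * ((Num.sqrt (2 : R))^-1)%:C = 2^-1 :> R[i].
  by rewrite -rmorphM -invfM -expr2 sqr_sqrtr// fmorphV rmorph_nat.
rewrite /Qmx /Umx; move: (_%:C) ss => s ss.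
apply/matrixP => i j; do 4 rewrite ?mxE ?big_ord_recl ?big_ord0.
case: i => [[|[|[|//]]] ?]; case: j => [[|[|[|//]]] ?]; rewrite /=.
all: rewrite ?(mul0r, mulr0, addr0, add0r, mul1r, mulr1).
all: first [by [] | by rewrite mulrA mulVf// mul1r expr2 | by rewrite -ss; ring].
Qed.

Theorem corollary2p5 (R : realType) (K K' lambda xi eta : R[i])
    (tau_upper : 0 < complex.Im (tau K K'))
    (x_lt1 : `|xx K lambda| < 1)
    (vartheta0_neq0 : vartheta0 (1 / rr K' lambda) (tau K K') != 0)
    (vartheta2_neq0 : vartheta2 (1 / rr K' lambda) (tau K K') != 0)
    (vartheta3_neq0 : vartheta3 (1 / rr K' lambda) (tau K K') != 0)
    (xi2 : xi ^+ 2 = xi_sq K K' lambda)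
    (eta2 : eta ^+ 2 = eta_sq K K' lambda) :
  Qmx xi eta =
    2^-1 *: mx_of_rows 3 3 [:: [:: 1 + eta ^+ 2; 0; 1 - eta ^+ 2];
                               [:: 0; 2 * xi ^+ 2; 0];
                               [:: 1 - eta ^+ 2; 0; 1 + eta ^+ 2]]
  /\ forall u : R[i],
       R22_regular K K' lambda u -> R22_regular K K' lambda (- u - 1) ->
       R22 K K' lambda (- u - 1) =
         (invmx (Qmx xi eta) *t 1%:M)
         *m ptrmx1 (flip_mx _ 3 *m R22 K K' lambda u *m flip_mx _ 3)
         *m (Qmx xi eta *t 1%:M).
Proof.
split=> [|u hu hu']; first exact: QmxE.
have two0 : 2 != 0 :> R[i] by rewrite pnatr_eq0.
(* Q depends on [xi] and [eta] only through their squares, so any choice of the square roots is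
   covered. *)
have -> : Qmx xi eta = crossing_mx (xi_sq K K' lambda)
    ((1 + eta_sq K K' lambda) / 2) ((1 - eta_sq K K' lambda) / 2).
  rewrite QmxE xi2 eta2; move: (xi_sq _ _ _) (eta_sq _ _ _) => x y.
  apply/matrixP => i j; rewrite !mxE.
  by case: i => [[|[|[|//]]] ?]; case: j => [[|[|[|//]]] ?]; rewrite /=; field.
rewrite -mulmxA -R22_crossing_mul// mulmxA tensmx_mul mulmx1 mulVmx ?crossing_mx_unit//.
by rewrite tensmx11 mul1mx.
Qed.
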